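(* Let $E$ be a de Branges function with associated de Branges space $\mathcal{H}(E)$, and let $\mathcal{N}$ be a nearly invariant (norm-closed) subspace of $\mathcal{H}(E)$ with no common zeros. Then there exist a de Branges space $\mathcal{H}(E_0)$ (for some de Branges function $E_0$) and $\alpha \in \mathbb{R}$ such that $$\mathcal{N} = e^{i\alpha z}\mathcal{H}(E_0) = \{ e^{i\alpha z} f(z) : f \in \mathcal{H}(E_0)\}.$$
   Context: Let $\mathbb{C}^+ = \{z \in \mathbb{C} : \operatorname{Im} z > 0\}$, and let $H^2(\mathbb{C}^+)$ be the usual Hardy space of the upper half plane. For an entire function $f$ put $f^*(z) := \overline{f(\overline{z})}$. A de Branges function is an entire function $E$ with $|E(z)| > |E(\overline{z})|$ for all $z \in \mathbb{C}^+$. The associated de Branges space $\mathcal{H}(E)$ is the Hilbert space of entire functions $f$ such that $f/E \in H^2(\mathbb{C}^+)$, $f^*/E \in H^2(\mathbb{C}^+)$, and $\|f\|_{\mathcal{H}(E)}^2 := \int_{\mathbb{R}} |f/E|^2\,dx < \infty$; this last expression defines the norm. It is a reproducing kernel Hilbert space with kernel $k_E(\lambda,z) = \frac{E(z)\overline{E(\lambda)} - E^*(z)\overline{E^*(\lambda)}}{2\pi i(\overline{\lambda} - z)}$. Subspaces are always norm-closed. A subspace $\mathcal{N}$ of $\mathcal{H}(E)$ has no common zeros if there is no $\lambda \in \mathbb{C}$ with $f(\lambda) = 0$ for all $f \in \mathcal{N}$. A subspace $\mathcal{N}$ with no common zeros is nearly invariant if whenever $f \in \mathcal{N}$, $\lambda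 \in \mathbb{C}$ and $f(\lambda) = 0$, the function $f(z)/(z-\lambda)$ belongs to $\mathcal{N}$. *)

(* Defs.v *)
From HB Require Import structures.
From mathcomp Require Import all_boot all_order all_algebra.
From mathcomp Require Import all_classical all_reals all_analysis.
From mathcomp Require Import complex.

Set Implicit Arguments.
Unset Strict Implicit.
Unset Printing Implicit Defensive.

Import Order.TTheory GRing.Theory Num.Theory.
Import numFieldNormedType.Exports.
Export numFieldNormedType.Exports.

Local Open Scope classical_set_scope.
Local Open Scope complex_scope.
Local Open Scope ring_scope.

Section DeBranges.
Context {R : realType}.
Local Notation C := R[i].
Local Notation mu := (@lebesgue_measure R).

(* [^o] puts on R[i] its structure of normed module over itself, so that the
   increments in the difference quotient are complex. *)
Definition holomorphic_at (f : C -> C) (z : C) : Prop :=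
  derivable (f : C^o -> C^o) z 1.

Definition entire (f : C -> C) : Prop := forall z, holomorphic_at f z.

Definition upper_half_plane : set C := [set z : C | 0 < complex.Im z].

Definition fstar (f : C -> C) : C -> C := fun z => (f z^*%C)^*%C.

(* The modulus as an element of R (the norm [`|z|] lives in R[i]). *)
Definition cabs (z : C) : R := ComplexField.Normc.normc z.

Definition cexp (z : C) : C :=
  ((expR (complex.Re z) * cos (complex.Im z)) +i*
   (expR (complex.Re z) * sin (complex.Im z)))%C.

Definition hardy2 : set (C -> C) :=
  [set F | (forall z, upper_half_plane z -> holomorphic_at F z) /\
    (ereal_sup [set \int[mu]_x (cabs (F (x +i* y)%C) ^+ 2)%:E
               | y in `]0%R, +oo[%classic] < +oo)%E].

Definition de_branges_function (E : C -> C) : Prop :=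
  entire E /\ forall z, upper_half_plane z -> cabs (E z^*%C) < cabs (E z).

(* The real zeros of E, where the quotient takes the value 0, form a null
   set. *)
Definition db_sqnorm (E f : C -> C) : \bar R :=
  (\int[mu]_x (cabs (f x%:C%C / E x%:C%C) ^+ 2)%:E)%E.

Definition db_space (E : C -> C) : set (C -> C) :=
  [set f | [/\ entire f,
               hardy2 (fun z => f z / E z),
               hardy2 (fun z => fstar f z / E z)
             & (db_sqnorm E f < +oo)%E]].

Definition db_norm (E f : C -> C) : R := Num.sqrt (fine (db_sqnorm E f)).

Definition linear_subspace (N : set (C -> C)) : Prop :=
  [/\ N (fun=> 0),
      forall f g, N f -> N g -> N (fun z => f z + g z)
    & forall (c : C) f, N f -> N (fun z => c * f z)].

Definition norm_closed (E : C -> C) (N : set (C -> C)) : Prop :=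
  forall f, db_space E f ->
    (forall e : R, 0 < e ->
       exists2 g, N g & db_norm E (fun z => f z - g z) < e) ->
    N f.

Definition closed_subspace (E : C -> C) (N : set (C -> C)) : Prop :=
  [/\ N `<=` db_space E, linear_subspace N & norm_closed E N].

Definition no_common_zeros (N : set (C -> C)) : Prop :=
  ~ exists l : C, forall f, N f -> f l = 0.

(* The entire function f(z) / (z - l), for f entire with f(l) = 0: its value
   at the removable singularity l is f'(l). *)
Definition divide_zero (f : C -> C) (l : C) : C -> C :=
  fun z => if z == l then 'D_1 (f : C^o -> C^o) l else f z / (z - l).

Definition nearly_invariant (N : set (C -> C)) : Prop :=
  forall f l, N f -> f l = 0 -> N (divide_zero f l).

(* e^{i a z} M *)
Definition exp_shift (a : R) (M : set (C -> C)) : set (C -> C) :=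
  [set (fun z => cexp ('i%C * a%:C%C * z) * f z) | f in M].

End DeBranges.

(* Main.v *)
(** The subspace N has reproducing kernels K_w. By near invariance at i and -i,
    multiplication by (z + i)/(z - i) is an isometry of {f in N | f(i) = 0} onto
    {f in N | f(-i) = 0}; comparing the kernels of these two spaces gives
      2 pi i (w^* - z) K_w(z) = A(z) A(w)^* - B(z) B(w)^*,
    where A is a multiple of (z + i) K_i and B one of (z - i) K_{-i}. Hence
    |A| > |B| in the upper half-plane, A A^* = B B^*, and U := A/B^* is entire
    without zeros and satisfies U U^* = 1. In the upper half-plane U is a multiple
    of the quotient of the zero-free functions K_i/E and (K_{-i})^*/E; these are
    O((Im z)^(-1/2)), so the real parts of their logarithms are at most m + 1/Im z,
    which bounds the logarithm of U by a polynomial in |z| and 1/|Im z|. By a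
    Liouville argument this logarithm is linear: U = c e^{2 i alpha z}. Then
    E0 := e^{-i alpha z} A satisfies B = c e^{2 i alpha z} A^*, so that H(E0) and
    e^{-i alpha z} N have the same reproducing kernels and are equal. *)

Require Import Defs.
From mathcomp Require Import all_boot all_order all_algebra.
From mathcomp Require Import all_classical all_reals all_analysis.
From mathcomp Require Import complex ring lra measurable_realfun.

Set Implicit Arguments.
Unset Strict Implicit.
Unset Printing Implicit Defensive.

Import Order.TTheory GRing.Theory Num.Theory.
Import numFieldNormedType.Exports.

Local Open Scope classical_set_scope.
Local Open Scope complex_scope.
Local Open Scope ring_scope.

(** * Complex differentiation *)

Section Calculus.
Context {R : realType}.
Local Notation C := R[i].
Local Notation re := (@complex.Re R).
Local Notation im := (@complex.Im R).
Implicit Types (z w v : C) (f g : C -> C).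

(** The kernel at w of the functions of N that vanish at i is K_w minus its component along K_i, and
    likewise at -i. A unitary multiplication carries kernel to kernel; clearing denominators turns
    this into the identity for A and B. In it, w = z gives |A|^2 - |B|^2 = 4 pi (Im z) K_z(z),
    positive above the axis because N has no common zeros, and taking for w the conjugate of z gives
    A A^* = B B^*. A real zero of E would be a common zero of N. So f/E is holomorphic across the
    real line, its boundary values are ordinary values, and the Hardy space theory reduces to
    contour integrals over rectangles. Poisson's formula then gives pi (Im z) |f/E|^2 <= ||f||^2,
    the source of the exponent -1/2. The relation U U^* = 1 serves twice: it reflects the growth
    bound into the lower half-plane, and it makes alpha real. The kernels of the two final spaces
    are compared at nonreal w only, where the contour argument works; continuity settles the real
    points. *)

Lemma cabs_ge0 z : 0 <= cabs z.
Proof. by case: z => a b; rewrite /cabs /= sqrtr_ge0. Qed.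

Lemma cabs0 : cabs (0 : C) = 0. Proof. exact: ComplexField.Normc.normc0. Qed.
Lemma cabs1 : cabs (1 : C) = 1. Proof. exact: ComplexField.Normc.normc1. Qed.

Lemma cabsM z w : cabs (z * w) = cabs z * cabs w.
Proof. exact: ComplexField.Normc.normcM. Qed.

Lemma cabsV z : cabs z^-1 = (cabs z)^-1.
Proof. exact: ComplexField.Normc.normcV. Qed.

Lemma cabs_div z w : cabs (z / w) = cabs z / cabs w.
Proof. by rewrite cabsM cabsV. Qed.

Lemma cabsN z : cabs (- z) = cabs z. Proof. exact: normcN. Qed.

Lemma cabsX z n : cabs (z ^+ n) = cabs z ^+ n.
Proof. by elim: n => [|n IH]; rewrite ?expr0 ?cabs1 // !exprS cabsM IH. Qed.

Lemma ler_cabsD z w : cabs (z + w) <= cabs z + cabs w.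
Proof. exact: le_normcD. Qed.

Lemma cabsBC z w : cabs (z - w) = cabs (w - z).
Proof. by rewrite -cabsN opprB. Qed.

Lemma ler_cabsB z w : cabs (z - w) <= cabs z + cabs w.
Proof. by rewrite -[cabs w]cabsN ler_cabsD. Qed.

Lemma ler_cabs_sub z w : cabs z - cabs w <= cabs (z - w).
Proof. by rewrite lerBlDr -{1}[z](subrK w) ler_cabsD. Qed.

Lemma cabs_eq0 z : (cabs z == 0) = (z == 0).
Proof.
by apply/eqP/eqP => [/ComplexField.Normc.eq0_normc|->] //; rewrite cabs0.
Qed.

Lemma cabs_gt0 z : (0 < cabs z) = (z != 0).
Proof. by rewrite lt_def cabs_ge0 cabs_eq0 andbT. Qed.

Lemma cabs_sqr z : cabs z ^+ 2 = re z ^+ 2 + im z ^+ 2.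
Proof. by case: z => a b; rewrite /cabs /= sqr_sqrtr // addr_ge0 ?sqr_ge0. Qed.

Lemma cabs_conj z : cabs z^*%C = cabs z.
Proof. by case: z => a b; rewrite /cabs /= sqrrN. Qed.

Lemma cabs_real (x : R) : cabs x%:C = `|x|.
Proof. by rewrite /cabs /= expr0n /= addr0 sqrtr_sqr. Qed.

Lemma cabs_re z : `|re z| <= cabs z.
Proof.
by rewrite -(ler_pXn2r (ltn0Sn 1)) ?nnegrE ?cabs_ge0 // cabs_sqr real_normK
  ?num_real // lerDl sqr_ge0.
Qed.

Lemma cabs_im z : `|im z| <= cabs z.
Proof.
by rewrite -(ler_pXn2r (ltn0Sn 1)) ?nnegrE ?cabs_ge0 // cabs_sqr real_normK
  ?num_real // lerDr sqr_ge0.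
Qed.

Lemma cabs_le_reim z : cabs z <= `|re z| + `|im z|.
Proof.
rewrite -(ler_pXn2r (ltn0Sn 1)) ?nnegrE ?cabs_ge0 ?addr_ge0 // cabs_sqr.
rewrite sqrrD !real_normK ?num_real // -addrA lerD2l lerDr.
by rewrite mulrn_wge0 // mulr_ge0.
Qed.

Lemma re_add z w : re (z + w) = re z + re w. Proof. by case: z; case: w. Qed.
Lemma im_add z w : im (z + w) = im z + im w. Proof. by case: z; case: w. Qed.
Lemma re_opp z : re (- z) = - re z. Proof. by case: z. Qed.
Lemma im_opp z : im (- z) = - im z. Proof. by case: z. Qed.
Lemma re_mul z w : re (z * w) = re z * re w - im z * im w.
Proof. by case: z; case: w. Qed.
Lemma im_mul z w : im (z * w) = re z * im w + im z * re w.
Proof. by case: z => a b; case: w => c d /=. Qed.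
Lemma re_conj z : re z^*%C = re z. Proof. by case: z. Qed.
Lemma im_conj z : im z^*%C = - im z. Proof. by case: z. Qed.

Lemma complex_ext z w : re z = re w -> im z = im w -> z = w.
Proof. by case: z => a b; case: w => c d /= -> ->. Qed.

Lemma conjcD z w : conjc (z + w) = conjc z + conjc w. Proof. exact: rmorphD. Qed.
Lemma conjcB z w : conjc (z - w) = conjc z - conjc w. Proof. exact: rmorphB. Qed.
Lemma conjcM z w : conjc (z * w) = conjc z * conjc w. Proof. exact: rmorphM. Qed.
Lemma conjc_i : ('i%C : C)^*%C = - 'i%C.
Proof. by apply: complex_ext => /=; rewrite ?oppr0. Qed.
Lemma conjc_Ni : (- 'i%C : C)^*%C = 'i%C. Proof. by rewrite -conjc_i conjcK. Qed.
Lemma conjc_2 : (2 : C)^*%C = 2. Proof. exact: rmorph_nat. Qed.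

Lemma mulc_conj z : z * z^*%C = ((cabs z ^+ 2)%:C)%C.
Proof.
rewrite cabs_sqr; case: z => a b /=.
by apply: complex_ext => /=; ring.
Qed.

(** Epsilon and delta are real here and measured by [cabs], whereas the topology of [R[i]] has radii
    in [R[i]]; [hasdP] is the bridge between the two. *)
Definition ccont f z : Prop := forall e : R, 0 < e -> exists2 d : R, 0 < d &
  forall v, cabs (v - z) < d -> cabs (f v - f z) < e.

Definition hasd f z (d : C) : Prop := forall e : R, 0 < e ->
  exists2 r : R, 0 < r & forall v, cabs (v - z) < r ->
    cabs (f v - f z - d * (v - z)) <= e * cabs (v - z).

Lemma normC_cabs z : `|z| = (cabs z)%:C.
Proof. by case: z. Qed.

(** A positive element of [R[i]] has imaginary part 0, so complex and real radii amount to the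
    same. *)
Lemma hasdP f z d : hasd f z d <-> is_derive (z : C^o) 1 (f : C^o -> C^o) d.
Proof.
split.
- move=> H.
  have L : (fun h : C^o => h^-1 *: (((f : C^o -> C^o) \o shift (z : C^o)) (h *: (1 : C^o))
      - (f : C^o -> C^o) z)) @ (0 : C^o)^' --> (d : C^o); last first.
    apply: DeriveDef; first by apply/cvg_ex; exists d.
    exact: cvg_lim L.
  apply/cvgrPdist_le => /= e e0.
  have er : (0 < re e) && (e == (re e)%:C).
    move: e0; rewrite ltcE /= => /andP[/eqP ei ->] /=.
    by apply/eqP/complex_ext.
  case/andP: er => er /eqP ee.
  have [r r0 Hr] := H _ er.
  exists (r%:C) => /=; first by rewrite ltcR.
  move=> h /=; rewrite sub0r normrN normC_cabs ltcR => hr h0.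
  rewrite normC_cabs ee lecR.
  have h0' : 0 < cabs h by rewrite cabs_gt0.
  have := Hr (h + z); rewrite addrK => /(_ hr) K.
  rewrite -(ler_pM2r h0') -cabsM; apply: le_trans K.
  rewrite -cabsN /GRing.scale /= mulr1.
  suff -> : (- ((d - h^-1 * (f (h + z) - f z)) * h)) = f (h + z) - f z - d * h by [].
  by field.
- case=> D <- e e0.
  have /cvgrPdist_le/(_ (e%:C)) := D; rewrite ltcR => /(_ e0).
  case=> r /= r0 Hr.
  have er : (0 < re r) && (r == (re r)%:C).
    move: r0; rewrite ltcE /= => /andP[/eqP ei ->] /=.
    by apply/eqP/complex_ext.
  case/andP: er => er /eqP ee.
  exists (re r) => // v vr.
  have [->|vz] := eqVneq v z; first by rewrite !subrr mulr0 subr0 cabs0 mulr0.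
  have := Hr (v - z); rewrite /= sub0r normrN normC_cabs ee ltcR subr_eq0.
  move=> /(_ vr vz); rewrite normC_cabs lecR => K.
  have h0' : 0 < cabs (v - z) by rewrite cabs_gt0 subr_eq0.
  rewrite -(ler_pM2r h0') -cabsM in K; apply: le_trans K.
  rewrite -cabsN /GRing.scale /= mulr1 subrK.
  set D1 := lim _; rewrite le_eqVlt; apply/orP; left; apply/eqP; congr cabs.
  have vz' : v - z != 0 by rewrite subr_eq0.
  rewrite /D1; rewrite (_ : lim _ = 'D_1 (f : C^o -> C^o) z) //.
  by field.
Qed.

Lemma holo_hasd f z : holomorphic_at f z <-> exists d, hasd f z d.
Proof.
split=> [H|[d /hasdP[]//]].
by exists ('D_1 (f : C^o -> C^o) z); apply/hasdP; apply: DeriveDef.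
Qed.

Lemma hasd_unique f z d : hasd f z d -> 'D_1 (f : C^o -> C^o) z = d.
Proof. by case/hasdP. Qed.

Lemma holo_hasdE f z : holomorphic_at f z -> hasd f z ('D_1 (f : C^o -> C^o) z).
Proof. by case/holo_hasd => d H; rewrite (hasd_unique H). Qed.

Lemma ccont_cst c z : ccont (fun=> c) z.
Proof. by move=> e e0; exists 1 => // v _; rewrite subrr cabs0. Qed.

Lemma ccont_id z : ccont id z.
Proof. by move=> e e0; exists e. Qed.

Lemma ccont_local f g z (r : R) : 0 < r ->
  (forall v, cabs (v - z) < r -> f v = g v) -> ccont f z -> ccont g z.
Proof.
move=> r0 fg fc e e0; have [d d0 H] := fc e e0.
exists (Num.min d r); first by rewrite lt_min d0.
move=> v; rewrite lt_min => /andP[vd vr]; rewrite -!fg ?H //.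
by rewrite subrr cabs0.
Qed.

Lemma ccont_comp f g z : ccont f z -> ccont g (f z) -> ccont (g \o f) z.
Proof.
move=> fc gc e e0; have [d d0 Hg] := gc e e0; have [r r0 Hf] := fc d d0.
by exists r => // v /Hf/Hg.
Qed.

Lemma ccontD f g z : ccont f z -> ccont g z -> ccont (fun v => f v + g v) z.
Proof.
move=> fc gc e e0; have e2 : 0 < e / 2 by rewrite divr_gt0.
have [d d0 Hf] := fc _ e2; have [r r0 Hg] := gc _ e2.
exists (Num.min d r); first by rewrite lt_min d0.
move=> v; rewrite lt_min => /andP[/Hf vd /Hg vr].
rewrite opprD addrACA (le_lt_trans (ler_cabsD _ _)) //.
by rewrite [ltRHS]splitr ltrD.
Qed.

Lemma ccontM f g z : ccont f z -> ccont g z -> ccont (fun v => f v * g v) z.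
Proof.
move=> fc gc e e0.
set M := cabs (f z) + cabs (g z) + 1.
have M0 : 0 < M by rewrite ltr_wpDl // addr_ge0 ?cabs_ge0.
have e2 : 0 < Num.min 1 (e / (2 * M)) by rewrite lt_min ltr01 divr_gt0 // mulr_gt0.
have [d d0 Hf] := fc _ e2; have [r r0 Hg] := gc _ e2.
exists (Num.min d r); first by rewrite lt_min d0.
move=> v; rewrite lt_min => /andP[/Hf vd /Hg vr].
move: vd vr; rewrite !lt_min => /andP[f1 f2] /andP[g1 g2].
have -> : f v * g v - f z * g z =
  (f v - f z) * (g v - g z) + f z * (g v - g z) + (f v - f z) * g z by ring.
apply: le_lt_trans (ler_cabsD _ _) _.
suff S : cabs ((f v - f z) * (g v - g z) + f z * (g v - g z)) +
  cabs ((f v - f z) * g z) <= cabs (f v - f z) * M + cabs (g v - g z) * M.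
  apply: le_lt_trans S _.
    have -> : e = e / (2 * M) * M + e / (2 * M) * M by field; rewrite gt_eqF.
    by rewrite ltrD // ltr_pM2r.
apply: le_trans (lerD (ler_cabsD _ _) (lexx _)) _; rewrite !cabsM /M.
move: (cabs_ge0 (f v - f z)) (cabs_ge0 (g v - g z)) (cabs_ge0 (f z)) (cabs_ge0 (g z)).
set a := cabs _; set b := cabs (g v - _); set c := cabs (f z); set k := cabs (g z).
move=> a0 b0 c0 k0.
have := mulr_ge0 a0 c0; have := mulr_ge0 b0 k0.
have : a * b <= a by rewrite ler_piMr // ltW.
by lra.
Qed.

Lemma ccontV f z : ccont f z -> f z != 0 -> ccont (fun v => (f v)^-1) z.
Proof.
move=> fc f0 e e0; have m0 : 0 < cabs (f z) by rewrite cabs_gt0.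
have e2 : 0 < Num.min (cabs (f z) / 2) (e * (cabs (f z) ^+ 2 / 2)).
  by rewrite lt_min divr_gt0 // mulr_gt0 // divr_gt0 // exprn_gt0.
have [d d0 H] := fc _ e2; exists d => // v /H.
rewrite lt_min => /andP[h1 h2].
have fv : cabs (f z) / 2 < cabs (f v).
  have := ler_cabs_sub (f z) (f z - f v); rewrite subKr cabsBC.
  by move: h1; rewrite ltr_pdivlMr // ltr_pdivrMr //; lra.
have fv0 : 0 < cabs (f v) by rewrite (le_lt_trans _ fv) // divr_ge0 // ltW.
have -> : (f v)^-1 - (f z)^-1 = - (f v - f z) / (f v * f z).
  by field; rewrite -!cabs_gt0 fv0 m0.
rewrite cabs_div cabsN cabsM ltr_pdivrMr ?mulr_gt0 //.
apply: lt_le_trans h2 _; rewrite ler_pM2l //.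
rewrite expr2 mulrAC ler_pM2r //; exact: ltW.
Qed.

(* Caratheodory's form of differentiability. *)
Definition hasdC f z d := exists2 p : C -> C, ccont p z /\ p z = d &
  exists2 r : R, 0 < r & forall v, cabs (v - z) < r -> f v = f z + p v * (v - z).

Lemma hasd_car f z d : hasd f z d <-> hasdC f z d.
Proof.
split=> [H|[p [pc <-] [r r0 Hr]]].
- exists (fun v => if v == z then d else (f v - f z) / (v - z)).
  split; last by rewrite eqxx.
  + move=> e e0; have e2 : 0 < e / 2 by rewrite divr_gt0.
    have [r r0 Hr] := H _ e2; exists r => // v vr.
    rewrite eqxx; case: eqVneq => [|vz]; first by rewrite subrr cabs0.
    have vz' : v - z != 0 by rewrite subr_eq0.
    have c0 : 0 < cabs (v - z) by rewrite cabs_gt0.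
    rewrite -(ltr_pM2r c0) -cabsM mulrBl divfK //.
    apply: le_lt_trans (Hr _ vr) _; rewrite ltr_pM2r //.
    by rewrite ltr_pdivrMr // mulr_natr mulr2n ltrDl.
  + exists 1 => // v _; case: eqVneq => [->|vz]; first by rewrite subrr mulr0 addr0.
    by rewrite divfK ?subr_eq0 // addrC subrK.
- move=> e e0; have [s s0 Hs] := pc e e0.
  exists (Num.min r s); first by rewrite lt_min r0.
  move=> v; rewrite lt_min => /andP[/Hr -> /Hs ps].
  rewrite [f z + _]addrC addrK -mulrBl cabsM ler_wpM2r ?cabs_ge0 //; exact: ltW.
Qed.

Lemma hasd_ccont f z d : hasd f z d -> ccont f z.
Proof.
case/hasd_car => p [pc _] [r r0 Hr].
apply: (@ccont_local (fun v => f z + p v * (v - z)) f z r) => //.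
- by move=> v /Hr.
- apply: ccontD; first exact: ccont_cst.
  apply: ccontM => //; apply: ccontD; [exact: ccont_id|exact: ccont_cst].
Qed.

Lemma hasd_local f g z d (r : R) : 0 < r ->
  (forall v, cabs (v - z) < r -> f v = g v) -> hasd f z d -> hasd g z d.
Proof.
move=> r0 fg fc e e0; have [s s0 H] := fc e e0.
exists (Num.min s r); first by rewrite lt_min s0.
move=> v; rewrite lt_min => /andP[vd vr]; rewrite -!fg ?H //.
by rewrite subrr cabs0.
Qed.

Lemma hasd_cst c z : hasd (fun=> c) z 0.
Proof.
by move=> e e0; exists 1 => // v _; rewrite subrr sub0r mul0r oppr0 cabs0 mulr_ge0 ?cabs_ge0 // ltW.
Qed.

Lemma hasd_id z : hasd id z 1.
Proof.
by move=> e e0; exists 1 => // v _; rewrite mul1r subrr cabs0 mulr_ge0 ?cabs_ge0 // ltW.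
Qed.

Lemma hasdD f g z a b : hasd f z a -> hasd g z b ->
  hasd (fun v => f v + g v) z (a + b).
Proof.
move=> /hasd_car[p [pc pa] [r r0 Hr]] /hasd_car[q [qc qb] [s s0 Hs]].
apply/hasd_car; exists (fun v => p v + q v).
  by split; [exact: ccontD|rewrite pa qb].
exists (Num.min r s); first by rewrite lt_min r0.
by move=> v; rewrite lt_min => /andP[/Hr -> /Hs ->]; ring.
Qed.

Lemma hasdM f g z a b : hasd f z a -> hasd g z b ->
  hasd (fun v => f v * g v) z (a * g z + f z * b).
Proof.
move=> /hasd_car[p [pc pa] [r r0 Hr]] gd; have gc := hasd_ccont gd.
move: gd => /hasd_car[q [qc qb] [s s0 Hs]].
apply/hasd_car; exists (fun v => p v * g v + f z * q v).
  split; last by rewrite pa qb.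
  by apply: ccontD; apply: ccontM => //; exact: ccont_cst.
exists (Num.min r s); first by rewrite lt_min r0.
by move=> v; rewrite lt_min => /andP[/Hr -> /Hs ->]; ring.
Qed.

Lemma hasdZ f z c a : hasd f z a -> hasd (fun v => c * f v) z (c * a).
Proof.
by move=> H; have := hasdM (hasd_cst c z) H; rewrite mul0r add0r.
Qed.

Lemma hasdN f z a : hasd f z a -> hasd (fun v => - f v) z (- a).
Proof.
move=> /(hasdZ (-1)) H; rewrite -mulN1r.
by apply: hasd_local ltr01 _ H => v _; rewrite mulN1r.
Qed.

Lemma hasdB f g z a b : hasd f z a -> hasd g z b ->
  hasd (fun v => f v - g v) z (a - b).
Proof. by move=> Hf /hasdN; exact: hasdD. Qed.

Lemma hasdV f z a : hasd f z a -> f z != 0 ->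
  hasd (fun v => (f v)^-1) z (- a / f z ^+ 2).
Proof.
move=> fd f0; have fc := hasd_ccont fd.
move: fd => /hasd_car[p [pc pa] [r r0 Hr]].
have m0 : 0 < cabs (f z) by rewrite cabs_gt0.
have [s s0 Hs] := fc _ m0.
apply/hasd_car; exists (fun v => - p v * ((f v)^-1 * (f z)^-1)).
  split; last by rewrite pa; field.
  apply: ccontM; last by apply: ccontM; [exact: ccontV|exact: ccont_cst].
  have := ccontM (ccont_cst (-1) z) pc.
  by apply: (ccont_local ltr01) => v _; rewrite mulN1r.
exists (Num.min r s); first by rewrite lt_min r0.
move=> v; rewrite lt_min => /andP[/Hr vr /Hs vs].
have fv0 : f v != 0.
  by apply/eqP => E; move: vs; rewrite E sub0r cabsN ltxx.
have K : p v * (v - z) = f v - f z by rewrite vr; ring.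
have -> : - p v * ((f v)^-1 * (f z)^-1) * (v - z) =
  - (p v * (v - z)) * ((f v)^-1 * (f z)^-1) by ring.
by rewrite K; field; rewrite fv0 f0.
Qed.

Lemma hasd_comp f g z a b : hasd f z a -> hasd g (f z) b ->
  hasd (fun v => g (f v)) z (b * a).
Proof.
move=> fd; have fc := hasd_ccont fd.
move: fd => /hasd_car[p [pc pa] [r r0 Hr]] /hasd_car[q [qc qb] [s s0 Hs]].
have [t t0 Ht] := fc _ s0.
apply/hasd_car; exists (fun v => q (f v) * p v).
  by split; [apply: ccontM => //; exact: ccont_comp|rewrite qb pa].
exists (Num.min r t); first by rewrite lt_min r0.
move=> v; rewrite lt_min => /andP[/Hr vr /Ht vs].
by rewrite (Hs _ vs) {2}vr; ring.
Qed.

Lemma hasdX f z a n : hasd f z a -> exists d, hasd (fun v => f v ^+ n) z d.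
Proof.
move=> H; elim: n => [|n [d IH]].
  by exists 0; apply: hasd_local ltr01 _ (hasd_cst 1 z) => v _; rewrite expr0.
by eexists; apply: hasd_local ltr01 _ (hasdM H IH) => v _; rewrite exprS.
Qed.

Lemma hasd_star f z a : hasd f z^*%C a -> hasd (fstar f) z a^*%C.
Proof.
move=> H e e0; have [r r0 Hr] := H _ e0; exists r => // v vr.
have := Hr v^*%C; rewrite -conjcB cabs_conj => /(_ vr).
apply: le_trans; rewrite -[X in X <= _]cabs_conj /fstar.
by rewrite !(conjcB, conjcM) !conjcK.
Qed.

End Calculus.

(** * Integrals over rectangles *)

Section ComplexIntegral.
Context {R : realType}.
Local Notation C := R[i].
Local Notation re := (@complex.Re R).
Local Notation im := (@complex.Im R).
Local Notation mu := (@lebesgue_measure R).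
Implicit Types (D : set R) (p q : R -> C).

Definition cint D p : C :=
  (Rintegral mu D (fun x => re (p x)) +i* Rintegral mu D (fun x => im (p x)))%C.

Definition cintegrable D p : Prop :=
  mu.-integrable D (EFin \o (fun x => re (p x))) /\
  mu.-integrable D (EFin \o (fun x => im (p x))).

Definition rcont p (x : R) : Prop := forall e : R, 0 < e ->
  exists2 d : R, 0 < d & forall y, `|y - x| < d -> cabs (p y - p x) < e.

Lemma integrableR_Z D (f : R -> R) (r : R) : measurable D ->
  mu.-integrable D (EFin \o f) -> mu.-integrable D (EFin \o (fun x => r * f x)).
Proof.
move=> mD hf; rewrite (_ : EFin \o _ = (fun x => r%:E * (EFin \o f) x))%E //.
exact: integrableZl.
Qed.

Lemma integrableR_D D (f g : R -> R) : measurable D ->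
  mu.-integrable D (EFin \o f) -> mu.-integrable D (EFin \o g) ->
  mu.-integrable D (EFin \o (fun x => f x + g x)).
Proof.
move=> mD hf hg; rewrite (_ : EFin \o _ = (EFin \o f) \+ (EFin \o g))%E //.
exact: integrableD.
Qed.

Lemma integrableR_B D (f g : R -> R) : measurable D ->
  mu.-integrable D (EFin \o f) -> mu.-integrable D (EFin \o g) ->
  mu.-integrable D (EFin \o (fun x => f x - g x)).
Proof.
move=> mD hf hg; rewrite (_ : EFin \o _ = (EFin \o f) \- (EFin \o g))%E //.
exact: integrableB.
Qed.

Lemma integrableR_le D (f g : R -> R) : measurable D -> measurable_fun D f ->
  mu.-integrable D (EFin \o g) -> (forall x, D x -> `|f x| <= g x) ->
  mu.-integrable D (EFin \o f).
Proof.
move=> mD mf hg H; apply: le_integrable hg => //; first exact/measurable_EFinP.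
by move=> x Dx /=; rewrite lee_fin; exact: le_trans (H x Dx) (ler_norm _).
Qed.

Lemma integrableR_measurable D (f : R -> R) : mu.-integrable D (EFin \o f) ->
  measurable_fun D f.
Proof. by case/integrableP => /measurable_EFinP. Qed.

Lemma Rintegral_segment_cst (a b r : R) : a <= b ->
  Rintegral mu `[a, b] (fun=> r) = r * (b - a).
Proof.
move=> ab; rewrite Rintegral_cst //.
have h : (mu `[a, b] = (b - a)%:E)%E.
  rewrite lebesgue_measure_itv /= lte_fin; have [//|ba] := ltP a b.
  by have -> : a = b by [apply/eqP; rewrite eq_le ab ba]; rewrite subrr.
by rewrite [X in fine X](_ : _ = (b - a)%:E).
Qed.

Lemma eq_cint D p q : (forall x, D x -> p x = q x) -> cint D p = cint D q.
Proof.
by move=> pq; congr (_ +i* _)%C; apply: eq_Rintegral => x /set_mem/pq ->.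
Qed.

Lemma eq_cintegrable D p q : measurable D -> (forall x, D x -> p x = q x) ->
  cintegrable D p -> cintegrable D q.
Proof.
move=> mD pq [h1 h2]; split; [apply: eq_integrable h1|apply: eq_integrable h2] => //;
  by move=> x /set_mem/pq /= ->.
Qed.

Lemma cintegrableD D p q : measurable D -> cintegrable D p -> cintegrable D q ->
  cintegrable D (fun x => p x + q x).
Proof.
move=> mD [p1 p2] [q1 q2]; split.
  have := integrableR_D mD p1 q1; apply: eq_integrable => // x _ /=.
  by rewrite re_add.
have := integrableR_D mD p2 q2; apply: eq_integrable => // x _ /=.
by rewrite im_add.
Qed.

Lemma cintD D p q : measurable D -> cintegrable D p -> cintegrable D q ->
  cint D (fun x => p x + q x) = cint D p + cint D q.
Proof.
move=> mD [p1 p2] [q1 q2]; rewrite /cint; apply: complex_ext => /=.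
  by rewrite -RintegralD //; apply: eq_Rintegral => x _; rewrite re_add.
by rewrite -RintegralD //; apply: eq_Rintegral => x _; rewrite im_add.
Qed.

Lemma cintegrableZ D p c : measurable D -> cintegrable D p ->
  cintegrable D (fun x => c * p x).
Proof.
move=> mD [p1 p2]; split.
  have := integrableR_B mD (integrableR_Z (re c) mD p1) (integrableR_Z (im c) mD p2).
  by apply: eq_integrable => // x _ /=; rewrite re_mul.
have := integrableR_D mD (integrableR_Z (re c) mD p2) (integrableR_Z (im c) mD p1).
by apply: eq_integrable => // x _ /=; rewrite im_mul.
Qed.

Lemma cintZ D p c : measurable D -> cintegrable D p ->
  cint D (fun x => c * p x) = c * cint D p.
Proof.
move=> mD [p1 p2]; rewrite /cint; apply: complex_ext => /=.
  rewrite re_mul /= -!RintegralZl // -RintegralB //; try exact: integrableR_Z.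
  by apply: eq_Rintegral => x _; rewrite re_mul.
rewrite im_mul /= -!RintegralZl // -RintegralD //; try exact: integrableR_Z.
by apply: eq_Rintegral => x _; rewrite im_mul.
Qed.

Lemma cintegrableN D p : measurable D -> cintegrable D p ->
  cintegrable D (fun x => - p x).
Proof.
move=> mD /(cintegrableZ (-1) mD); apply: eq_cintegrable => // x _.
by rewrite mulN1r.
Qed.

Lemma cintN D p : measurable D -> cintegrable D p ->
  cint D (fun x => - p x) = - cint D p.
Proof.
move=> mD h; rewrite -mulN1r -cintZ //; apply: eq_cint => x _.
by rewrite mulN1r.
Qed.

Lemma cintegrableB D p q : measurable D -> cintegrable D p -> cintegrable D q ->
  cintegrable D (fun x => p x - q x).
Proof. by move=> mD hp /(cintegrableN mD); exact: cintegrableD. Qed.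

Lemma cintB D p q : measurable D -> cintegrable D p -> cintegrable D q ->
  cint D (fun x => p x - q x) = cint D p - cint D q.
Proof.
by move=> mD hp hq; rewrite cintD ?cintN //; exact: cintegrableN.
Qed.

Lemma measurable_cabs D p : cintegrable D p ->
  measurable_fun D (fun x => cabs (p x)).
Proof.
case=> /integrableR_measurable p1 /integrableR_measurable p2.
have -> : (fun x => cabs (p x)) =
    (fun x => Num.sqrt (re (p x) ^+ 2 + im (p x) ^+ 2)).
  by apply/funext => x; case: (p x).
apply: (measurableT_comp (continuous_measurable_fun (@sqrt_continuous R))).
by apply: measurable_funD; apply: measurable_funX.
Qed.

Lemma integrable_cabs D p : measurable D -> cintegrable D p ->
  mu.-integrable D (EFin \o (fun x => cabs (p x))).
Proof.
move=> mD h; have mp := measurable_cabs h; case: h => p1 p2.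
apply: (@integrableR_le _ _ (fun x => `|re (p x)| + `|im (p x)|)) => //.
  by apply: integrableR_D => //; exact: integrable_norm.
by move=> x _; rewrite ger0_norm ?cabs_ge0 //; exact: cabs_le_reim.
Qed.

(** The unimodular constant c with c I = |I| makes the integral real, and the real part of c p is at
    most |p|. *)
Lemma cabs_cint_le D p : measurable D -> cintegrable D p ->
  cabs (cint D p) <= Rintegral mu D (fun x => cabs (p x)).
Proof.
move=> mD h; set I := cint D p.
have [/eqP I0|I0] := eqVneq (cabs I) 0.
  by rewrite (eqP I0); apply: Rintegral_ge0 => x _; exact: cabs_ge0.
have Ip : 0 < cabs I by rewrite lt_def I0 cabs_ge0.
pose c := I^*%C / (cabs I)%:C.
have cI : c * I = (cabs I)%:C.
  rewrite /c mulrAC [_ * I]mulrC mulc_conj; apply: complex_ext => /=;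
  by field.
have c1 : cabs c = 1.
  by rewrite cabs_div cabs_conj cabs_real ger0_norm ?divff // ltW.
have h' := cintegrableZ c mD h.
have -> : cabs I = Rintegral mu D (fun x => re (c * p x)).
  by have := cintZ c mD h; rewrite -/I cI => /(congr1 re) /= <-.
apply: le_Rintegral => //; first by case: h'.
  exact: integrable_cabs.
move=> x _; apply: le_trans (ler_norm _) _; apply: le_trans (cabs_re _) _.
by rewrite cabsM c1 mul1r.
Qed.

Lemma rcont_cintegrable (a b : R) p :
  (forall x, a <= x <= b -> rcont p x) -> cintegrable `[a, b] p.
Proof.
have K (f : C -> R) : (forall z w, f (z - w) = f z - f w) ->
    (forall z, `|f z| <= cabs z) -> (forall x, a <= x <= b -> rcont p x) ->
    mu.-integrable `[a, b] (EFin \o (fun x => f (p x))).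
  move=> fB fc pc; apply: continuous_compact_integrable; first exact: segment_compact.
  apply: continuous_in_subspaceT => x /set_mem /=; rewrite in_itv /= => xab.
  apply/cvgrPdist_lt => e e0; have [d d0 H] := pc _ xab _ e0.
  exists d => //= y; rewrite /ball /= distrC => yx.
  by rewrite -fB; apply: le_lt_trans (fc _) _; rewrite cabsBC H.
move=> h; split; apply: K => //; try exact: cabs_re; try exact: cabs_im.
  by move=> z w; rewrite re_add re_opp.
by move=> z w; rewrite im_add im_opp.
Qed.

Lemma cint_cst (a b : R) (c : C) : a <= b -> cint `[a, b] (fun=> c) = (b - a)%:C * c.
Proof.
move=> ab; rewrite /cint !Rintegral_segment_cst //.
by apply: complex_ext; rewrite ?re_mul ?im_mul /=; ring.
Qed.

Lemma cabs_cint_bound (a b M : R) p : a <= b -> cintegrable `[a, b] p ->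
  (forall x, a <= x <= b -> cabs (p x) <= M) -> cabs (cint `[a, b] p) <= M * (b - a).
Proof.
move=> ab h pM; apply: le_trans (cabs_cint_le _ h) _ => //.
have -> : M * (b - a) = Rintegral mu `[a, b] (fun=> M).
  by rewrite Rintegral_segment_cst.
apply: le_Rintegral => //; first exact: integrable_cabs.
  have [] := @rcont_cintegrable a b (fun=> M%:C) => //.
  by move=> x _ e e0; exists 1 => // y _; rewrite subrr cabs0.
Qed.

Lemma cint_split (a m b : R) p : a <= m -> m <= b -> cintegrable `[a, b] p ->
  cint `[a, b] p = cint `[a, m] p + cint `[m, b] p.
Proof.
move=> am mb [p1 p2].
have K (f : R -> R) : mu.-integrable `[a, b] (EFin \o f) ->
    Rintegral mu `[a, b] f = Rintegral mu `[a, m] f + Rintegral mu `[m, b] f.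
  move=> fi; have fi' : mu.-integrable `]m, b] (EFin \o f).
    by apply: integrableS fi => //; apply: subset_itvr; rewrite bnd_simp.
  rewrite -(Rintegral_itv_obnd_cbnd fi').
  by rewrite -(@Rintegral_itvB _ f (BLeft a) (BRight b) m) ?bnd_simp // addrC subrK.
by rewrite /cint (K _ p1) (K _ p2).
Qed.

End ComplexIntegral.

(** * Goursat's theorem on rectangles *)

Section Goursat.
Context {R : realType}.
Local Notation C := R[i].
Local Notation re := (@complex.Re R).
Local Notation im := (@complex.Im R).
Implicit Types (f g : C -> C) (a b c d : R).

Definition inrect a b c d (z : C) := [&& a <= re z, re z <= b, c <= im z & im z <= d].

(** The contour integral along the boundary, counterclockwise from the bottom side; the factor i is
    dz/dy on the vertical sides. *)
Definition rectint f a b c d : C :=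
  cint `[a, b] (fun x => f (x +i* c)%C) - cint `[a, b] (fun x => f (x +i* d)%C)
  + ('i%C * cint `[c, d] (fun y => f (b +i* y)%C)
     - 'i%C * cint `[c, d] (fun y => f (a +i* y)%C)).

Definition onrect a b c d (z : C) := inrect a b c d z &&
  [|| re z == a, re z == b, im z == c | im z == d].

Definition inside a b c d (z : C) := [&& a < re z, re z < b, c < im z & im z < d].

Definition rectcont f a b c d := forall z, inrect a b c d z -> ccont f z.

(** Continuity is asked on the boundary alone, for integrands such as f(z)/(z - w) with a pole
    inside. *)
Definition bdcont f a b c d := forall z, onrect a b c d z -> ccont f z.

Lemma rectcont_bd f a b c d : rectcont f a b c d -> bdcont f a b c d.
Proof. by move=> h z /andP[/h]. Qed.

Lemma rcont_hor f c x : ccont f (x +i* c)%C -> rcont (fun x => f (x +i* c)%C) x.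
Proof.
move=> h e e0; have [d d0 H] := h e e0; exists d => // y yx; apply: H.
have -> : ((y +i* c) - (x +i* c))%C = (y - x)%:C by apply: complex_ext => /=; ring.
by rewrite cabs_real.
Qed.

Lemma rcont_ver f b y : ccont f (b +i* y)%C -> rcont (fun y => f (b +i* y)%C) y.
Proof.
move=> h e e0; have [d d0 H] := h e e0; exists d => // x yx; apply: H.
have -> : ((b +i* x) - (b +i* y))%C = 'i%C * (x - y)%:C by apply: complex_ext => /=; ring.
by rewrite cabsM cabs_real {1}/cabs /= expr0n /= add0r expr1n sqrtr1 mul1r.
Qed.

Lemma rect_side f a b c d : bdcont f a b c d -> a <= b -> c <= d ->
  [/\ cintegrable `[a, b] (fun x => f (x +i* c)%C),
      cintegrable `[a, b] (fun x => f (x +i* d)%C),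
      cintegrable `[c, d] (fun y => f (a +i* y)%C)
    & cintegrable `[c, d] (fun y => f (b +i* y)%C)].
Proof.
move=> fc ab cd; split; apply: rcont_cintegrable => x /andP[x1 x2];
  (apply: rcont_hor || apply: rcont_ver); apply: fc; rewrite /onrect /inrect /=;
  by rewrite /= ?x1 ?x2 ?ab ?cd ?lexx ?eqxx ?orbT.
Qed.

Lemma rectcontS f a b c d a' b' c' d' : rectcont f a b c d ->
  a <= a' -> b' <= b -> c <= c' -> d' <= d -> rectcont f a' b' c' d'.
Proof.
move=> fc aa bb cc dd z /and4P[z1 z2 z3 z4]; apply: fc; apply/and4P.
by split; lra.
Qed.

Lemma eq_rectint f g a b c d : a <= b -> c <= d ->
  (forall z, onrect a b c d z -> f z = g z) -> rectint f a b c d = rectint g a b c d.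
Proof.
move=> ab cd fg; rewrite /rectint; congr (_ - _ + ('i%C * _ - 'i%C * _));
  apply: eq_cint => x; rewrite /= in_itv /= => /andP[x1 x2]; apply: fg;
  by rewrite /onrect /inrect /= ?x1 ?x2 ?ab ?cd ?lexx ?eqxx ?orbT.
Qed.

Lemma rectintD f g a b c d : a <= b -> c <= d ->
  bdcont f a b c d -> bdcont g a b c d ->
  rectint (fun z => f z + g z) a b c d = rectint f a b c d + rectint g a b c d.
Proof.
move=> ab cd /rect_side-/(_ ab cd)[f1 f2 f3 f4] /rect_side-/(_ ab cd)[g1 g2 g3 g4].
by rewrite /rectint !cintD //; ring.
Qed.

Lemma rectintZ f k a b c d : a <= b -> c <= d -> bdcont f a b c d ->
  rectint (fun z => k * f z) a b c d = k * rectint f a b c d.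
Proof.
move=> ab cd /rect_side-/(_ ab cd)[f1 f2 f3 f4].
by rewrite /rectint !cintZ //; ring.
Qed.

Lemma rectintB f g a b c d : a <= b -> c <= d ->
  bdcont f a b c d -> bdcont g a b c d ->
  rectint (fun z => f z - g z) a b c d = rectint f a b c d - rectint g a b c d.
Proof.
move=> ab cd /rect_side-/(_ ab cd)[f1 f2 f3 f4] /rect_side-/(_ ab cd)[g1 g2 g3 g4].
by rewrite /rectint !cintB //; ring.
Qed.

Lemma rectint_splitx f a m b c d : a <= m -> m <= b -> c <= d -> rectcont f a b c d ->
  rectint f a b c d = rectint f a m c d + rectint f m b c d.
Proof.
move=> am mb cd fc; move/rectcont_bd/rect_side: (fc)=> /(_ (le_trans am mb) cd)[f1 f2 f3 f4].
by rewrite /rectint (cint_split am mb f1) (cint_split am mb f2); ring.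
Qed.

Lemma rectint_splity f a b c n d : a <= b -> c <= n -> n <= d -> rectcont f a b c d ->
  rectint f a b c d = rectint f a b c n + rectint f a b n d.
Proof.
move=> ab cn nd fc; move/rectcont_bd/rect_side: (fc)=> /(_ ab (le_trans cn nd))[f1 f2 f3 f4].
by rewrite /rectint (cint_split cn nd f3) (cint_split cn nd f4); ring.
Qed.

Lemma rectint_bound f a b c d M : a <= b -> c <= d -> bdcont f a b c d ->
  (forall z, onrect a b c d z -> cabs (f z) <= M) ->
  cabs (rectint f a b c d) <= 2 * M * ((b - a) + (d - c)).
Proof.
move=> ab cd /rect_side-/(_ ab cd)[f1 f2 f3 f4] fM.
have h1 : cabs (cint `[a, b] (fun x => f (x +i* c)%C)) <= M * (b - a).
  apply: cabs_cint_bound => // x /andP[x1 x2]; by apply: fM; rewrite /onrect /inrect /= ?x1 ?x2 ?ab ?cd ?lexx ?eqxx ?orbT.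
have h2 : cabs (cint `[a, b] (fun x => f (x +i* d)%C)) <= M * (b - a).
  apply: cabs_cint_bound => // x /andP[x1 x2]; by apply: fM; rewrite /onrect /inrect /= ?x1 ?x2 ?ab ?cd ?lexx ?eqxx ?orbT.
have h3 : cabs (cint `[c, d] (fun x => f (a +i* x)%C)) <= M * (d - c).
  apply: cabs_cint_bound => // x /andP[x1 x2]; by apply: fM; rewrite /onrect /inrect /= ?x1 ?x2 ?ab ?cd ?lexx ?eqxx ?orbT.
have h4 : cabs (cint `[c, d] (fun x => f (b +i* x)%C)) <= M * (d - c).
  apply: cabs_cint_bound => // x /andP[x1 x2]; by apply: fM; rewrite /onrect /inrect /= ?x1 ?x2 ?ab ?cd ?lexx ?eqxx ?orbT.
have ci : cabs ('i%C : C) = 1.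
  by rewrite /cabs /= expr0n /= add0r expr1n sqrtr1.
apply: le_trans (ler_cabsD _ _) _.
apply: le_trans (lerD (ler_cabsB _ _) (ler_cabsB _ _)) _.
by rewrite !cabsM ci; lra.
Qed.

Lemma rectcont_cst (k : C) a b c d : rectcont (fun=> k) a b c d.
Proof. by move=> z _; exact: ccont_cst. Qed.

Lemma rectint_cst (k : C) a b c d : rectint (fun=> k) a b c d = 0.
Proof. by rewrite /rectint; ring. Qed.

Lemma rectint_id a b c d : a <= b -> c <= d -> rectint id a b c d = 0.
Proof.
move=> ab cd.
have [f1 f2 f3 f4] : [/\ cintegrable `[a, b] (fun x => id (x +i* c)%C),
      cintegrable `[a, b] (fun x => id (x +i* d)%C),
      cintegrable `[c, d] (fun y => id (a +i* y)%C)
    & cintegrable `[c, d] (fun y => id (b +i* y)%C)].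
  by apply: (@rect_side id) => // z _; exact: ccont_id.
rewrite /rectint -mulrBr -!cintB //.
rewrite (@eq_cint _ _ _ (fun=> (0 +i* (c - d))%C)); last first.
  by move=> x _; apply: complex_ext => /=; ring.
rewrite (@eq_cint _ _ (fun x => id (b +i* x)%C - id (a +i* x)%C) (fun=> (b - a)%:C)); last first.
  by move=> x _; apply: complex_ext => /=; ring.
by rewrite !cint_cst //; apply: complex_ext => /=; ring.
Qed.

Section Bisection.
Variable P : R -> R -> R -> R -> Prop.

(** Picks a quarter on which [P] fails, if there is one. *)
Definition bisect_step (r : R * R * (R * R)) : R * R * (R * R) :=
  let: ((a, b), (c, d)) := r in let m := (a + b) / 2 in let n := (c + d) / 2 in
  if `[< ~ P a m c n >] then ((a, m), (c, n)) else
  if `[< ~ P m b c n >] then ((m, b), (c, n)) else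
  if `[< ~ P a m n d >] then ((a, m), (n, d)) else ((m, b), (n, d)).

Definition rle (r s : R * R * (R * R)) :=
  [&& s.1.1 <= r.1.1, r.1.2 <= s.1.2, s.2.1 <= r.2.1 & r.2.2 <= s.2.2].

(** If [P] failed on the whole rectangle, it would fail on a nested sequence of quarters shrinking
    to a point, against the local hypothesis there. This one compactness principle serves Goursat's
    theorem, boundedness of continuous functions and the mean value estimate. *)
Lemma rect_bisect a0 b0 c0 d0 : a0 <= b0 -> c0 <= d0 ->
  (forall a b c d, a0 <= a -> a <= b -> b <= b0 -> c0 <= c -> c <= d -> d <= d0 ->
    P a ((a + b) / 2) c ((c + d) / 2) -> P ((a + b) / 2) b c ((c + d) / 2) ->
    P a ((a + b) / 2) ((c + d) / 2) d -> P ((a + b) / 2) b ((c + d) / 2) d -> P a b c d) ->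
  (forall p q, a0 <= p <= b0 -> c0 <= q <= d0 -> exists2 e : R, 0 < e &
    forall a b c d, a0 <= a -> a <= p <= b -> b <= b0 -> c0 <= c -> c <= q <= d -> d <= d0 ->
      b - a < e -> d - c < e -> P a b c d) ->
  P a0 b0 c0 d0.
Proof.
move=> ab0 cd0 Hsplit Hloc; apply: contrapT => nP0.
pose r0 := ((a0, b0), (c0, d0)).
pose ok (r : R * R * (R * R)) := [/\ rle r r0, r.1.1 <= r.1.2, r.2.1 <= r.2.2 &
  ~ P r.1.1 r.1.2 r.2.1 r.2.2].
have step r : ok r -> [/\ ok (bisect_step r), rle (bisect_step r) r,
    (bisect_step r).1.2 - (bisect_step r).1.1 = (r.1.2 - r.1.1) / 2 &
    (bisect_step r).2.2 - (bisect_step r).2.1 = (r.2.2 - r.2.1) / 2].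
  case: r => [[a b] [c d]] [/and4P[/= r1 r2 r3 r4] /= ab cd nP].
  have m1 : a <= (a + b) / 2 by lra.
  have m2 : (a + b) / 2 <= b by lra.
  have n1 : c <= (c + d) / 2 by lra.
  have n2 : (c + d) / 2 <= d by lra.
  case: asboolP => [K|/contrapT P1].
    by split => //=; try (by field); [split => //=|]; apply/and4P; split => /=; lra.
  case: asboolP => [K|/contrapT P2].
    by split => //=; try (by field); [split => //=|]; apply/and4P; split => /=; lra.
  case: asboolP => [K|/contrapT P3].
    by split => //=; try (by field); [split => //=|]; apply/and4P; split => /=; lra.
  have K : ~ P ((a + b) / 2) b ((c + d) / 2) d.
    by move=> P4; apply: nP; apply: Hsplit.
  by split => //=; try (by field); [split => //=|]; apply/and4P; split => /=; lra.
pose r n := iter n bisect_step r0.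
have okr n : ok (r n).
  elim: n => [|n IH]; last by have [] := step _ IH.
  by split => //=; rewrite /rle !lexx.
have rS n : rle (r n.+1) (r n) by have [] := step _ (okr n).
have rmon n k : rle (r (n + k)%N) (r n).
  elim: k => [|k IH]; first by rewrite addn0 /rle !lexx.
  rewrite addnS; have := rS (n + k)%N; move: IH => /and4P[k1 k2 k3 k4] /and4P[h1 h2 h3 h4].
  by apply/and4P; split; [exact: le_trans k1 h1|exact: le_trans h2 k2|
    exact: le_trans k3 h3|exact: le_trans h4 k4].
have len n : (r n).1.2 - (r n).1.1 = (b0 - a0) / 2 ^+ n /\
    (r n).2.2 - (r n).2.1 = (d0 - c0) / 2 ^+ n.
  elim: n => [|n [IH1 IH2]]; first by rewrite expr0 !divr1.
  have [_ _ e1 e2] := step _ (okr n).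
  rewrite /r iterS e1 e2 -/(r n) IH1 IH2 exprS.
  by split; field; rewrite expf_neq0 // pnatr_eq0.
have cross n m : (r n).1.1 <= (r m).1.2 /\ (r n).2.1 <= (r m).2.2.
  have /and4P[h1 h2 h3 h4] := rmon n (maxn n m - n)%N.
  have /and4P[k1 k2 k3 k4] := rmon m (maxn n m - m)%N.
  rewrite subnKC ?leq_maxl // in h1 h2 h3 h4.
  rewrite subnKC ?leq_maxr // in k1 k2 k3 k4.
  have [_ o1 o2 _] := okr (maxn n m).
  by split; [exact: le_trans h1 (le_trans o1 k2)|exact: le_trans h3 (le_trans o2 k4)].
(* By [cross], every left or lower end stays below every right or upper end, so the suprema lie in
   all the rectangles. *)
pose p := sup [set (r n).1.1 | n in setT]; pose q := sup [set (r n).2.1 | n in setT].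
have pn n : (r n).1.1 <= p <= (r n).1.2.
  apply/andP; split.
    apply: ub_le_sup; last by exists n.
    by exists b0 => _ [m _ <-]; have [] := cross m 0%N.
  apply: ge_sup; first by exists a0, 0%N.
  by move=> _ [m _ <-]; have [] := cross m n.
have qn n : (r n).2.1 <= q <= (r n).2.2.
  apply/andP; split.
    apply: ub_le_sup; last by exists n.
    by exists d0 => _ [m _ <-]; have [] := cross m 0%N.
  apply: ge_sup; first by exists c0, 0%N.
  by move=> _ [m _ <-]; have [] := cross m n.
have [e e0 He] := Hloc p q (pn 0%N) (qn 0%N).
(* Both sides of the n-th rectangle are at most K / 2^n, and 2^n exceeds n. *)
pose K := (b0 - a0) + (d0 - c0).
have [n nK] : exists n : nat, K / e < n%:R.
  by exists (Num.truncn (K / e)).+1; rewrite truncnS_gt.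
have n2 : K / e < 2 ^+ n.
  apply: lt_trans nK _; rewrite -natrX ltr_nat; exact: ltn_expl.
have K2 : K / 2 ^+ n < e.
  by rewrite ltr_pdivrMr ?exprn_gt0 // mulrC -ltr_pdivrMr.
have [/and4P[h1 h2 h3 h4] o1 o2 nP] := okr n.
have [l1 l2] := len n.
apply: nP; apply: He => //.
- rewrite l1; apply: le_lt_trans K2; rewrite ler_pM2r ?invr_gt0 ?exprn_gt0 // /K.
  by rewrite lerDl subr_ge0.
- rewrite l2; apply: le_lt_trans K2; rewrite ler_pM2r ?invr_gt0 ?exprn_gt0 // /K.
  by rewrite lerDr subr_ge0.
Qed.

End Bisection.

Lemma cabs_rect_dist a b c d z w : inrect a b c d z -> inrect a b c d w ->
  cabs (z - w) <= (b - a) + (d - c).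
Proof.
move=> /and4P[z1 z2 z3 z4] /and4P[w1 w2 w3 w4].
apply: le_trans (cabs_le_reim _) _; rewrite re_add im_add re_opp im_opp.
by apply: lerD; rewrite ler_norml; apply/andP; split; lra.
Qed.

(** Let S be half the perimeter. The bound e S^2 on the integral passes from the quarters to the
    rectangle, because S is halved and 4 (S/2)^2 = S^2. It holds on small rectangles because f is
    there affine up to e/2 |z - z0|, and affine functions have integral 0. *)
Lemma goursat f a b c d : a <= b -> c <= d ->
  (forall z, inrect a b c d z -> holomorphic_at f z) -> rectint f a b c d = 0.
Proof.
move=> ab cd fh; apply/eqP; rewrite -cabs_eq0 eq_le cabs_ge0 andbT.
have fcont : rectcont f a b c d.
  by move=> z /fh/holo_hasd[k /hasd_ccont].
pose S := (b - a) + (d - c).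
have S0 : 0 <= S by rewrite addr_ge0 // subr_ge0.
suff H e : 0 < e -> cabs (rectint f a b c d) <= e * S ^+ 2.
  rewrite leNgt; apply/negP => J0.
  have := H (cabs (rectint f a b c d) / (2 * (S ^+ 2 + 1))).
  have T : 0 < S ^+ 2 + 1 by rewrite ltr_wpDl // sqr_ge0.
  rewrite divr_gt0 ?mulr_gt0 // => /(_ isT).
  set J := cabs _ in J0 *; rewrite mulrAC ler_pdivlMr ?mulr_gt0 // ler_pM2l //.
  by have := sqr_ge0 S; lra.
move=> e0.
apply: (@rect_bisect (fun a b c d => cabs (rectint f a b c d) <= e * ((b - a) + (d - c)) ^+ 2)) => //.
- move=> a' b' c' d' a1 ab' b1 c1 cd' d1.
  have m1 : a' <= (a' + b') / 2 by lra.
  have m2 : (a' + b') / 2 <= b' by lra.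
  have n1 : c' <= (c' + d') / 2 by lra.
  have n2 : (c' + d') / 2 <= d' by lra.
  have fc' : rectcont f a' b' c' d' by exact: rectcontS fcont _ _ _ _.
  rewrite (rectint_splitx m1 m2 cd' fc').
  rewrite (rectint_splity m1 n1 n2) ?(rectint_splity m2 n1 n2); last 2 first.
    by exact: rectcontS fc' _ _ _ _.
    by exact: rectcontS fc' _ _ _ _.
  move=> h1 h2 h3 h4.
  apply: le_trans (ler_cabsD _ _) _.
  apply: le_trans (lerD (ler_cabsD _ _) (ler_cabsD _ _)) _.
  apply: le_trans (lerD (lerD h1 h3) (lerD h2 h4)) _.
  by rewrite le_eqVlt; apply/orP; left; apply/eqP; field.
- move=> p q pab qcd.
  have pq : inrect a b c d (p +i* q)%C.
    by move: pab qcd => /andP[? ?] /andP[? ?]; apply/and4P.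
  have /holo_hasd[k fk] := fh _ pq.
  have e2 : 0 < e / 2 by rewrite divr_gt0.
  have [r r0 Hr] := fk _ e2.
  exists (r / 2); first by rewrite divr_gt0.
  move=> a' b' c' d' a1 /andP[ap pb] b1 c1 /andP[cq qd] d1 s1 s2.
  have ab' : a' <= b' := le_trans ap pb.
  have cd' : c' <= d' := le_trans cq qd.
  have fc' : rectcont f a' b' c' d' by exact: rectcontS fcont _ _ _ _.
  pose z0 := (p +i* q)%C.
  (* The remainder of the first order expansion at z0; [l] is the affine part. *)
  pose g z := f z + (- f z0 + (- k) * (z - z0)).
  pose l z := f z0 + (- k * z0) + k * z.
  have gc : rectcont g a' b' c' d'.
    move=> z hz; apply: ccontD; first exact: fc'.
    apply: ccontD; first exact: ccont_cst.
    apply: ccontM; first exact: ccont_cst.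
    by apply: ccontD; [exact: ccont_id|exact: ccont_cst].
  have idc : rectcont id a' b' c' d' by move=> z _; exact: ccont_id.
  have kc : rectcont (fun z => k * z) a' b' c' d'.
    by move=> z _; apply: ccontM; [exact: ccont_cst|exact: ccont_id].
  have lc : rectcont l a' b' c' d'.
    by move=> z hz; apply: ccontD; [exact: ccont_cst|exact: kc].
  have -> : rectint f a' b' c' d' = rectint g a' b' c' d'.
    rewrite (@eq_rectint f (fun z => g z + l z)) //; last first.
      by move=> z _; rewrite /g /l; ring.
    rewrite rectintD //; try exact: rectcont_bd; rewrite [rectint l _ _ _ _](_ : _ = 0) ?addr0 //.
    rewrite /l rectintD //; [|exact/rectcont_bd/rectcont_cst|exact: rectcont_bd].
    by rewrite rectint_cst rectintZ ?rectint_id ?mulr0 ?addr0 //; exact: rectcont_bd.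
  set T := (b' - a') + (d' - c').
  have z0in : inrect a' b' c' d' z0 by apply/and4P; split.
  have K := @rectint_bound g a' b' c' d' (e / 2 * T) ab' cd' (rectcont_bd gc).
  have : cabs (rectint g a' b' c' d') <= 2 * (e / 2 * T) * T.
    apply: K => z /andP[hz _]; have dz := cabs_rect_dist hz z0in.
    have zr : cabs (z - z0) < r by apply: le_lt_trans dz _; lra.
    have := Hr _ zr.
    have -> : g z = f z - f z0 - k * (z - z0) by rewrite /g; ring.
    by move=> /le_trans; apply; rewrite ler_pM2l.
  by move=> /le_trans; apply; rewrite le_eqVlt; apply/orP; left; apply/eqP; field.
Qed.

End Goursat.

(** * Exceptional points, and differentiation of Cauchy integrals *)

Section Cauchy.
Context {R : realType}.
Local Notation C := R[i].
Local Notation re := (@complex.Re R).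
Local Notation im := (@complex.Im R).
Implicit Types (f g : C -> C) (a b c d : R).

Lemma cint_pt (p : R -> C) (a : R) : cint `[a, a] p = 0.
Proof. by rewrite /cint set_itv1 !Rintegral_set1. Qed.

Lemma rectint_degx f a c d : rectint f a a c d = 0.
Proof. by rewrite /rectint !cint_pt !subrr addr0. Qed.

Lemma rectint_degy f a b c : rectint f a b c c = 0.
Proof. by rewrite /rectint !cint_pt subrr add0r subrr. Qed.

(** Induction on the exceptional points: around p a small rectangle is cut out. The four remaining
    pieces avoid p, so their integrals vanish by induction, and the integral over the small one is
    at most a bound of f times its perimeter. *)
Lemma goursat_except f (s : seq C) a b c d : a <= b -> c <= d ->
  rectcont f a b c d ->
  (forall z, inrect a b c d z -> z \notin s -> holomorphic_at f z) ->
  rectint f a b c d = 0.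
Proof.
elim: s a b c d => [|p s IH] a b c d ab cd fc fh.
  by apply: goursat => // z zr; exact: fh.
have IHp a' b' c' d' : a <= a' -> a' <= b' -> b' <= b -> c <= c' -> c' <= d' -> d' <= d ->
    ~~ inrect a' b' c' d' p -> rectint f a' b' c' d' = 0.
  move=> a1 ab' b1 c1 cd' d1 np; apply: IH => //; first exact: rectcontS fc _ _ _ _.
  move=> z zr zs; apply: fh.
    by move: zr => /and4P[z1 z2 z3 z4]; apply/and4P; split; lra.
  by rewrite in_cons negb_or zs andbT; apply: contraNneq np => <-.
have [pin|] := boolP (inrect a b c d p); last by apply: IHp.
have [p1 p2 p3 p4] := and4P pin.
have [r r0 Hr] := fc p pin 1 ltr01.
pose M := cabs (f p) + 1.
suff H e : 0 < e -> cabs (rectint f a b c d) <= e.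
  apply/eqP; rewrite -cabs_eq0 eq_le cabs_ge0 andbT leNgt; apply/negP => J0.
  by have := H (cabs (rectint f a b c d) / 2); rewrite divr_gt0 // => /(_ isT); lra.
move=> e0.
have M0 : 0 < M by rewrite ltr_wpDl ?cabs_ge0.
(* The half-side of the small rectangle: its points are within 2k < r of p, where |f| <= M, and its
   contribution is at most 2 M (4 k) <= e. *)
pose k := Num.min (r / 5) (e / (8 * M)).
have k0 : 0 < k by rewrite lt_min !divr_gt0 // mulr_gt0.
have k1 : 5 * k <= r.
  have : k <= r / 5 by rewrite ge_min lexx.
  lra.
have k2 : 8 * M * k <= e.
  have : k <= e / (8 * M) by rewrite ge_min lexx orbT.
  by rewrite ler_pdivlMr ?mulr_gt0 // mulrC.
(* The point p may lie on the boundary, so the square is intersected with the rectangle; some of the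
   outer pieces are then degenerate. *)
pose x1 := Num.max a (re p - k); pose x2 := Num.min b (re p + k).
pose y1 := Num.max c (im p - k); pose y2 := Num.min d (im p + k).
have ax1 : a <= x1 by rewrite le_max lexx.
have x1p : x1 <= re p by rewrite ge_max p1 /=; lra.
have px2 : re p <= x2 by rewrite le_min p2 /=; lra.
have x2b : x2 <= b by rewrite ge_min lexx.
have cy1 : c <= y1 by rewrite le_max lexx.
have y1p : y1 <= im p by rewrite ge_max p3 /=; lra.
have py2 : im p <= y2 by rewrite le_min p4 /=; lra.
have y2d : y2 <= d by rewrite ge_min lexx.
have kx1 : re p - k <= x1 by rewrite le_max lexx orbT.
have ky1 : im p - k <= y1 by rewrite le_max lexx orbT.
have kx2 : x2 <= re p + k by rewrite ge_min lexx orbT.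
have ky2 : y2 <= im p + k by rewrite ge_min lexx orbT.
have x12 : x1 <= x2 by lra.
have y12 : y1 <= y2 by lra.
have c1 : rectcont f x1 b c d by apply: rectcontS fc _ _ _ _; lra.
have c2 : rectcont f x1 x2 c d by apply: rectcontS fc _ _ _ _; lra.
have c3 : rectcont f x1 x2 y1 d by apply: rectcontS fc _ _ _ _; lra.
have c4 : rectcont f x1 x2 y1 y2 by apply: rectcontS fc _ _ _ _; lra.
have left0 : rectint f a x1 c d = 0.
  have [E|nE] := eqVneq a x1; first by rewrite -E rectint_degx.
  have xE : x1 = re p - k.
    by move: nE; rewrite /x1; case: (leP a (re p - k)) => //; rewrite eqxx.
  by apply: IHp => //; try lra; apply/negP => /and4P[_ h _ _]; lra.
have right0 : rectint f x2 b c d = 0.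
  have [E|nE] := eqVneq b x2; first by rewrite -E rectint_degx.
  have xE : x2 = re p + k.
    by move: nE; rewrite /x2; case: (leP b (re p + k)) => //; rewrite eqxx.
  by apply: IHp => //; try lra; apply/negP => /and4P[h _ _ _]; lra.
have bot0 : rectint f x1 x2 c y1 = 0.
  have [E|nE] := eqVneq c y1; first by rewrite -E rectint_degy.
  have yE : y1 = im p - k.
    by move: nE; rewrite /y1; case: (leP c (im p - k)) => //; rewrite eqxx.
  by apply: IHp => //; try lra; apply/negP => /and4P[_ _ _ h]; lra.
have top0 : rectint f x1 x2 y2 d = 0.
  have [E|nE] := eqVneq d y2; first by rewrite -E rectint_degy.
  have yE : y2 = im p + k.
    by move: nE; rewrite /y2; case: (leP d (im p + k)) => //; rewrite eqxx.
  by apply: IHp => //; try lra; apply/negP => /and4P[_ _ h _]; lra.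
have x1b : x1 <= b by lra.
have y1d : y1 <= d by lra.
rewrite (rectint_splitx ax1 x1b cd fc) left0 add0r.
rewrite (rectint_splitx x12 x2b cd c1) right0 addr0.
rewrite (rectint_splity x12 cy1 y1d c2) bot0 add0r.
rewrite (rectint_splity x12 y12 y2d c3) top0 addr0.
have := rectint_bound (M := M) x12 y12 (rectcont_bd c4).
suff fM z : onrect x1 x2 y1 y2 z -> cabs (f z) <= M.
  move=> /(_ fM) /le_trans; apply; apply: le_trans k2.
  have -> : 8 * M * k = 2 * M * (4 * k) by ring.
  by rewrite ler_pM2l ?mulr_gt0 //; lra.
move=> /andP[/and4P[z1 z2 z3 z4] _].
have zp : cabs (z - p) < r.
  apply: le_lt_trans (cabs_le_reim _) _; rewrite re_add im_add re_opp im_opp.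
  have : `|re z - re p| <= k by rewrite ler_norml; apply/andP; split; lra.
  have : `|im z - im p| <= k by rewrite ler_norml; apply/andP; split; lra.
  by lra.
by have := Hr _ zp; have := ler_cabs_sub (f z) (f p); rewrite /M; lra.
Qed.

(** Compactness by bisection: the sum of the bounds on four quarters is a bound on their union. *)
Lemma rect_bounded f a b c d : a <= b -> c <= d -> rectcont f a b c d ->
  exists2 M : R, 0 < M & forall z, inrect a b c d z -> cabs (f z) <= M.
Proof.
move=> ab cd fc.
pose P a b c d := exists2 M : R, 0 < M & forall z, inrect a b c d z -> cabs (f z) <= M.
apply: (@rect_bisect _ P) => //.
- move=> a' b' c' d' a1 ab' b1 c1 cd' d1 [M1 m1 H1] [M2 m2 H2] [M3 m3 H3] [M4 m4 H4].
  exists (M1 + M2 + M3 + M4); first by rewrite !addr_gt0.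
  move=> z /and4P[z1 z2 z3 z4].
  case: (leP (re z) ((a' + b') / 2)) => hx; case: (leP (im z) ((c' + d') / 2)) => hy.
  + by have := H1 z; rewrite /inrect z1 z3 hx hy => /(_ isT); lra.
  + by have := H3 z; rewrite /inrect z1 z4 hx (ltW hy) => /(_ isT); lra.
  + by have := H2 z; rewrite /inrect z2 z3 (ltW hx) hy => /(_ isT); lra.
  + by have := H4 z; rewrite /inrect z2 z4 (ltW hx) (ltW hy) => /(_ isT); lra.
- move=> p q pab qcd.
  have pq : inrect a b c d (p +i* q)%C.
    by move: pab qcd => /andP[? ?] /andP[? ?]; apply/and4P.
  have [r r0 Hr] := fc _ pq 1 ltr01.
  exists (r / 2); first by rewrite divr_gt0.
  move=> a' b' c' d' a1 /andP[ap pb] b1 c1 /andP[cq qd] d1 s1 s2.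
  exists (cabs (f (p +i* q)%C) + 1); first by rewrite ltr_wpDl ?cabs_ge0.
  move=> z zin.
  have z0in : inrect a' b' c' d' (p +i* q)%C by apply/and4P; split.
  have dz := cabs_rect_dist zin z0in.
  have zr : cabs (z - (p +i* q)%C) < r by apply: le_lt_trans dz _; lra.
  by have := Hr _ zr; have := ler_cabs_sub (f z) (f (p +i* q)%C); lra.
Qed.

Lemma inside_inrect a b c d z : inside a b c d z -> inrect a b c d z.
Proof. by move=> /and4P[z1 z2 z3 z4]; apply/and4P; split; exact: ltW. Qed.

Lemma inside_dist a b c d w : inside a b c d w -> exists2 r : R, 0 < r &
  (forall z, onrect a b c d z -> r <= cabs (z - w)) /\
  (forall z, cabs (z - w) < r -> inside a b c d z).
Proof.
move=> /and4P[w1 w2 w3 w4].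
pose r := Num.min (Num.min (re w - a) (b - re w)) (Num.min (im w - c) (d - im w)).
have r1 : r <= re w - a by rewrite /r !ge_min lexx.
have r2 : r <= b - re w by rewrite /r !ge_min lexx !orbT.
have r3 : r <= im w - c by rewrite /r !ge_min lexx !orbT.
have r4 : r <= d - im w by rewrite /r !ge_min lexx !orbT.
exists r; first by rewrite !lt_min !subr_gt0 w1 w2 w3 w4.
split=> z.
- move=> /andP[_ /or4P[] /eqP E].
  + apply: le_trans (cabs_re _); rewrite re_add re_opp E.
    by rewrite ler_normr; apply/orP; right; lra.
  + apply: le_trans (cabs_re _); rewrite re_add re_opp E.
    by rewrite ler_normr; apply/orP; left; lra.
  + apply: le_trans (cabs_im _); rewrite im_add im_opp E.
    by rewrite ler_normr; apply/orP; right; lra.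
  + apply: le_trans (cabs_im _); rewrite im_add im_opp E.
    by rewrite ler_normr; apply/orP; left; lra.
- move=> zr; have := le_lt_trans (cabs_re _) zr; have := le_lt_trans (cabs_im _) zr.
  rewrite re_add im_add re_opp im_opp !ltr_norml => /andP[h1 h2] /andP[h3 h4].
  by apply/and4P; split; lra.
Qed.

Lemma inside_lt a b c d w : inside a b c d w -> a < b /\ c < d.
Proof. by move=> /and4P[w1 w2 w3 w4]; split; lra. Qed.

Lemma bdcont_kernel f w n a b c d : inside a b c d w -> bdcont f a b c d ->
  bdcont (fun z => f z / (z - w) ^+ n) a b c d.
Proof.
move=> wi fc z zb; have [r r0 [H _]] := inside_dist wi.
have zw : z - w != 0 by rewrite -cabs_gt0 (lt_le_trans r0) // H.
apply: ccontM; first exact: fc.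
have hd : hasd (fun z : C => z - w) z 1.
  have := hasdB (hasd_id z) (hasd_cst w z); rewrite subr0.
  exact: hasd_local ltr01 _.
have [k hk] := hasdX n hd.
by apply: (hasd_ccont (hasdV hk _)); rewrite expf_neq0.
Qed.

(* Its value 2 pi i is not needed, only that it is nonzero. *)
Definition winding (w : C) a b c d := rectint (fun z => 1 / (z - w) ^+ 1) a b c d.

(** Differentiation under the integral sign: the remainder is quadratic in w - w0 uniformly on the
    contour, and its integral is at most 2 M S |w - w0|^2. *)
Lemma rectint_param (K : C -> C -> C) (K1 : C -> C) w0 (r M : R) a b c d :
  a <= b -> c <= d -> 0 < r -> 0 <= M ->
  (forall w, cabs (w - w0) < r -> bdcont (K w) a b c d) -> bdcont K1 a b c d ->
  (forall w z, cabs (w - w0) < r -> onrect a b c d z ->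
     cabs (K w z - K w0 z - (w - w0) * K1 z) <= M * cabs (w - w0) ^+ 2) ->
  hasd (fun w => rectint (K w) a b c d) w0 (rectint K1 a b c d).
Proof.
move=> ab cd r0 M0 Kc K1c H e e0.
pose S := (b - a) + (d - c).
have S0 : 0 <= S by rewrite addr_ge0 // subr_ge0.
have T0 : 0 < 2 * M * S + 1 by rewrite ltr_wpDl // !mulr_ge0.
exists (Num.min r (e / (2 * M * S + 1))); first by rewrite lt_min r0 divr_gt0.
move=> w; rewrite lt_min => /andP[wr we].
have w0r : cabs (w0 - w0) < r by rewrite subrr cabs0.
have c1 := Kc _ wr; have c2 := Kc _ w0r.
have kc : bdcont (fun z => (w - w0) * K1 z) a b c d.
  by move=> z zb; apply: ccontM; [exact: ccont_cst|exact: K1c].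
have bc : bdcont (fun z => K w z - K w0 z) a b c d.
  move=> z zb; apply: ccontD; first exact: c1.
  apply: (@ccont_local _ (fun v => (-1) * K w0 v) _ _ 1 ltr01); first by move=> v _; rewrite mulN1r.
  by apply: ccontM; [exact: ccont_cst|exact: c2].
have dc : bdcont (fun z => K w z - K w0 z - (w - w0) * K1 z) a b c d.
  move=> z zb; apply: ccontD; first exact: bc.
  apply: (@ccont_local _ (fun v => (-1) * ((w - w0) * K1 v)) _ _ 1 ltr01).
    by move=> v _; rewrite mulN1r.
  by apply: ccontM; [exact: ccont_cst|exact: kc].
have -> : rectint (K w) a b c d - rectint (K w0) a b c d - rectint K1 a b c d * (w - w0)
    = rectint (fun z => K w z - K w0 z - (w - w0) * K1 z) a b c d.
  by rewrite rectintB // rectintB // rectintZ // mulrC.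
apply: le_trans (rectint_bound ab cd dc (fun z zb => H w z wr zb)) _.
rewrite -/S expr2; have := cabs_ge0 (w - w0).
set t := cabs (w - w0) in we *; move=> t0.
have : t * (2 * M * S + 1) <= e by rewrite -ler_pdivlMr // ltW.
move=> /(ler_wpM2r t0) h; have := mulr_ge0 t0 t0.
have -> : 2 * (M * (t * t)) * S = 2 * M * S * t * t by ring.
by lra.
Qed.

Lemma cauchy_kernel1 f w0 a b c d : inside a b c d w0 -> rectcont f a b c d ->
  hasd (fun w => rectint (fun z => f z / (z - w) ^+ 1) a b c d) w0
       (rectint (fun z => f z / (z - w0) ^+ 2) a b c d).
Proof.
move=> wi fc; have [ab cd] := inside_lt wi; have [r r0 [H1 H2]] := inside_dist wi.
have [M M0 fM] := rect_bounded (ltW ab) (ltW cd) fc.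
(* The contour is at distance at least r from w0, hence at least r/2 from w. The three factors bound
   |f|, 1/|z - w| and 1/|z - w0|^2 in the exact remainder f(z) (w - w0)^2 / ((z - w) (z - w0)^2). *)
apply: (@rectint_param (fun w z => f z / (z - w) ^+ 1) _ w0 (r / 2) (M * (2 / r) * (1 / r) ^+ 2)) => //.
- exact: ltW.
- exact: ltW.
- by rewrite divr_gt0.
- by rewrite !mulr_ge0 ?exprn_ge0 ?invr_ge0 // ltW.
- move=> w wr; apply: bdcont_kernel; last exact: rectcont_bd.
  by apply: H2; lra.
- by apply: bdcont_kernel => //; exact: rectcont_bd.
move=> w z wr zb.
have z1 := H1 _ zb.
have z2 : r / 2 <= cabs (z - w).
  have := ler_cabsD (z - w) (w - w0); rewrite subrKA; lra.
have n1 : z - w0 != 0 by rewrite -cabs_gt0 (lt_le_trans r0).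
have n2 : z - w != 0 by rewrite -cabs_gt0 (lt_le_trans _ z2) // divr_gt0.
have -> : f z / (z - w) ^+ 1 - f z / (z - w0) ^+ 1 - (w - w0) * (f z / (z - w0) ^+ 2) =
   f z * (z - w)^-1 * ((z - w0)^-1) ^+ 2 * (w - w0) ^+ 2.
  by field; rewrite n1 n2.
rewrite !(cabsX, cabsM, cabsV); apply: ler_wpM2r; first by rewrite exprn_ge0 ?cabs_ge0.
have i1 : (cabs (z - w))^-1 <= 2 / r.
  by rewrite -[2 / r]invrK lef_pV2 ?posrE ?invf_div ?divr_gt0 // (lt_le_trans _ z2) // divr_gt0.
have i2 : (cabs (z - w0))^-1 <= 1 / r.
  by rewrite -[1 / r]invrK lef_pV2 ?posrE ?invf_div ?divr1 // (lt_le_trans r0).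
apply: ler_pM; rewrite ?mulr_ge0 ?exprn_ge0 ?invr_ge0 ?cabs_ge0 //.
  apply: ler_pM; rewrite ?invr_ge0 ?cabs_ge0 //.
  by apply: fM; case/andP: zb.
by apply: lerXn2r; rewrite ?nnegrE ?invr_ge0 ?cabs_ge0 // divr_ge0 // ltW.
Qed.

Lemma cauchy_kernel2 f w0 a b c d : inside a b c d w0 -> rectcont f a b c d ->
  hasd (fun w => rectint (fun z => f z / (z - w) ^+ 2) a b c d) w0
       (rectint (fun z => (2 * f z) / (z - w0) ^+ 3) a b c d).
Proof.
move=> wi fc; have [ab cd] := inside_lt wi; have [r r0 [H1 H2]] := inside_dist wi.
have [M M0 fM] := rect_bounded (ltW ab) (ltW cd) fc.
apply: (@rectint_param (fun w z => f z / (z - w) ^+ 2) _ w0 (r / 2)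
   (M * ((2 / r) ^+ 2 * (1 / r) ^+ 2 + 2 * ((2 / r) * (1 / r) ^+ 3)))) => //.
- exact: ltW.
- exact: ltW.
- by rewrite divr_gt0.
- by rewrite !(mulr_ge0, addr_ge0, exprn_ge0) // ?invr_ge0 ltW.
- move=> w wr; apply: bdcont_kernel; last exact: rectcont_bd.
  by apply: H2; lra.
- apply: bdcont_kernel => // z /andP[/fc zc _].
  by apply: ccontM => //; exact: ccont_cst.
move=> w z wr zb.
have z1 := H1 _ zb.
have z2 : r / 2 <= cabs (z - w).
  have := ler_cabsD (z - w) (w - w0); rewrite subrKA; lra.
have n1 : z - w0 != 0 by rewrite -cabs_gt0 (lt_le_trans r0).
have n2 : z - w != 0 by rewrite -cabs_gt0 (lt_le_trans _ z2) // divr_gt0.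
have -> : f z / (z - w) ^+ 2 - f z / (z - w0) ^+ 2 - (w - w0) * (2 * f z / (z - w0) ^+ 3) =
   f z * (((z - w)^-1) ^+ 2 * ((z - w0)^-1) ^+ 2 + 2 * ((z - w)^-1 * ((z - w0)^-1) ^+ 3))
     * (w - w0) ^+ 2.
  by field; rewrite n1 n2.
rewrite 2!cabsM cabsX; apply: ler_wpM2r; first by rewrite exprn_ge0 ?cabs_ge0.
have i1 : (cabs (z - w))^-1 <= 2 / r.
  by rewrite -[2 / r]invrK lef_pV2 ?posrE ?invf_div ?divr_gt0 // (lt_le_trans _ z2) // divr_gt0.
have i2 : (cabs (z - w0))^-1 <= 1 / r.
  by rewrite -[1 / r]invrK lef_pV2 ?posrE ?invf_div ?divr1 // (lt_le_trans r0).
apply: ler_pM; rewrite ?cabs_ge0 //; first by apply: fM; case/andP: zb.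
apply: le_trans (ler_cabsD _ _) _; rewrite !(cabsX, cabsM, cabsV).
have c2 : cabs (2 : C) = 2 by have := cabs_real (2 : R); rewrite normr_nat rmorphMn.
rewrite c2; apply: lerD.
  by apply: ler_pM; rewrite ?exprn_ge0 ?invr_ge0 ?cabs_ge0 //;
    apply: lerXn2r; rewrite ?nnegrE ?invr_ge0 ?cabs_ge0 // divr_ge0 // ltW.
rewrite ler_pM2l //; apply: ler_pM; rewrite ?exprn_ge0 ?invr_ge0 ?cabs_ge0 //.
by apply: lerXn2r; rewrite ?nnegrE ?invr_ge0 ?cabs_ge0 // divr_ge0 // ltW.
Qed.

End Cauchy.

(** * Cauchy's formula and its consequences *)

Section CauchyConsequences.
Context {R : realType}.
Local Notation C := R[i].
Local Notation re := (@complex.Re R).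
Local Notation im := (@complex.Im R).
Local Notation mu := (@lebesgue_measure R).
Implicit Types (f g : C -> C) (a b c d : R).

Lemma im_inv (z : C) : im z^-1 = - im z / (cabs z ^+ 2).
Proof. by rewrite cabs_sqr mulNr; case: z => x y. Qed.

Lemma re_inv (z : C) : re z^-1 = re z / (cabs z ^+ 2).
Proof. by rewrite cabs_sqr; case: z => x y. Qed.

Lemma Rintegral_segment_ge (f : R -> R) (a b m : R) : a <= b ->
  mu.-integrable `[a, b] (EFin \o f) -> (forall x, a <= x <= b -> m <= f x) ->
  m * (b - a) <= Rintegral mu `[a, b] f.
Proof.
move=> ab fi fm; rewrite -Rintegral_segment_cst //; apply: le_Rintegral => //.
have [] := @rcont_cintegrable R a b (fun=> m%:C) => //.
by move=> x _ e e0; exists 1 => // y _; rewrite subrr cabs0.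
Qed.

Lemma cint_im_ge0 (p : R -> C) (a b m : R) : a <= b -> cintegrable `[a, b] p ->
  (forall x, a <= x <= b -> m <= im (p x)) -> m * (b - a) <= im (cint `[a, b] p).
Proof. by move=> ab [_ h]; exact: Rintegral_segment_ge. Qed.

Lemma cint_re_ge0 (p : R -> C) (a b m : R) : a <= b -> cintegrable `[a, b] p ->
  (forall x, a <= x <= b -> m <= re (p x)) -> m * (b - a) <= re (cint `[a, b] p).
Proof. by move=> ab [h _]; exact: Rintegral_segment_ge. Qed.

(** Each side contributes a nonnegative imaginary part, and the bottom side at least m (b - a) > 0,
    because |z - w| <= S there. *)
Lemma winding_neq0 w a b c d : inside a b c d w -> winding w a b c d != 0.
Proof.
move=> wi; have [ab cd] := inside_lt wi; have [r r0 [H1 H2]] := inside_dist wi.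
pose k (z : C) := 1 / (z - w) ^+ 1.
have kc : bdcont k a b c d.
  by apply: (bdcont_kernel 1 wi) => z _; exact: ccont_cst.
have [k1 k2 k3 k4] := rect_side kc (ltW ab) (ltW cd).
have kE z : k z = (z - w)^-1 by rewrite /k expr1 mul1r.
move: (wi) => /and4P[w1 w2 w3 w4].
pose S := (b - a) + (d - c).
have S0 : 0 < S by rewrite addr_gt0 // subr_gt0.
pose m := (im w - c) / S ^+ 2.
have m0 : 0 < m by rewrite divr_gt0 ?exprn_gt0 // subr_gt0.
have i1 : m * (b - a) <= im (cint `[a, b] (fun x => k (x +i* c)%C)).
  apply: (cint_im_ge0 (ltW ab) k1) => x /andP[x1 x2].
  have zb : onrect a b c d (x +i* c)%C.
    by rewrite /onrect /inrect /= x1 x2 lexx eqxx (ltW cd) !orbT.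
  have zr := H1 _ zb; have z0 : 0 < cabs ((x +i* c)%C - w) by exact: lt_le_trans zr.
  have zS : cabs ((x +i* c)%C - w) <= S.
    by apply: cabs_rect_dist; [case/andP: zb|exact: inside_inrect].
  rewrite kE im_inv im_add im_opp /= /m opprB.
  apply: ler_wpM2l; first by rewrite subr_ge0 ltW.
  rewrite lef_pV2 ?posrE ?exprn_gt0 //.
  by apply: lerXn2r; rewrite ?nnegrE // ltW.
have pos (z : C) (t : R) : 0 <= t -> 0 <= t / cabs z ^+ 2.
  by move=> t0; rewrite divr_ge0 ?exprn_ge0 ?cabs_ge0.
have i2 : 0 * (b - a) <= im (cint `[a, b] (fun x => - k (x +i* d)%C)).
  apply: (cint_im_ge0 (ltW ab)); first exact: cintegrableN.
  move=> x _; rewrite im_opp kE im_inv im_add im_opp /= mulNr opprK.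
  by apply: pos; rewrite subr_ge0 ltW.
have i3 : 0 * (d - c) <= re (cint `[c, d] (fun y => k (b +i* y)%C)).
  apply: (cint_re_ge0 (ltW cd)) => // x _; rewrite kE re_inv re_add re_opp /=.
  by apply: pos; rewrite subr_ge0 ltW.
have i4 : 0 * (d - c) <= re (cint `[c, d] (fun y => - k (a +i* y)%C)).
  apply: (cint_re_ge0 (ltW cd)); first exact: cintegrableN.
  move=> x _; rewrite re_opp kE re_inv re_add re_opp /= -mulNr.
  by apply: pos; rewrite opprB subr_ge0 ltW.
rewrite cintN // im_opp in i2; rewrite cintN // re_opp in i4.
have h : 0 < m * (b - a) by rewrite mulr_gt0 // subr_gt0.
apply/eqP => /(congr1 im); rewrite /winding /rectint -/k.
rewrite !mul0r in i2 i3 i4; move: i1 i2 i3 i4.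
set X1 := cint _ _; set X2 := cint _ _; set X3 := cint _ _; set X4 := cint _ _.
rewrite !(im_add, im_opp, im_mul) [re 'i%C]/= [im 'i%C]/= [im 0]/=.
by lra.
Qed.

(** The difference quotient of f at w, completed by the derivative, is continuous, and holomorphic
    off w and [s]; its integral is 0 by [goursat_except]. The exceptional points are what
    [removable] relies on. *)
Lemma cauchy_formula f (s : seq C) w a b c d : inside a b c d w ->
  rectcont f a b c d -> w \notin s ->
  (forall z, inrect a b c d z -> z \notin s -> holomorphic_at f z) ->
  f w * winding w a b c d = rectint (fun z => f z / (z - w) ^+ 1) a b c d.
Proof.
move=> wi fc ws fh; have [ab cd] := inside_lt wi; have [r r0 [H1 _]] := inside_dist wi.
have /holo_hasd[e fd] := fh _ (inside_inrect wi) ws.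
pose g z := if z == w then e else (f z - f w) / (z - w).
have gE z : z != w -> g z = (f z - f w) * (z - w)^-1 by rewrite /g => /negbTE ->.
have hsub v : hasd (fun z : C => z - w) v 1.
  have := hasdB (hasd_id v) (hasd_cst w v); rewrite subr0.
  exact: hasd_local ltr01 _.
have gloc v : v != w -> exists2 t : R, 0 < t & forall z, cabs (z - v) < t ->
    (f z - f w) * (z - w)^-1 = g z.
  move=> vw; exists (cabs (w - v)); first by rewrite cabs_gt0 subr_eq0 eq_sym.
  by move=> z zv; rewrite gE //; apply: contraTneq zv => ->; rewrite ltxx.
have gc : rectcont g a b c d.
  move=> v vin; have [->|vw] := eqVneq v w.
    have := fd => /hasd_car[p [pc pe] [t t0 Ht]].
    apply: (ccont_local t0) pc => z zt; rewrite /g; case: eqVneq => [->//|zw].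
    by rewrite (Ht _ zt) addrAC subrr add0r mulfK // subr_eq0.
  have [t t0 Ht] := gloc v vw; apply: (ccont_local t0 Ht).
  apply: ccontM.
    by apply: ccontD; [exact: fc|exact: ccont_cst].
  by apply: ccontV; [exact: hasd_ccont (hsub v)|rewrite subr_eq0].
have gh z : inrect a b c d z -> z \notin w :: s -> holomorphic_at g z.
  rewrite in_cons negb_or => zin /andP[zw zs].
  have [t t0 Ht] := gloc z zw; have /holo_hasd[l fl] := fh _ zin zs.
  apply/holo_hasd; eexists; apply: (hasd_local t0 Ht).
  apply: hasdM; first exact: hasdB fl (hasd_cst (f w) z).
  by apply: hasdV; [exact: hsub|rewrite subr_eq0].
have G0 := goursat_except (ltW ab) (ltW cd) gc gh.
have b1 : bdcont (fun z => f z / (z - w) ^+ 1) a b c d.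
  by apply: bdcont_kernel => //; exact: rectcont_bd.
have b2 : bdcont (fun z => 1 / (z - w) ^+ 1) a b c d.
  by apply: (bdcont_kernel 1 wi) => z _; exact: ccont_cst.
have b3 : bdcont (fun z => f w * (1 / (z - w) ^+ 1)) a b c d.
  by move=> z zb; apply: ccontM; [exact: ccont_cst|exact: b2].
rewrite /winding -rectintZ ?ltW //; apply/eqP; rewrite eq_sym -subr_eq0.
rewrite -rectintB ?ltW // -[X in _ == X]G0; apply/eqP; apply: eq_rectint; rewrite ?ltW //.
move=> z zb; have zw : z != w.
  by rewrite -subr_eq0 -cabs_gt0 (lt_le_trans r0) // H1.
by rewrite gE //; field; rewrite subr_eq0.
Qed.

(** Cauchy's formula writes f as a quotient of two contour integrals depending on w. Both can be
    differentiated twice, so f is holomorphic, and so is its derivative, given by the quotient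
    rule. *)
Lemma holo_of_cauchy f a b c d : rectcont f a b c d ->
  (forall w, inside a b c d w ->
    f w * winding w a b c d = rectint (fun z => f z / (z - w) ^+ 1) a b c d) ->
  exists f' : C -> C, forall w, inside a b c d w -> hasd f w (f' w) /\ holomorphic_at f' w.
Proof.
move=> fc F.
have oc : rectcont (fun=> 1 : C) a b c d by move=> z _; exact: ccont_cst.
pose A k w := rectint (fun z => f z / (z - w) ^+ k) a b c d.
pose B k w := rectint (fun z => 1 / (z - w) ^+ k) a b c d.
exists (fun w => A 2%N w * (B 1%N w)^-1 + A 1%N w * (- B 2%N w / B 1%N w ^+ 2)) => w wi.
have B0 v : inside a b c d v -> B 1%N v != 0 by move=> vi; exact: winding_neq0.
have A1 := cauchy_kernel1 wi fc; have B1 := cauchy_kernel1 wi oc.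
have A2 := cauchy_kernel2 wi fc; have B2 := cauchy_kernel2 wi oc.
have BV := hasdV B1 (B0 _ wi).
have [r r0 [_ Hin]] := inside_dist wi.
split.
- apply: hasd_local r0 _ (hasdM A1 BV) => v /Hin vi.
  by rewrite -F // /winding -/(B 1%N v) mulfK // B0.
- have [e he] := hasdX 2 B1; apply/holo_hasd; eexists.
  apply: hasdD; first exact: hasdM A2 BV.
  apply: hasdM; first exact: A1.
  apply: hasdM; first exact: hasdN B2.
  by apply: hasdV he _; rewrite expf_neq0 // B0.
Qed.

Lemma holo_deriv f a b c d :
  (forall z, inrect a b c d z -> holomorphic_at f z) ->
  exists f' : C -> C, forall w, inside a b c d w -> hasd f w (f' w) /\ holomorphic_at f' w.
Proof.
move=> fh; have fc : rectcont f a b c d.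
  by move=> z /fh/holo_hasd[k /hasd_ccont].
apply: holo_of_cauchy => // w wi; apply: (@cauchy_formula f [::]) => // z zi _; exact: fh.
Qed.

(** Cauchy's formula holds at every w other than p. Both of its sides are continuous in w, so it
    holds at p as well. *)
Lemma removable f p a b c d : rectcont f a b c d -> inside a b c d p ->
  (forall z, inrect a b c d z -> z != p -> holomorphic_at f z) -> holomorphic_at f p.
Proof.
move=> fc pin fh.
have F w : inside a b c d w -> w != p ->
    f w * winding w a b c d = rectint (fun z => f z / (z - w) ^+ 1) a b c d.
  move=> wi wp; apply: (@cauchy_formula f [:: p]) => //; first by rewrite inE.
  by move=> z zi; rewrite inE; exact: fh.
suff Fp : f p * winding p a b c d = rectint (fun z => f z / (z - p) ^+ 1) a b c d.
  have [|f' H] := @holo_of_cauchy f a b c d fc.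
    by move=> w wi; have [->//|] := eqVneq w p; exact: F.
  by apply/holo_hasd; exists (f' p); have [] := H _ pin.
have oc : rectcont (fun=> 1 : C) a b c d by move=> z _; exact: ccont_cst.
have Ac := hasd_ccont (cauchy_kernel1 pin fc).
have Bc := hasd_ccont (cauchy_kernel1 pin oc).
have Dc : ccont (fun w => f w * winding w a b c d -
    rectint (fun z => f z / (z - w) ^+ 1) a b c d) p.
  apply: ccontD; first by apply: ccontM => //; apply: fc; exact: inside_inrect.
  have := ccontM (ccont_cst (-1) p) Ac.
  by apply: (ccont_local ltr01) => v _; rewrite mulN1r.
apply/eqP; rewrite -subr_eq0 -cabs_eq0; apply: contraT => h.
have h0 : 0 < cabs (f p * winding p a b c d -
    rectint (fun z => f z / (z - p) ^+ 1) a b c d) by rewrite lt_def h cabs_ge0.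
have [t t0 Ht] := Dc _ h0; have [r r0 [_ Hin]] := inside_dist pin.
pose e := Num.min t r / 2.
have m0 : 0 < Num.min t r by rewrite lt_min t0.
have e0 : 0 < e by rewrite divr_gt0.
have er : e < Num.min t r by rewrite /e; lra.
have vp : cabs (p + e%:C - p) < Num.min t r.
  by rewrite addrAC subrr add0r cabs_real gtr0_norm.
move: vp; rewrite lt_min => /andP[v1 v2].
have := Ht _ v1; rewrite F; last 2 first.
- exact: Hin.
- rewrite -subr_eq0 addrAC subrr add0r -cabs_gt0 cabs_real gtr0_norm //.
by rewrite subrr sub0r cabsN ltxx.
Qed.

(** Both sides of Cauchy's formula pass to the uniform limit. *)
Lemma unif_limit_holo (u : nat -> C -> C) f a b c d :
  (forall n z, inrect a b c d z -> holomorphic_at (u n) z) ->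
  (forall e : R, 0 < e -> exists n, forall z, inrect a b c d z -> cabs (u n z - f z) <= e) ->
  rectcont f a b c d ->
  forall w, inside a b c d w -> holomorphic_at f w.
Proof.
move=> uh uf fc w wi.
have F v : inside a b c d v ->
    f v * winding v a b c d = rectint (fun z => f z / (z - v) ^+ 1) a b c d.
  move=> vi; have [ab cd] := inside_lt vi; have [r r0 [H1 _]] := inside_dist vi.
  apply/eqP; rewrite -subr_eq0 -cabs_eq0 eq_le cabs_ge0 andbT leNgt; apply/negP.
  set D := cabs _ => D0.
  pose S := (b - a) + (d - c).
  have S0 : 0 < S by rewrite addr_gt0 // subr_gt0.
  pose W := cabs (winding v a b c d); have W0 : 0 <= W := cabs_ge0 _.
  pose K := W + 2 * (1 / r) * S.
  have K0 : 0 < K by rewrite ltr_wpDl // !mulr_gt0 // invr_gt0.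
  (* K bounds the effect of a unit uniform error on the two sides together, so this precision costs
     at most D/2, while the defect is D. *)
  have [n Hn] := uf (D / (2 * K)) (divr_gt0 D0 (mulr_gt0 (ltr0n _ 2) K0)).
  have unc : rectcont (u n) a b c d by move=> z /(uh n)/holo_hasd[k /hasd_ccont].
  have Fn : u n v * winding v a b c d = rectint (fun z => u n z / (z - v) ^+ 1) a b c d.
    by apply: (@cauchy_formula (u n) [::]) => // z zi _; exact: uh.
  have b1 : bdcont (fun z => f z / (z - v) ^+ 1) a b c d.
    by apply: bdcont_kernel => //; exact: rectcont_bd.
  have b2 : bdcont (fun z => u n z / (z - v) ^+ 1) a b c d.
    by apply: bdcont_kernel => //; exact: rectcont_bd.
  have b3 : bdcont (fun z => u n z / (z - v) ^+ 1 - f z / (z - v) ^+ 1) a b c d.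
    move=> z zb; apply: ccontD; first exact: b2.
    have := ccontM (ccont_cst (-1) z) (b1 _ zb).
    by apply: (ccont_local ltr01) => t _; rewrite mulN1r.
  have I := rectint_bound (M := D / (2 * K) * (1 / r)) (ltW ab) (ltW cd) b3.
  have {}I : cabs (rectint (fun z => u n z / (z - v) ^+ 1 - f z / (z - v) ^+ 1) a b c d)
      <= 2 * (D / (2 * K) * (1 / r)) * S.
    apply: I => z zb; rewrite expr1 -mulrBl cabs_div.
    apply: ler_pM; rewrite ?invr_ge0 ?cabs_ge0 //; first by apply: Hn; case/andP: zb.
    by rewrite div1r lef_pV2 ?posrE // ?H1 // (lt_le_trans r0) // H1.
  have J : cabs ((u n v - f v) * winding v a b c d) <= D / (2 * K) * W.
    by rewrite cabsM ler_wpM2r // Hn // inside_inrect.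
  have DE : D <= D / (2 * K) * W + 2 * (D / (2 * K) * (1 / r)) * S.
    have XE : D = cabs (- ((u n v - f v) * winding v a b c d) +
      rectint (fun z => u n z / (z - v) ^+ 1 - f z / (z - v) ^+ 1) a b c d).
      by rewrite rectintB ?ltW // -Fn /D; congr cabs; ring.
    rewrite [leLHS]XE; apply: le_trans (ler_cabsD _ _) _; rewrite cabsN.
    exact: lerD.
  have E : D / (2 * K) * W + 2 * (D / (2 * K) * (1 / r)) * S = D / 2.
    rewrite (_ : _ + _ = D / (2 * K) * K); last by rewrite /K; ring.
    by field; rewrite gt_eqF.
  by move: DE; rewrite E; lra.
have [f' H] := holo_of_cauchy fc F.
by apply/holo_hasd; exists (f' w); have [] := H _ wi.
Qed.

Lemma expr_small (t e : R) : 0 <= t < 1 -> 0 < e -> exists n, t ^+ n < e.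
Proof.
move=> /andP[t0 t1] e0.
have /cvgrPdist_lt/(_ _ e0) : t ^+ n @[n --> \oo] --> (0 : R).
  by apply: cvg_expr; rewrite ger0_norm.
case=> N _ /(_ N (leqnn N)); rewrite /= sub0r normrN ger0_norm ?exprn_ge0 //.
by exists N.
Qed.

(* Cauchy's formula applied to all powers of f removes the constant. *)
Lemma max_modulus f a b c d M w : 
  (forall z, inrect a b c d z -> holomorphic_at f z) ->
  (forall z, onrect a b c d z -> cabs (f z) <= M) ->
  inside a b c d w -> cabs (f w) <= M.
Proof.
move=> fh fM wi; rewrite leNgt; apply/negP => Mf.
have [ab cd] := inside_lt wi; have [r r0 [H1 _]] := inside_dist wi.
have M0 : 0 <= M.
  apply: le_trans (cabs_ge0 (f (a +i* c)%C)) (fM _ _).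
  by rewrite /onrect /inrect /= !lexx eqxx (ltW ab) (ltW cd).
have fw0 : 0 < cabs (f w) by exact: le_lt_trans Mf.
pose W := cabs (winding w a b c d).
have W0 : 0 < W by rewrite cabs_gt0 winding_neq0.
pose S := (b - a) + (d - c).
have S0 : 0 < S by rewrite addr_gt0 // subr_gt0.
have key n : cabs (f w) ^+ n * W <= 2 * (M ^+ n * (1 / r)) * S.
  have fnh z : inrect a b c d z -> holomorphic_at (fun z => f z ^+ n) z.
    by move=> /fh/holo_hasd[k /(hasdX n)] h; apply/holo_hasd.
  have fnc : rectcont (fun z => f z ^+ n) a b c d.
    by move=> z /fnh/holo_hasd[k /hasd_ccont].
  rewrite -cabsX -cabsM (@cauchy_formula (fun z => f z ^+ n) [::]) //; last first.
    by move=> z zi _; exact: fnh.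
  apply: rectint_bound; rewrite ?ltW //.
    by apply: (bdcont_kernel 1 wi); exact: rectcont_bd.
  move=> z zb; rewrite expr1 cabs_div cabsX.
  apply: ler_pM; rewrite ?invr_ge0 ?exprn_ge0 ?cabs_ge0 //.
    by apply: lerXn2r; rewrite ?nnegrE ?cabs_ge0 ?fM.
  by rewrite div1r lef_pV2 ?posrE // ?H1 // (lt_le_trans r0) // H1.
pose K := 2 * (1 / r) * S.
have K0 : 0 < K by rewrite !mulr_gt0 // invr_gt0.
have t01 : 0 <= M / cabs (f w) < 1.
  by rewrite divr_ge0 ?cabs_ge0 //= ltr_pdivrMr // mul1r.
(* For this n the geometric factor (M / |f(w)|)^n beats the constant K / W, which contradicts
   [key]. *)
have [n Hn] := expr_small t01 (divr_gt0 W0 K0).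
move: Hn; rewrite ltr_pdivlMr // exprMn exprVn mulrAC ltr_pdivrMr ?exprn_gt0 //.
have := key n; rewrite /K.
have -> : 2 * (M ^+ n * (1 / r)) * S = M ^+ n * (2 * (1 / r) * S) by ring.
by move=> h1 h2; have := le_lt_trans h1 h2; rewrite mulrC ltxx.
Qed.

End CauchyConsequences.

(** * Primitives and divided differences *)

Section Primitives.
Context {R : realType}.
Local Notation C := R[i].
Local Notation re := (@complex.Re R).
Local Notation im := (@complex.Im R).
Implicit Types (f g F : C -> C) (a b c d : R).

Lemma complex_eta (z : C) : (re z +i* im z)%C = z. Proof. by case: z. Qed.

(** A mean value estimate by bisection: the increment along a diagonal splits at the centre into the
    increments along diagonals of two opposite quarters, each with half the perimeter. The two
    diagonals together use all four quarters, so both are treated at once. *)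
Lemma hasd0_diag F a b c d : a <= b -> c <= d ->
  (forall z, inrect a b c d z -> hasd F z 0) ->
  F (b +i* d)%C = F (a +i* c)%C /\ F (b +i* c)%C = F (a +i* d)%C.
Proof.
move=> ab cd F0.
pose S := (b - a) + (d - c).
have S0 : 0 <= S by rewrite addr_ge0 // subr_ge0.
suff H e : 0 < e -> cabs (F (b +i* d)%C - F (a +i* c)%C) <= e * S /\
    cabs (F (b +i* c)%C - F (a +i* d)%C) <= e * S.
  have T (z : C) : (forall e : R, 0 < e -> cabs z <= e * S) -> z = 0.
    move=> h; apply/eqP; rewrite -cabs_eq0 eq_le cabs_ge0 andbT leNgt; apply/negP => z0.
    have T0 : 0 < S + 1 by rewrite ltr_wpDl.
    have := h (cabs z / (2 * (S + 1))); rewrite divr_gt0 ?mulr_gt0 // => /(_ isT).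
    by rewrite mulrAC ler_pdivlMr ?mulr_gt0 // ler_pM2l //; lra.
  by split; apply/eqP; rewrite -subr_eq0; apply/eqP/T => e /H[].
move=> e0.
apply: (@rect_bisect _ (fun a b c d => cabs (F (b +i* d)%C - F (a +i* c)%C) <= e * ((b - a) + (d - c)) /\
  cabs (F (b +i* c)%C - F (a +i* d)%C) <= e * ((b - a) + (d - c)))) => //.
- move=> a' b' c' d' _ _ _ _ _ _.
  set m := (a' + b') / 2; set n := (c' + d') / 2.
  move=> [h1 _] [_ h2] [_ h3] [h4 _]; split.
    have -> : F (b' +i* d')%C - F (a' +i* c')%C = (F (b' +i* d')%C - F (m +i* n)%C) +
      (F (m +i* n)%C - F (a' +i* c')%C) by ring.
    apply: le_trans (ler_cabsD _ _) _; apply: le_trans (lerD h4 h1) _.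
    by rewrite -mulrDr ler_pM2l // /m /n; lra.
  have -> : F (b' +i* c')%C - F (a' +i* d')%C = (F (b' +i* c')%C - F (m +i* n)%C) +
    (F (m +i* n)%C - F (a' +i* d')%C) by ring.
  apply: le_trans (ler_cabsD _ _) _; apply: le_trans (lerD h2 h3) _.
  by rewrite -mulrDr ler_pM2l // /m /n; lra.
- move=> p q pab qcd.
  have pq : inrect a b c d (p +i* q)%C.
    by move: pab qcd => /andP[? ?] /andP[? ?]; apply/and4P.
  have e2 : 0 < e / 2 by rewrite divr_gt0.
  have [r r0 Hr] := F0 _ pq _ e2.
  exists (r / 2); first by rewrite divr_gt0.
  move=> a' b' c' d' a1 /andP[ap pb] b1 c1 /andP[cq qd] d1 s1 s2.
  have z0in : inrect a' b' c' d' (p +i* q)%C by apply/and4P; split.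
  have K z : inrect a' b' c' d' z -> cabs (F z - F (p +i* q)%C) <= e / 2 * ((b' - a') + (d' - c')).
    move=> zin; have dz := cabs_rect_dist zin z0in.
    have zr : cabs (z - (p +i* q)%C) < r by apply: le_lt_trans dz _; lra.
    have := Hr _ zr; rewrite mul0r subr0 => /le_trans; apply.
    by rewrite ler_pM2l.
  have ab' : a' <= b' := le_trans ap pb.
  have cd' : c' <= d' := le_trans cq qd.
  have X z w : inrect a' b' c' d' z -> inrect a' b' c' d' w ->
      cabs (F z - F w) <= e * ((b' - a') + (d' - c')).
    move=> /K kz /K; rewrite cabsBC => kw.
    have -> : F z - F w = (F z - F (p +i* q)%C) + (F (p +i* q)%C - F w) by ring.
    apply: le_trans (ler_cabsD _ _) _; apply: le_trans (lerD kz kw) _.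
    by rewrite -mulrDl -splitr.
  by split; apply: X; rewrite /inrect /= ?lexx ?ab' ?cd'.
Qed.

Section Strip.
(* The domain {z | P (im z)}: a half-plane, a strip or the whole plane. *)
Variable P : R -> Prop.
Hypothesis Pconv : forall y1 y2 y, P y1 -> P y2 -> y1 <= y <= y2 -> P y.
Hypothesis Popen : forall y, P y -> exists2 t : R, 0 < t &
  forall y', `|y' - y| < t -> P y'.

Lemma hasd0_cst F : (forall z, P (im z) -> hasd F z 0) ->
  forall z w, P (im z) -> P (im w) -> F z = F w.
Proof.
move=> F0.
have W z w : P (im z) -> P (im w) -> re z <= re w -> F z = F w.
  move=> Pz Pw xle; case: (leP (im z) (im w)) => y.
    have [|] := @hasd0_diag F (re z) (re w) (im z) (im w) xle y.
      by move=> v /and4P[_ _ v1 v2]; apply: F0; apply: (Pconv Pz Pw); rewrite v1.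
    by rewrite !complex_eta.
  have [|_] := @hasd0_diag F (re z) (re w) (im w) (im z) xle (ltW y).
    by move=> v /and4P[_ _ v1 v2]; apply: F0; apply: (Pconv Pw Pz); rewrite v1.
  by rewrite !complex_eta.
move=> z w Pz Pw; case: (leP (re z) (re w)) => [|/ltW] h; first exact: W.
by symmetry; exact: W.
Qed.

Definition oint (p : R -> C) (x1 x2 : R) : C :=
  if x1 <= x2 then cint `[x1, x2] p else - cint `[x2, x1] p.

Lemma oint_chasles (Q : R -> Prop) (p : R -> C) x0 x1 x2 :
  (forall y1 y2 y, Q y1 -> Q y2 -> y1 <= y <= y2 -> Q y) ->
  (forall x, Q x -> rcont p x) -> Q x0 -> Q x1 -> Q x2 -> x1 <= x2 ->
  oint p x0 x2 - oint p x0 x1 = cint `[x1, x2] p.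
Proof.
move=> Qc pc q0 q1 q2 x12.
have I u v : Q u -> Q v -> cintegrable `[u, v] p.
  by move=> qu qv; apply: rcont_cintegrable => x xuv; apply: pc; exact: Qc xuv.
rewrite /oint; case: (leP x0 x1) => h1.
  by rewrite (le_trans h1 x12) (cint_split h1 x12 (I _ _ q0 q2)); ring.
case: (leP x0 x2) => h2.
  by rewrite (cint_split (ltW h1) h2 (I _ _ q1 q2)); ring.
by rewrite (cint_split x12 (ltW h2) (I _ _ q1 q0)); ring.
Qed.

Lemma cint_near (p : R -> C) (k : C) (x1 x2 e : R) : x1 <= x2 ->
  (forall x, x1 <= x <= x2 -> rcont p x) ->
  (forall x, x1 <= x <= x2 -> cabs (p x - k) <= e) ->
  cabs (cint `[x1, x2] p - (x2 - x1)%:C * k) <= e * (x2 - x1).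
Proof.
move=> x12 pc pk; have pi := rcont_cintegrable pc.
have ki : cintegrable `[x1, x2] (fun=> k).
  by apply: rcont_cintegrable => x _ t t0; exists 1 => // y _; rewrite subrr cabs0.
rewrite -cint_cst // -cintB //; apply: cabs_cint_bound => //.
exact: cintegrableB.
Qed.

(** F integrates f along the horizontal line at height y0 and then vertically. By Goursat the
    horizontal increments may be computed at any other height, so F has the right increments in both
    directions. *)
Lemma primitive f : (forall z, P (im z) -> holomorphic_at f z) ->
  exists F : C -> C, forall z, P (im z) -> hasd F z (f z).
Proof.
move=> fh; have [[y0 Py0]|nP] := pselect (exists y0, P y0); last first.
  by exists (fun=> 0) => z Pz; exfalso; apply: nP; exists (im z).
have fc z : P (im z) -> ccont f z by move=> /fh/holo_hasd[k /hasd_ccont].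
pose F z := oint (fun t => f (t +i* y0)%C) 0 (re z) +
  'i%C * oint (fun t => f (re z +i* t)%C) y0 (im z).
have V x y1 y2 : P y1 -> P y2 -> y1 <= y2 ->
    F (x +i* y2)%C - F (x +i* y1)%C = 'i%C * cint `[y1, y2] (fun t => f (x +i* t)%C).
  move=> P1 P2 y12; rewrite /F /= -(@oint_chasles P _ y0 y1 y2) //; first by ring.
  by move=> t Pt; apply: rcont_ver; exact: fc.
have H y x1 x2 : P y -> x1 <= x2 ->
    F (x2 +i* y)%C - F (x1 +i* y)%C = cint `[x1, x2] (fun t => f (t +i* y)%C).
  move=> Py x12.
  have E : oint (fun t => f (t +i* y0)%C) 0 x2 - oint (fun t => f (t +i* y0)%C) 0 x1 =
      cint `[x1, x2] (fun t => f (t +i* y0)%C).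
    by apply: (@oint_chasles (fun=> True)) => // t _; apply: rcont_hor; exact: fc.
  transitivity (cint `[x1, x2] (fun t => f (t +i* y0)%C) +
    ('i%C * oint (fun t => f (x2 +i* t)%C) y0 y - 'i%C * oint (fun t => f (x1 +i* t)%C) y0 y)).
    by rewrite -E /F /=; ring.
  rewrite /oint; case: (leP y0 y) => hy.
    have := @goursat R f x1 x2 y0 y x12 hy; rewrite /rectint.
    move=> /(_ (fun z zin => fh z (Pconv Py0 Py (proj2 (andP (proj2 (andP zin))) )))).
    set A := cint _ _; set B := cint `[x1, x2] _ => G0.
    by apply/eqP; rewrite -subr_eq0 -[X in _ == X]G0; apply/eqP; ring.
  have := @goursat R f x1 x2 y y0 x12 (ltW hy); rewrite /rectint.
  move=> /(_ (fun z zin => fh z (Pconv Py Py0 (proj2 (andP (proj2 (andP zin))) )))).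
  set A := cint _ _; set B := cint `[x1, x2] _ => G0.
  by apply/eqP; rewrite eq_sym -subr_eq0 -[X in _ == X]G0; apply/eqP; ring.
exists F => z Pz e e0.
have e2 : 0 < e / 2 by rewrite divr_gt0.
have [r r0 Hr] := fc z Pz _ e2; have [t t0 Ht] := Popen Pz.
exists (Num.min r t / 2); first by rewrite divr_gt0 // lt_min r0.
move=> v vz.
have m0 : 0 < Num.min r t by rewrite lt_min r0.
have vx : `|re v - re z| <= cabs (v - z).
  by have := cabs_re (v - z); rewrite re_add re_opp.
have vy : `|im v - im z| <= cabs (v - z).
  by have := cabs_im (v - z); rewrite im_add im_opp.
have near u : `|re u - re z| <= `|re v - re z| -> `|im u - im z| <= `|im v - im z| ->
    P (im u) /\ cabs (f u - f z) <= e / 2.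
  move=> ux uy; have uz : cabs (u - z) < Num.min r t.
    apply: le_lt_trans (cabs_le_reim _) _; rewrite re_add im_add re_opp im_opp.
    lra.
  move: uz; rewrite lt_min => /andP[u1 u2]; split; last exact/ltW/Hr.
  apply: Ht; apply: le_lt_trans u2.
  by have := cabs_im (u - z); rewrite im_add im_opp.
have bet (x y s : R) : (x <= s <= y) || (y <= s <= x) -> `|s - x| <= `|y - x|.
  move=> /orP[] /andP[s1 s2].
    by rewrite !ger0_norm ?subr_ge0 // ?lerD2r // (le_trans s1).
  by rewrite !ler0_norm ?subr_le0 // ?(le_trans s1) // lerN2 lerD2r.
(* The corner of the path that goes from z horizontally to w and then vertically to v. *)
pose w := (re v +i* im z)%C.
have h1 : cabs (F w - F z - (re v - re z)%:C * f z) <= e / 2 * `|re v - re z|.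
  have zE : z = (re z +i* im z)%C by rewrite complex_eta.
  case: (leP (re z) (re v)) => hx.
    rewrite {1}zE /w (H _ _ _ Pz hx) ger0_norm ?subr_ge0 //.
    apply: cint_near => // s sx; first by apply: rcont_hor; exact: fc.
    apply: (proj2 (near (s +i* im z)%C _ _)); last by rewrite /= subrr normr0.
    by apply: bet; rewrite sx.
  rewrite -[X in X <= _]cabsN.
  have -> : - (F w - F z - (re v - re z)%:C * f z) = F z - F w - (re z - re v)%:C * f z.
    by rewrite -(opprB (re v)) rmorphN /=; ring.
  rewrite {1}zE /w (H _ _ _ Pz (ltW hx)) distrC ger0_norm; last by rewrite subr_ge0 ltW.
  apply: (cint_near (ltW hx)) => s sx; first by apply: rcont_hor; exact: fc.
  apply: (proj2 (near (s +i* im z)%C _ _)); last by rewrite /= subrr normr0.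
    by apply: bet; rewrite sx orbT.
have Pv : P (im v) by have [] := near v.
have ci : cabs ('i%C : C) = 1 by rewrite /cabs /= expr0n /= add0r expr1n sqrtr1.
have h2 : cabs (F v - F w - 'i%C * ((im v - im z)%:C * f z)) <= e / 2 * `|im v - im z|.
  have vE : v = (re v +i* im v)%C by rewrite complex_eta.
  case: (leP (im z) (im v)) => hy.
    rewrite {1}vE /w (V _ _ _ Pz Pv hy) ger0_norm ?subr_ge0 // -mulrBr cabsM ci mul1r.
    apply: cint_near => // s sy.
      by apply: rcont_ver; apply: fc; exact: Pconv sy.
    apply: (proj2 (near (re v +i* s)%C _ _)); first by rewrite /= lexx.
    by apply: bet; rewrite sy.
  rewrite -[X in X <= _]cabsN.
  have -> : - (F v - F w - 'i%C * ((im v - im z)%:C * f z)) =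
      F w - F v - 'i%C * ((im z - im v)%:C * f z).
    by rewrite -(opprB (im v)) rmorphN /=; ring.
  rewrite {1}vE /w (V _ _ _ Pv Pz (ltW hy)) distrC ger0_norm; last by rewrite subr_ge0 ltW.
  rewrite -mulrBr cabsM ci mul1r; apply: (cint_near (ltW hy)) => s sy.
    by apply: rcont_ver; apply: fc; exact: Pconv sy.
  apply: (proj2 (near (re v +i* s)%C _ _)); first by rewrite /= lexx.
    by apply: bet; rewrite sy orbT.
have -> : F v - F z - f z * (v - z) = (F v - F w - 'i%C * ((im v - im z)%:C * f z)) +
    (F w - F z - (re v - re z)%:C * f z).
  have -> : v - z = (re v - re z)%:C + 'i%C * (im v - im z)%:C.
    by case: (v) => ? ?; case: (z) => ? ?; apply: complex_ext => /=; ring.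
  by ring.
apply: le_trans (ler_cabsD _ _) _; apply: le_trans (lerD h2 h1) _.
rewrite -mulrDr [leRHS](_ : _ = e / 2 * (2 * cabs (v - z))); last by field.
by rewrite ler_pM2l //; lra.
Qed.

End Strip.

(** The value at z0 is the derivative, which makes the quotient continuous; [removable] makes it
    holomorphic. *)
Lemma divdiff f z0 a b c d : inside a b c d z0 ->
  (forall z, inrect a b c d z -> holomorphic_at f z) ->
  exists g : C -> C, (forall z, f z = f z0 + g z * (z - z0)) /\
    (forall z, holomorphic_at f z -> holomorphic_at g z).
Proof.
move=> zin fh; have /holo_hasd[e fd] := fh _ (inside_inrect zin).
pose g z := if z == z0 then e else (f z - f z0) / (z - z0).
exists g; split.
  move=> z; rewrite /g; case: eqVneq => [->|zz]; first by rewrite subrr mulr0 addr0.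
  by rewrite divfK ?subr_eq0 // addrC subrK.
have gh z : z != z0 -> holomorphic_at f z -> holomorphic_at g z.
  move=> zz /holo_hasd[l fl]; apply/holo_hasd; eexists.
  have t0 : 0 < cabs (z0 - z) by rewrite cabs_gt0 subr_eq0 eq_sym.
  apply: (@hasd_local _ (fun v => (f v - f z0) * (v - z0)^-1) _ _ _ _ t0).
    move=> v vz; rewrite /g; case: eqVneq vz => [->|//].
    by rewrite ltxx.
  apply: hasdM; first exact: hasdB fl (hasd_cst (f z0) z).
  by apply: hasdV; [exact: hasdB (hasd_id z) (hasd_cst z0 z)|rewrite subr_eq0].
move=> z; have [->|zz] := eqVneq z z0; last exact: gh.
move=> _; apply: (@removable _ g z0 a b c d) => //; last by move=> v vin vz; apply: gh (fh _ vin).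
move=> v vin; have [->|vz] := eqVneq v z0.
  have := fd => /hasd_car[p [pc pe] [t t0 Ht]].
  apply: (ccont_local t0) pc => w wt; rewrite /g; case: eqVneq => [->//|ww].
  by rewrite (Ht _ wt) addrAC subrr add0r mulfK // subr_eq0.
by have /holo_hasd[l /hasd_ccont] := gh _ vz (fh _ vin).
Qed.

End Primitives.

(** * The complex exponential *)

Section Exponential.
Context {R : realType}.
Local Notation C := R[i].
Local Notation re := (@complex.Re R).
Local Notation im := (@complex.Im R).

Lemma cexpD (z w : C) : cexp (z + w) = cexp z * cexp w.
Proof.
case: z => a b; case: w => c d; rewrite /cexp /=.
by apply: complex_ext => /=; rewrite expRD ?cosD ?sinD; ring.
Qed.

Lemma cexp0 : cexp (0 : C) = 1.
Proof. by rewrite /cexp /= expR0 cos0 sin0; apply: complex_ext => /=; ring. Qed.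

Lemma cabs_cexp (z : C) : cabs (cexp z) = expR (re z).
Proof.
apply/eqP; rewrite -(eqrXn2 (ltn0Sn 1)) ?cabs_ge0 ?expR_ge0 // cabs_sqr /cexp /=.
by rewrite !exprMn -mulrDr cos2Dsin2 mulr1.
Qed.

Lemma cexp_neq0 (z : C) : cexp z != 0.
Proof. by rewrite -cabs_gt0 cabs_cexp expR_gt0. Qed.

Lemma cexpN (z : C) : cexp (- z) = (cexp z)^-1.
Proof.
by apply: (mulfI (cexp_neq0 z)); rewrite -cexpD subrr cexp0 divff ?cexp_neq0.
Qed.

Lemma cexp_conj (z : C) : cexp z^*%C = (cexp z)^*%C.
Proof. by case: z => a b; rewrite /cexp /= cosN sinN; apply: complex_ext => /=; ring. Qed.

Lemma real_deriv0 (f : R -> R) (d e : R) : is_derive (0 : R) 1 f d -> 0 < e ->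
  exists2 r : R, 0 < r & forall t, `|t| < r -> `|f t - f 0 - d * t| <= e * `|t|.
Proof.
case=> D <- e0; have /cvgrPdist_le/(_ _ e0)[r /= r0 Hr] := D.
exists r => // t tr; have [->|t0] := eqVneq t 0.
  by rewrite subrr mulr0 subr0 normr0 mulr0.
have := Hr t; rewrite /= sub0r normrN => /(_ tr t0).
have n0 : 0 < `|t| by rewrite normr_gt0.
rewrite -(ler_pM2r n0) -normrM => h; apply: le_trans h.
rewrite -[X in X <= _]normrN /GRing.scale /= mulr1 addr0.
rewrite le_eqVlt; apply/orP; left; apply/eqP; congr (`|_|).
set L1 := lim _; rewrite (_ : 'D_1 f 0 = L1) //.
by field.
Qed.

Lemma hasd_cexp (z : C) : hasd cexp z (cexp z).
Proof.
suff H : hasd cexp (0 : C) 1.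
  have h : hasd (fun v => v - z) z (1 - 0) := hasdB (hasd_id z) (hasd_cst z z).
  have H' : hasd cexp (z - z) 1 by rewrite subrr.
  have := hasdZ (cexp z) (hasd_comp h H'); rewrite subr0 !mulr1.
  by apply: hasd_local ltr01 _ => v _; rewrite -cexpD addrC subrK.
(* With [expR], [cos] and [sin] linearised at 0 up to t |v|, the total error found below is at most
   9 t |v|. *)
move=> e e0; have [t [t0 t1 te]] : exists t : R, [/\ 0 < t, t <= 1 & 10 * t <= e].
  exists (Num.min 1 (e / 10)); split; first by rewrite lt_min ltr01 divr_gt0.
    by rewrite ge_min lexx.
  have : Num.min 1 (e / 10) <= e / 10 by rewrite ge_min lexx orbT.
  lra.
have [r1 r10 H1] := real_deriv0 (is_derive_expR 0) t0.
have [r2 r20 H2] := real_deriv0 (is_derive_cos 0) t0.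
have [r3 r30 H3] := real_deriv0 (is_derive_sin 0) t0.
pose r := Num.min (Num.min r1 r2) (Num.min r3 t).
exists r; first by rewrite !lt_min r10 r20 r30 t0.
move=> v; rewrite cexp0 !subr0 mul1r !lt_min => /andP[/andP[v1 v2] /andP[v3 v4]].
have vre := cabs_re v; have vim := cabs_im v.
have := H1 _ (le_lt_trans vre v1); rewrite expR0 mul1r => h1.
have := H2 _ (le_lt_trans vim v2); rewrite cos0 sin0 oppr0 mul0r subr0 => h2.
have := H3 _ (le_lt_trans vim v3); rewrite cos0 sin0 mul1r subr0 => h3.
apply: le_trans (cabs_le_reim _) _.
rewrite !(re_add, im_add, re_opp, im_opp) /cexp /=.
move: h1 h2 h3 vre vim v4; set x := re v; set y := im v; set s := cabs v.
set E := expR x; set c := cos y; set n := sin y => h1 h2 h3 vre vim v4.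
have s0 : 0 <= s := cabs_ge0 v.
have ts k : 0 <= k -> k <= s -> t * k <= t * s by move=> _ ?; rewrite ler_pM2l.
have b1 := le_trans h1 (ts _ (normr_ge0 _) vre).
have b2 := le_trans h2 (ts _ (normr_ge0 _) vim).
have b3 := le_trans h3 (ts _ (normr_ge0 _) vim).
have ts2 : t * s <= s by rewrite ler_piMl.
have Em : `|E - 1| <= 2 * s.
  rewrite -[E - 1](subrK x); apply: le_trans (ler_normD _ _) _; lra.
have Eb : `|E| <= 3.
  rewrite -[E](subrK 1); apply: le_trans (ler_normD _ _) _; rewrite normr1.
  lra.
have -> : E * c - 1 - x = (E - 1 - x) + E * (c - 1) by ring.
have -> : E * n - 0 - y = E * (n - y) + (E - 1) * y by ring.
have m1 : `|E * (c - 1)| <= 3 * (t * s) by rewrite normrM; apply: ler_pM.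
have m2 : `|E * (n - y)| <= 3 * (t * s) by rewrite normrM; apply: ler_pM.
have m3 : `|(E - 1) * y| <= 2 * (t * s).
  rewrite normrM mulrA; apply: ler_pM => //; lra.
have := ler_normD (E - 1 - x) (E * (c - 1)).
have := ler_normD (E * (n - y)) ((E - 1) * y).
have := ler_wpM2r s0 te; have := mulr_ge0 (ltW t0) s0.
have -> : 10 * t * s = 10 * (t * s) by ring.
lra.
Qed.

End Exponential.

(** * Logarithms and growth *)

Section Growth.
Context {R : realType}.
Local Notation C := R[i].
Local Notation re := (@complex.Re R).
Local Notation im := (@complex.Im R).
Implicit Types (f g F : C -> C).

Lemma holo_rect_deriv f z (t : R) : 0 < t ->
  (forall v, im z - t <= im v <= im z + t -> holomorphic_at f v) ->
  exists e, hasd f z e /\ holomorphic_at (fun v => 'D_1 (f : C^o -> C^o) v) z.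
Proof.
move=> t0 fh; have [|f' H] := @holo_deriv R f (re z - t) (re z + t) (im z - t) (im z + t).
  by move=> v /and4P[_ _ v1 v2]; apply: fh; rewrite v1.
have zin : inside (re z - t) (re z + t) (im z - t) (im z + t) z by apply/and4P; split; lra.
have [h1 /holo_hasd[k h2]] := H _ zin; exists (f' z); split => //.
have [r r0 [_ Hr]] := inside_dist zin.
apply/holo_hasd; exists k; apply: hasd_local r0 _ h2 => v /Hr/H[h _].
by rewrite (hasd_unique h).
Qed.

Section Strip.
Variable P : R -> Prop.
Hypothesis Pconv : forall y1 y2 y, P y1 -> P y2 -> y1 <= y <= y2 -> P y.
Hypothesis Popen : forall y, P y -> exists2 t : R, 0 < t &
  forall y', `|y' - y| < t -> P y'.

(** L is a primitive of U'/U. Then U e^(-L) has derivative 0, hence equals a constant c, which is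
    kept apart instead of being absorbed into L. *)
Lemma holomorphic_log (U : C -> C) : (forall z, P (im z) -> holomorphic_at U z) ->
  (forall z, P (im z) -> U z != 0) ->
  exists (L : C -> C) (c : C), [/\ c != 0, forall z, P (im z) -> holomorphic_at L z &
    forall z, P (im z) -> U z = c * cexp (L z)].
Proof.
move=> Uh U0; have [[y0 Py0]|nP] := pselect (exists y0, P y0); last first.
  exists (fun=> 0), 1; split; first exact: oner_neq0.
    by move=> z Pz; exfalso; apply: nP; exists (im z).
  by move=> z Pz; exfalso; apply: nP; exists (im z).
pose U' (z : C) : C := 'D_1 (U : C^o -> C^o) z.
have Dh z : P (im z) -> holomorphic_at U' z.
  move=> /Popen[t t0 Ht]; have [||e []//] := @holo_rect_deriv U z (t / 2).
    by rewrite divr_gt0.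
  move=> v /andP[v1 v2]; apply/Uh/Ht; rewrite ltr_norml; apply/andP; split; lra.
pose l (z : C) : C := U' z * (U z)^-1.
have lh z : P (im z) -> holomorphic_at l z.
  move=> Pz; have /holo_hasd[k h1] := Dh z Pz; have /holo_hasd[m h2] := Uh z Pz.
  apply/holo_hasd; eexists; apply: hasdM h1 _; apply: hasdV h2 _; exact: U0.
have [L HL] := primitive Pconv Popen lh.
pose V z := U z * cexp (- L z).
have V0 z : P (im z) -> hasd V z 0.
  move=> Pz; have h1 := holo_hasdE (Uh z Pz).
  have := hasdM h1 (hasd_comp (hasdN (HL z Pz)) (hasd_cexp _)).
  rewrite -/(U' z) /l; set W := cexp (- L z).
  suff -> : U' z * W + U z * (W * - (U' z * (U z)^-1)) = 0 by [].
  by field; exact: U0.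
have Vc := hasd0_cst Pconv V0.
have E0 : P (im (0 +i* y0)%C) by [].
exists L, (V (0 +i* y0)%C); split.
- by rewrite mulf_neq0 ?cexp_neq0 ?U0.
- by move=> z /HL h; apply/holo_hasd; eexists; exact: h.
- by move=> z Pz; rewrite -(Vc z) // /V cexpN mulfVK ?cexp_neq0.
Qed.

(** The derivative H' e^H vanishes and the exponential does not. *)
Lemma cexp_cst (H : C -> C) (k : C) : (forall z, P (im z) -> holomorphic_at H z) ->
  (forall z, P (im z) -> cexp (H z) = k) ->
  forall z w, P (im z) -> P (im w) -> H z = H w.
Proof.
move=> Hh Hk; apply: hasd0_cst => // z Pz; have /holo_hasd[d hd] := Hh z Pz.
have [t t0 Ht] := Popen Pz.
have h1 := hasd_comp hd (hasd_cexp (H z)).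
have h2 : hasd (fun v => cexp (H v)) z 0.
  apply: hasd_local t0 _ (hasd_cst k z) => v vt; rewrite Hk //; apply: Ht.
  by apply: le_lt_trans vt; have := cabs_im (v - z); rewrite im_add im_opp.
have := hasd_unique h1; rewrite (hasd_unique h2) => /esym/eqP.
by rewrite mulf_eq0 (negbTE (cexp_neq0 _)) /= => /eqP E; rewrite -E.
Qed.

End Strip.

Lemma whole_conv (y1 y2 y : R) : True -> True -> y1 <= y <= y2 -> True.
Proof. by []. Qed.

Lemma whole_open (y : R) : True -> exists2 t : R, 0 < t & forall y' : R, `|y' - y| < t -> True.
Proof. by exists 1. Qed.

Lemma upper_conv (y1 y2 y : R) : 0 < y1 -> 0 < y2 -> y1 <= y <= y2 -> 0 < y.
Proof. by move=> h _ /andP[/(lt_le_trans h)]. Qed.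

Lemma upper_open (y : R) : 0 < y -> exists2 t : R, 0 < t & forall y' : R, `|y' - y| < t -> 0 < y'.
Proof. by move=> y0; exists y => // y'; rewrite ltr_norml => /andP[]; lra. Qed.

Lemma cabs_dist_conj (z w : C) : 0 <= im z -> 0 <= im w ->
  cabs (z - w) <= cabs (z - w^*%C).
Proof.
move=> hz hw; rewrite -(ler_pXn2r (ltn0Sn 1)) ?nnegrE ?cabs_ge0 // !cabs_sqr.
rewrite !(re_add, im_add, re_opp, im_opp, re_conj, im_conj) lerD2l.
by have := mulr_ge0 hz hw; nra.
Qed.

Lemma cabs_re_conj (p q : C) : 0 <= re p -> 0 <= re q -> cabs (p - q) <= cabs (p + q^*%C).
Proof.
move=> hz hw; rewrite -(ler_pXn2r (ltn0Sn 1)) ?nnegrE ?cabs_ge0 // !cabs_sqr.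
rewrite !(re_add, im_add, re_opp, im_opp, re_conj, im_conj) lerD2r.
by have := mulr_ge0 hz hw; nra.
Qed.

(** The Schwarz-Pick inequality from the upper to the right half-plane. The Cayley transform [phi]
    of p is bounded by 1 and vanishes at z0; dividing it by the Blaschke factor of z0 gives [psi],
    and the claim is |psi(z)| <= 1. *)
Lemma schwarz_pick (p : C -> C) (z0 z : C) :
  (forall v, 0 <= im v -> holomorphic_at p v) -> (forall v, 0 <= im v -> 0 < re (p v)) ->
  0 < im z0 -> 0 < im z ->
  cabs (p z - p z0) * cabs (z - z0^*%C) <= cabs (p z + (p z0)^*%C) * cabs (z - z0).
Proof.
move=> ph ppos i0 iz.
have den v : 0 <= im v -> p v + (p z0)^*%C != 0.
  move=> iv; apply/eqP => /(congr1 re); rewrite re_add re_conj /= => E.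
  by have := ppos v iv; have := ppos z0 (ltW i0); rewrite -/(re _) in E *; lra.
pose phi v := (p v - p z0) * (p v + (p z0)^*%C)^-1.
have phih v : 0 <= im v -> holomorphic_at phi v.
  move=> iv; have /holo_hasd[d h] := ph v iv; apply/holo_hasd; eexists.
  apply: hasdM; first exact: hasdB h (hasd_cst (p z0) v).
  by apply: hasdV; [exact: hasdD h (hasd_cst _ v)|exact: den].
have zin : inside (re z0 - 1) (re z0 + 1) (im z0 / 2) (2 * im z0) z0.
  by apply/and4P; split; lra.
have [|g [gE gh]] := divdiff zin (f := phi).
  by move=> v /and4P[_ _ v1 _]; apply: phih; lra.
have phi0 : phi z0 = 0 by rewrite /phi subrr mul0r.
have phi1 v : 0 <= im v -> cabs (phi v) <= 1.
  move=> iv; rewrite cabs_div ler_pdivrMr ?cabs_gt0 ?den // mul1r.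
  by apply: cabs_re_conj; apply/ltW/ppos => //; exact: ltW.
pose psi v := g v * (v - z0^*%C).
have psih v : 0 <= im v -> holomorphic_at psi v.
  move=> iv; have /holo_hasd[d h] := gh _ (phih v iv); apply/holo_hasd; eexists.
  apply: hasdM h _; exact: hasdB (hasd_id v) (hasd_cst _ v).
have psiE v : psi v * (v - z0) = phi v * (v - z0^*%C).
  by rewrite /psi [in RHS](gE v) phi0; ring.
have psiN v : cabs (psi v) * cabs (v - z0) = cabs (phi v) * cabs (v - z0^*%C).
  by rewrite -[LHS]cabsM -[RHS]cabsM psiE.
suff K : cabs (psi z) <= 1.
  have E' := psiN z.
  have h : cabs (phi z) * cabs (z - z0^*%C) <= cabs (z - z0).
    by rewrite -E' ler_piMl ?cabs_ge0.
  move: h; rewrite cabs_div mulrAC ler_pdivrMr; last by rewrite cabs_gt0 den // ltW.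
  by move=> h; rewrite [leRHS]mulrC.
pose k := cabs z0; have k0 : 0 <= k := cabs_ge0 _.
(* Maximum modulus on [-r, r] x [0, r]: on the real side the Blaschke factor is unimodular, so |psi|
   <= 1, and on the other sides |v| >= r. The bound tends to 1 as r grows. *)
have B (r : R) : k < r -> cabs z < r -> cabs (psi z) <= (r + k) / (r - k).
  move=> kr zr; have rk : 0 < r - k by rewrite subr_gt0.
  have r0 : 0 < r by exact: le_lt_trans kr.
  have b1 : 1 <= (r + k) / (r - k) by rewrite ler_pdivlMr // mul1r; lra.
  apply: (@max_modulus _ psi (- r) r 0 r).
  - by move=> v /and4P[_ _ v1 _]; exact: psih.
  - move=> v /andP[/and4P[v1 v2 v3 v4] vb].
    have P1 := phi1 v v3; have E := psiN v.
    have small : cabs (psi v) * cabs (v - z0) <= cabs (v - z0^*%C).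
      by rewrite E ler_piMl ?cabs_ge0.
    have [/eqP v0|nv0] := boolP (im v == 0).
      apply: le_trans b1.
      have Ev : cabs (v - z0) = cabs (v - z0^*%C).
        apply/eqP; rewrite -(eqrXn2 (ltn0Sn 1)) ?cabs_ge0 // !cabs_sqr.
        by rewrite !(re_add, im_add, re_opp, im_opp, re_conj, im_conj) v0 !add0r !sqrrN.
      have n0 : 0 < cabs (v - z0).
        by rewrite cabs_gt0 subr_eq0; apply: contraTneq i0 => <-; rewrite v0 ltxx.
      by move: small; rewrite -Ev -{2}(mul1r (cabs (v - z0))) ler_pM2r.
    have vr : r <= cabs v.
      move: vb; rewrite (negbTE nv0) /= => /or3P[] /eqP h.
      + by apply: le_trans (cabs_re _); rewrite h normrN ler_norm.
      + by apply: le_trans (cabs_re _); rewrite h ler_norm.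
      + by apply: le_trans (cabs_im _); rewrite h ler_norm.
    have n0 : cabs v - k <= cabs (v - z0) by exact: ler_cabs_sub.
    have n1 : cabs (v - z0^*%C) <= cabs v + k.
      by apply: le_trans (ler_cabsB _ _) _; rewrite cabs_conj.
    have n2 : 0 < cabs (v - z0) by apply: lt_le_trans n0; lra.
    apply: (@le_trans _ _ ((cabs v + k) / (cabs v - k))).
      rewrite ler_pdivlMr; last lra.
      apply: le_trans n1; apply: le_trans small; apply: ler_wpM2l => //.
      exact: cabs_ge0.
    rewrite ler_pdivrMr; last lra.
    rewrite mulrAC ler_pdivlMr //; nra.
  - have := le_lt_trans (cabs_re z) zr; have := le_lt_trans (cabs_im z) zr.
    by rewrite !ltr_norml => /andP[a1 a2] /andP[a3 a4]; apply/and4P; split.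
rewrite leNgt; apply/negP => p1.
set s := cabs (psi z) in B p1.
(* The bound at r would give (s - 1) (r - k) <= 2 k, while this r makes the left side exceed 4 k. *)
pose r := (k + cabs z + 1) + 4 * k / (s - 1).
have s1 : 0 < s - 1 by rewrite subr_gt0.
have q0 : 0 <= 4 * k / (s - 1) by rewrite divr_ge0 ?mulr_ge0 // ltW.
have cz := cabs_ge0 z.
have rk : 0 < r - k by rewrite /r; lra.
have := B r; rewrite -subr_gt0 => /(_ rk).
have zr : cabs z < r by rewrite /r; lra.
move=> /(_ zr); rewrite ler_pdivlMr //.
have qE : 4 * k / (s - 1) * (s - 1) = 4 * k by rewrite divfK // gt_eqF.
have : (s - 1) * (r - k) = (s - 1) * (cabs z + 1) + 4 * k by rewrite -qE /r; ring.
have : 0 < (s - 1) * (cabs z + 1) by rewrite mulr_gt0 //; lra.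
nra.
Qed.

(** With D and d the distances of z to the conjugate of z0 and to z0, Schwarz-Pick and the triangle
    inequality give |p(z)| (D - d) <= |p(z0)| (D + d). Multiplying by D + d <= 2 D and using D^2 -
    d^2 = 4 Im z Im z0 concludes. *)
Lemma harnack_upper (p : C -> C) (z0 z : C) :
  (forall v, 0 <= im v -> holomorphic_at p v) -> (forall v, 0 <= im v -> 0 < re (p v)) ->
  0 < im z0 -> 0 < im z ->
  cabs (p z) * (im z * im z0) <= cabs (p z0) * cabs (z - z0^*%C) ^+ 2.
Proof.
move=> ph ppos i0 iz; have S := schwarz_pick ph ppos i0 iz.
set D := cabs (z - z0^*%C) in S *; set d := cabs (z - z0) in S.
have dD : D ^+ 2 - d ^+ 2 = 4 * (im z * im z0).
  rewrite /D /d !cabs_sqr !(re_add, im_add, re_opp, im_opp, re_conj, im_conj); ring.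
have dD1 : d <= D by apply: cabs_dist_conj; exact: ltW.
have d0 : 0 <= d := cabs_ge0 _.
have h1 := ler_cabs_sub (p z) (p z0).
have h2 := ler_cabsD (p z) (p z0)^*%C; rewrite cabs_conj in h2.
move: S h1 h2; set a := cabs (p z); set b := cabs (p z0); set x := cabs _; set y := cabs _.
move=> S h1 h2.
have b0 : 0 <= b := cabs_ge0 _.
have D0 : 0 <= D := cabs_ge0 _.
have e1 : a * (D - d) <= b * (D + d).
  have := ler_wpM2r D0 h1; have := ler_wpM2r d0 h2; lra.
have e2 : a * (D ^+ 2 - d ^+ 2) <= b * (D + d) ^+ 2.
  have := ler_wpM2r (addr_ge0 D0 d0) e1; nra.
have e3 : b * (D + d) ^+ 2 <= b * (4 * D ^+ 2).
  by apply: ler_wpM2l => //; nra.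
by move: e2; rewrite dD; lra.
Qed.

(** A Borel-Caratheodory argument: an upper bound on the real part controls the modulus. On the
    half-plane above height e, the function M - L has positive real part, so [harnack_upper]
    compares its values at z and at i. *)
Lemma log_growth (L : C -> C) (m : R) : 0 <= m ->
  (forall z, 0 < im z -> holomorphic_at L z) ->
  (forall z, 0 < im z -> re (L z) <= m + (im z)^-1) ->
  exists2 K : R, 0 < K & forall z, 0 < im z ->
    cabs (L z) <= K * (1 + cabs z ^+ 2) * ((im z)^-1 + (im z)^-1 ^+ 2).
Proof.
move=> m0 Lh Lm; pose A := m + 3 + cabs (L 'i%C).
have A0 : 0 < A by rewrite /A; have := cabs_ge0 (L 'i%C); lra.
exists (9 * A); first by rewrite mulr_gt0.
move=> z; set y := im z => y0.
(* Half of the smaller height, so that z and i both stay above the line Im = e after the shift. *)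
pose e := Num.min y 1 / 2.
have mn0 : 0 < Num.min y 1 by rewrite lt_min y0 ltr01.
have e0 : 0 < e by rewrite divr_gt0.
have ey : e <= y / 2 by rewrite /e ler_pM2r // ge_min lexx.
have e1 : e <= 1 / 2 by rewrite /e ler_pM2r // ge_min lexx orbT.
have yV : 0 < y^-1 by rewrite invr_gt0.
have eV : e^-1 <= 2 + 2 * y^-1.
  by rewrite /e invf_div; case: (leP y 1) => h; rewrite ?divr1; lra.
pose M := m + e^-1 + 1.
pose p v := M%:C - L (v + (0 +i* e)%C).
have ph v : 0 <= im v -> holomorphic_at p v.
  move=> iv; have /holo_hasd[d h] : holomorphic_at L (v + (0 +i* e)%C).
    by apply: Lh; rewrite im_add /= ltr_wpDl.
  apply/holo_hasd; eexists.
  exact: (hasdB (hasd_cst M%:C v) (hasd_comp (hasdD (hasd_id v) (hasd_cst _ v)) h)).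
have ppos v : 0 <= im v -> 0 < re (p v).
  move=> iv; have := Lm (v + (0 +i* e)%C); rewrite im_add /= -/(im v) ltr_wpDl // => /(_ isT).
  have : (im v + e)^-1 <= e^-1 by rewrite lef_pV2 ?posrE ?ltr_wpDl // lerDr.
  rewrite /p re_add re_opp /= -/(im _) -/(re _) /M; lra.
pose z0 := (0 +i* (1 - e))%C; pose z1 := (re z +i* (y - e))%C.
have i0 : 0 < im z0 by rewrite /=; lra.
have i1 : 0 < im z1 by rewrite /=; lra.
have := harnack_upper ph ppos i0 i1.
have -> : p z0 = M%:C - L 'i%C.
  by rewrite /p /z0; congr (_ - L _); apply: complex_ext => /=; ring.
have -> : p z1 = M%:C - L z.
  rewrite /p /z1; congr (_ - L _); rewrite -[RHS]complex_eta.
  by apply: complex_ext => /=; rewrite /y; ring.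
rewrite /= => H.
have M0 : 0 <= M by rewrite /M !addr_ge0 // invr_ge0 ltW.
have p0 : cabs (M%:C - L 'i%C) <= A * (1 + y^-1).
  apply: le_trans (ler_cabsB _ _) _; rewrite cabs_real ger0_norm // /A /M.
  have := mulr_ge0 m0 (ltW yV); have := mulr_ge0 (cabs_ge0 (L 'i%C)) (ltW yV); lra.
have MA : M <= A * (1 + y^-1).
  rewrite /A /M.
  have := mulr_ge0 m0 (ltW yV); have := mulr_ge0 (cabs_ge0 (L 'i%C)) (ltW yV).
  have := cabs_ge0 (L 'i%C); lra.
have D2 : cabs (z1 - z0^*%C) ^+ 2 <= 2 * (1 + cabs z ^+ 2).
  rewrite !cabs_sqr !(re_add, im_add, re_opp, im_opp, re_conj, im_conj) /= -/(im z) -/(re z) -/y.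
  rewrite oppr0 addr0 opprK.
  have : (y - e + (1 - e)) ^+ 2 <= (y + 1) ^+ 2.
    apply: lerXn2r; rewrite ?nnegrE; lra.
  have := sqr_ge0 (y - 1); have := sqr_ge0 (re z); nra.
have Lz : cabs (L z) <= M + cabs (M%:C - L z).
  have -> : L z = M%:C - (M%:C - L z) by ring.
  apply: le_trans (ler_cabsB _ _) _; rewrite cabs_real ger0_norm // lerD2l.
  by rewrite subKr.
set X := cabs (M%:C - L z) in H Lz; have X0 : 0 <= X := cabs_ge0 _.
set Q := 1 + cabs z ^+ 2 in D2 *.
have Qy : y <= Q.
  rewrite /Q cabs_sqr -/y; have := sqr_ge0 (y - 1); have := sqr_ge0 (re z); nra.
have Xb : X * (y / 4) <= A * (1 + y^-1) * (2 * Q).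
  have t1 : X * (y / 4) <= X * ((y - e) * (1 - e)).
    apply: ler_wpM2l => //; nra.
  apply: le_trans t1 _; apply: le_trans H _.
  by apply: ler_pM; rewrite ?cabs_ge0 ?exprn_ge0 ?cabs_ge0.
have X2 : X <= 8 * A * (1 + y^-1) * Q * y^-1.
  rewrite -ler_pdivrMr ?invr_gt0 // invrK; lra.
have Qy1 : 1 <= Q * y^-1 by rewrite ler_pdivlMr // mul1r.
have M2 : M <= A * (1 + y^-1) * (Q * y^-1).
  apply: le_trans MA _; rewrite ler_peMr // mulr_ge0 ?ltW // ltr_wpDl //; lra.
have -> : 9 * A * Q * (y^-1 + y^-1 ^+ 2) = A * (1 + y^-1) * (Q * y^-1) + 8 * A * (1 + y^-1) * Q * y^-1.
  by ring.
lra.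
Qed.

(* The weight (z^2 - r^2)^2 vanishes where the square meets the real axis, which
   absorbs the singularity of the bound there. *)
Lemma liouville_linear (G : C -> C) (K : R) : 0 < K -> entire G ->
  (forall z, im z != 0 ->
    cabs (G z) <= K * (1 + cabs z ^+ 2) * (`|im z|^-1 + `|im z|^-1 ^+ 2)) ->
  exists g0 g1 : C, forall z, G z = g0 + g1 * z.
Proof.
move=> K0 Gh Gb.
have in0 : inside (-1) 1 (-1) 1 (0 : C) by rewrite /inside /= !ltrN10 !ltr01.
(* Two divided differences at 0 give G(z) = G(0) + G1(0) z + z^2 G2(z); linearity amounts to G2 =
   0. *)
have [|G1 [E1 h1]] := divdiff in0 (f := G); first by move=> z _; exact: Gh.
have [|G2 [E2 h2]] := divdiff in0 (f := G1); first by move=> z _; apply: h1; exact: Gh.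
have E z : z ^+ 2 * G2 z = G z - G 0 - G1 0 * z.
  by rewrite (E1 z) (E2 z) !subr0; ring.
exists (G 0), (G1 0) => z.
suff G20 : G2 z = 0 by move: (E z); rewrite G20 mulr0 => /eqP; rewrite eq_sym subr_eq0 subr_eq addrC => /eqP.
have G2h w : holomorphic_at G2 w by apply: h2; apply: h1; exact: Gh.
pose a := cabs (G 0); pose b := cabs (G1 0).
have a0 : 0 <= a := cabs_ge0 _.
have b0 : 0 <= b := cabs_ge0 _.
(* On the boundary |G| y^2 <= 6 K r^3 and the weight is at most 9 r^2 y^2, whence 54 K; the second
   term comes from G(0) + G1(0) w. *)
pose K' := 54 * K + 9 * (a + 2 * b).
have K'0 : 0 < K' by rewrite /K'; lra.
suff B (r : R) : 1 <= r -> 2 * cabs z < r -> cabs (G2 z) <= 4 * K' / r.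
  apply/eqP; rewrite -cabs_eq0 eq_le cabs_ge0 andbT leNgt; apply/negP => g0.
  have cz := cabs_ge0 z.
  pose r := 1 + 2 * cabs z + 4 * K' / cabs (G2 z) + 1.
  have q0 : 0 < 4 * K' / cabs (G2 z) by rewrite divr_gt0 // mulr_gt0.
  have r0 : 0 < r by rewrite /r; lra.
  have := B r; rewrite ler_pdivlMr // => H.
  have {}H : cabs (G2 z) * r <= 4 * K' by apply: H; rewrite /r; lra.
  have rE : cabs (G2 z) * r = cabs (G2 z) * (2 + 2 * cabs z) + 4 * K'.
    by rewrite /r; field; rewrite gt_eqF.
  have : 0 < cabs (G2 z) * (2 + 2 * cabs z) by rewrite mulr_gt0 //; lra.
  lra.
move=> r1 zr; have r0 : 0 < r by lra.
pose f w := G2 w * (w ^+ 2 - (r ^+ 2)%:C) ^+ 2.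
have fh w : holomorphic_at f w.
  have /holo_hasd[k hk] := G2h w; have [l hl] := hasdX 2 (hasd_id w).
  have [m hm] := hasdX 2 (hasdB hl (hasd_cst (r ^+ 2)%:C w)).
  by apply/holo_hasd; eexists; exact: hasdM hk hm.
have nz w : cabs (w ^+ 2 - (r ^+ 2)%:C) = cabs (w - r%:C) * cabs (w + r%:C).
  by rewrite -cabsM; congr cabs; rewrite rmorphXn /=; ring.
(* One estimate for all four sides: y runs over (0, r] on the vertical ones and equals r on the
   horizontal ones. The case y = 0 is separate, as the weight vanishes there. *)
have core w (y : R) : r <= cabs w -> cabs w <= 2 * r -> y = `|im w| -> 0 < y -> y <= r ->
    (1 + cabs w ^+ 2) <= 3 * r ^+ 2 -> cabs (w ^+ 2 - (r ^+ 2)%:C) <= 3 * r * y ->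
    cabs (f w) <= K' * r ^+ 3.
  move=> wr wr2 yE y0 yr w2 wy.
  have iw : im w != 0 by rewrite -normr_gt0 -yE.
  have := Gb w iw; rewrite -yE => g.
  have yV : 0 < y^-1 by rewrite invr_gt0.
  have g2 : cabs (G w) * y ^+ 2 <= 3 * K * r ^+ 2 * (2 * r).
    have : cabs (G w) * y ^+ 2 <= K * (3 * r ^+ 2) * (y^-1 + y^-1 ^+ 2) * y ^+ 2.
      rewrite ler_pM2r ?exprn_gt0 //; apply: le_trans g _.
      rewrite ler_pM2r ?ler_pM2l //; by rewrite addr_gt0 // exprn_gt0.
    have -> : K * (3 * r ^+ 2) * (y^-1 + y^-1 ^+ 2) * y ^+ 2 = 3 * K * r ^+ 2 * (y + 1).
      by field; rewrite gt_eqF.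
    move=> /le_trans; apply; rewrite ler_pM2l ?mulr_gt0 ?exprn_gt0 //; lra.
  have fE : cabs w ^+ 2 * cabs (f w) = cabs (G w - G 0 - G1 0 * w) * cabs (w ^+ 2 - (r ^+ 2)%:C) ^+ 2.
    by rewrite -E /f !(cabsX, cabsM); ring.
  have n1 : cabs (G w - G 0 - G1 0 * w) <= cabs (G w) + (a + 2 * b * r).
    apply: le_trans (ler_cabsB _ _) _; rewrite cabsM -/b.
    have := ler_cabsB (G w) (G 0); rewrite -/a; have := ler_wpM2l b0 wr2; lra.
  have n2 : cabs (w ^+ 2 - (r ^+ 2)%:C) ^+ 2 <= (3 * r * y) ^+ 2.
    by apply: lerXn2r; rewrite ?nnegrE ?cabs_ge0 // !mulr_ge0 // ltW.
  have n3 : cabs w ^+ 2 * cabs (f w) <= K' * r ^+ 3 * r ^+ 2.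
    rewrite fE; apply: le_trans (ler_pM _ _ n1 n2) _; rewrite ?exprn_ge0 ?cabs_ge0 //.
    have y2 : y ^+ 2 <= r ^+ 2 by apply: lerXn2r => //; rewrite nnegrE ltW.
    have ab : 0 <= a + 2 * b * r by rewrite addr_ge0 // !mulr_ge0 // ltW.
    have ab2 : a + 2 * b * r <= (a + 2 * b) * r by have := ler_wpM2l a0 r1; lra.
    have -> : (cabs (G w) + (a + 2 * b * r)) * (3 * r * y) ^+ 2 =
      9 * r ^+ 2 * (cabs (G w) * y ^+ 2) + 9 * r ^+ 2 * ((a + 2 * b * r) * y ^+ 2) by ring.
    have -> : K' * r ^+ 3 * r ^+ 2 = 9 * r ^+ 2 * (3 * K * r ^+ 2 * (2 * r)) +
       9 * r ^+ 2 * ((a + 2 * b) * r * r ^+ 2) by rewrite /K'; ring.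
    have r9 : 0 < 9 * r ^+ 2 by rewrite mulr_gt0 // exprn_gt0.
    apply: lerD; rewrite ler_pM2l //.
    by apply: ler_pM; rewrite ?exprn_ge0 // ltW.
  rewrite -(ler_pM2r (exprn_gt0 2 r0)); apply: le_trans n3; rewrite mulrC.
  by apply: ler_wpM2r; rewrite ?cabs_ge0 //; apply: lerXn2r; rewrite ?nnegrE ?cabs_ge0 // ltW.
have bound w : onrect (- r) r (- r) r w -> cabs (f w) <= K' * r ^+ 3.
  move=> /andP[/and4P[w1 w2 w3 w4] wb].
  have rr : (re w) ^+ 2 <= r ^+ 2 by rewrite -[leLHS]real_normK ?num_real // lerXn2r ?nnegrE ?ler_norml ?w1 ?w2 // ltW.
  have ii : (im w) ^+ 2 <= r ^+ 2 by rewrite -[leLHS]real_normK ?num_real // lerXn2r ?nnegrE ?ler_norml ?w3 ?w4 // ltW.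
  have wsq : cabs w ^+ 2 <= 2 * r ^+ 2 by rewrite cabs_sqr; lra.
  have wle : cabs w <= 2 * r.
    by rewrite -(ler_pXn2r (ltn0Sn 1)) ?nnegrE ?cabs_ge0 ?mulr_ge0 ?ltW //; nra.
  have r21 : 1 <= r ^+ 2 by rewrite exprn_ege1.
  have w3r : 1 + cabs w ^+ 2 <= 3 * r ^+ 2 by lra.
  have wr3 u : cabs u = r -> cabs (w + u) <= 3 * r.
    by move=> ur; apply: le_trans (ler_cabsD _ _) _; rewrite ur; lra.
  have cr : cabs (r%:C : C) = r by rewrite cabs_real gtr0_norm.
  have vert (s : R) : `|s| = r -> re w = s -> cabs (f w) <= K' * r ^+ 3.
    move=> sr ws.
    have wd : cabs (w - s%:C) = `|im w|.
      have -> : w - s%:C = 'i%C * (im w)%:C.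
        by rewrite -[w in LHS]complex_eta ws; apply: complex_ext => /=; ring.
      by rewrite cabsM cabs_real {1}/cabs /= expr0n /= add0r expr1n sqrtr1 mul1r.
    have wp : cabs (w ^+ 2 - (r ^+ 2)%:C) <= 3 * r * `|im w|.
      have -> : w ^+ 2 - (r ^+ 2)%:C = (w - s%:C) * (w + s%:C).
        by rewrite -sr real_normK ?num_real // rmorphXn /=; ring.
      rewrite cabsM wd mulrC; apply: ler_wpM2r => //; apply: wr3.
      by rewrite cabs_real.
    have [i0|i0] := eqVneq (im w) 0.
      rewrite /f cabsM cabsX.
      have -> : cabs (w ^+ 2 - (r ^+ 2)%:C) = 0.
        by apply/eqP; rewrite eq_le cabs_ge0 andbT; move: wp; rewrite i0 normr0 mulr0.
      by rewrite expr0n mulr0 mulr_ge0 ?exprn_ge0 // ltW.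
    apply: (core w `|im w|) => //.
    - by rewrite -sr -ws cabs_re.
    - by rewrite normr_gt0.
    - by rewrite ler_norml w3 w4.
  have hor : `|im w| = r -> cabs (f w) <= K' * r ^+ 3.
    move=> ir; apply: (core w r) => //.
      by rewrite -ir cabs_im.
    rewrite nz; have := wr3 r%:C cr; have := wr3 (- r%:C); rewrite cabsN => /(_ cr).
    move=> t1 t2.
    have := ler_cabsD (w ^+ 2) (- (r ^+ 2)%:C); rewrite nz cabsN cabsX cabs_real.
    rewrite ger0_norm ?sqr_ge0 //; nra.
  case/or4P: wb => /eqP wE.
  + by apply: (vert (- r)) => //; rewrite normrN gtr0_norm.
  + by apply: (vert r) => //; rewrite gtr0_norm.
  + by apply: hor; rewrite wE normrN gtr0_norm.
  + by apply: hor; rewrite wE gtr0_norm.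
have zin : inside (- r) r (- r) r z.
  have := cabs_re z; have := cabs_im z; rewrite !ler_norml => /andP[z1 z2] /andP[z3 z4].
  by have := cabs_ge0 z => z5; apply/and4P; split; lra.
have := max_modulus (fun w _ => fh w) bound zin; rewrite /f cabsM cabsX => H.
have low : r ^+ 2 / 2 <= cabs (z ^+ 2 - (r ^+ 2)%:C).
  have := ler_cabs_sub ((r ^+ 2)%:C) (z ^+ 2); rewrite cabsBC cabsX cabs_real.
  by rewrite ger0_norm ?sqr_ge0 //; have := cabs_ge0 z; nra.
have low2 : r ^+ 4 / 4 <= cabs (z ^+ 2 - (r ^+ 2)%:C) ^+ 2.
  have -> : r ^+ 4 / 4 = (r ^+ 2 / 2) ^+ 2 by field.
  by apply: lerXn2r; rewrite ?nnegrE ?cabs_ge0 ?divr_ge0 ?exprn_ge0 // ltW.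
have r4 : 0 < r ^+ 4 by rewrite exprn_gt0.
rewrite ler_pdivlMr // -(ler_pM2r (exprn_gt0 3 r0)).
have := ler_wpM2l (cabs_ge0 (G2 z)) low2.
have -> : cabs (G2 z) * r * r ^+ 3 = cabs (G2 z) * r ^+ 4 by ring.
lra.
Qed.

End Growth.

(** * Hardy spaces of the half-plane *)

Section RealIntegrals.
Context {R : realType}.
Local Notation C := R[i].
Local Notation re := (@complex.Re R).
Local Notation im := (@complex.Im R).
Local Notation mu := (@lebesgue_measure R).
Implicit Types (p q : R -> C).

Lemma rcont_continuous (l : C -> R) p x : (forall z w, l (z - w) = l z - l w) ->
  (forall z, `|l z| <= cabs z) -> rcont p x -> {for x, continuous (fun t => l (p t))}.
Proof.
move=> lB lc pc; apply/cvgrPdist_lt => e e0; have [d d0 H] := pc _ e0.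
exists d => //= y; rewrite /ball /= distrC => yx.
by rewrite -lB; apply: le_lt_trans (lc _) _; rewrite cabsBC H.
Qed.

Definition cmeasurable p := measurable_fun setT (fun x => re (p x)) /\
  measurable_fun setT (fun x => im (p x)).

Lemma rcont_cmeasurable p : (forall x, rcont p x) -> cmeasurable p.
Proof.
move=> pc; split; apply: continuous_measurable_fun => x; apply: rcont_continuous => //.
- by move=> z w; rewrite re_add re_opp.
- exact: cabs_re.
- by move=> z w; rewrite im_add im_opp.
- exact: cabs_im.
Qed.

Lemma cmeasurableM p q : cmeasurable p -> cmeasurable q -> cmeasurable (fun x => p x * q x).
Proof.
move=> [p1 p2] [q1 q2]; split.
  rewrite (_ : (fun x => _) = fun x => re (p x) * re (q x) - im (p x) * im (q x)); last first.
    by apply/funext => x; rewrite re_mul.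
  by apply: measurable_funB; apply: measurable_funM.
rewrite (_ : (fun x => _) = fun x => re (p x) * im (q x) + im (p x) * re (q x)); last first.
  by apply/funext => x; rewrite im_mul.
by apply: measurable_funD; apply: measurable_funM.
Qed.

Lemma cmeasurable_conj p : cmeasurable p -> cmeasurable (fun x => (p x)^*%C).
Proof.
move=> [p1 p2]; split.
  by rewrite (_ : (fun x => _) = fun x => re (p x)) //; apply/funext => x; rewrite re_conj.
rewrite (_ : (fun x => _) = fun x => - im (p x)); last by apply/funext => x; rewrite im_conj.
exact: measurable_funN.
Qed.

Lemma cmeasurable_sqr p : cmeasurable p -> measurable_fun setT (fun x => cabs (p x) ^+ 2).
Proof.
move=> [p1 p2].
rewrite (_ : (fun x => _) = fun x => re (p x) ^+ 2 + im (p x) ^+ 2); last first.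
  by apply/funext => x; rewrite cabs_sqr.
by apply: measurable_funD; apply: measurable_funX.
Qed.

Lemma integral_lty_integrable (f : R -> R) (D : set R) : measurable D -> measurable_fun D f ->
  (forall x, D x -> 0 <= f x) -> (\int[mu]_(x in D) (f x)%:E < +oo)%E ->
  mu.-integrable D (EFin \o f).
Proof.
move=> mD mf f0 fi; apply/integrableP; split; first exact/measurable_EFinP.
rewrite [X in (X < _)%E](_ : _ = \int[mu]_(x in D) (f x)%:E)%E //.
by apply: eq_integral => x /set_mem xD; rewrite /= ger0_norm // f0.
Qed.

Lemma integrable_integralE (f : R -> R) (D : set R) : measurable D ->
  mu.-integrable D (EFin \o f) ->
  (\int[mu]_(x in D) (f x)%:E = (Rintegral mu D f)%:E)%E.
Proof. by move=> mD fi; rewrite /Rintegral fineK //; exact: integrable_fin_num. Qed.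

Lemma ge0_le_integralR (f g : R -> R) (D : set R) : measurable D ->
  measurable_fun D f -> measurable_fun D g ->
  (forall x, D x -> 0 <= f x) -> (forall x, D x -> f x <= g x) ->
  (\int[mu]_(x in D) (f x)%:E <= \int[mu]_(x in D) (g x)%:E)%E.
Proof.
move=> mD mf mg f0 fg; apply: ge0_le_integral => //.
- exact/measurable_EFinP.
- exact/measurable_EFinP.
Qed.

Lemma integral_sub_le (D : set R) (f : R -> R) (g : R -> \bar R) : measurable D ->
  measurable_fun D f -> measurable_fun setT g -> (forall x, D x -> 0 <= f x) ->
  (forall x, 0 <= g x)%E -> (forall x, D x -> ((f x)%:E <= g x)%E) ->
  (\int[mu]_(x in D) (f x)%:E <= \int[mu]_x g x)%E.
Proof.
move=> mD mf mg f0 g0 fg; apply: (@le_trans _ _ (\int[mu]_(x in D) g x)%E).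
  apply: ge0_le_integral => //; first exact/measurable_EFinP.
  exact: measurable_funTS.
exact: ge0_subset_integral.
Qed.

Lemma integral_segment_cst (a b c : R) : a <= b ->
  (\int[mu]_(x in `[a, b]) c%:E = (c * (b - a))%:E)%E.
Proof.
move=> ab; rewrite (integrable_integralE (f := fun=> c)) ?Rintegral_segment_cst //.
have [] := @rcont_cintegrable R a b (fun=> c%:C) => //.
by move=> x _ e e0; exists 1 => // y _; rewrite subrr cabs0.
Qed.

Lemma cintegrable_le p (g : R -> R) (D : set R) : measurable D ->
  measurable_fun D (fun x => re (p x)) -> measurable_fun D (fun x => im (p x)) ->
  mu.-integrable D (EFin \o g) -> (forall x, D x -> cabs (p x) <= g x) -> cintegrable D p.
Proof.
move=> mD m1 m2 gi pg; split; apply: (integrableR_le mD _ gi) => // x Dx.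
  exact: le_trans (cabs_re _) (pg x Dx).
exact: le_trans (cabs_im _) (pg x Dx).
Qed.

(** A superlevel set of g is the union of the countably many squares with rational centre and
    half-side 1/(n + 1) that it contains, which makes it measurable for the product sigma-algebra
    used by Tonelli's theorem. *)
Lemma plane_measurable (g : R * R -> R) :
  (forall x y e, 0 < e -> exists2 d : R, 0 < d & forall x' y', `|x' - x| < d -> `|y' - y| < d ->
     `|g (x', y') - g (x, y)| < e) -> measurable_fun setT g.
Proof.
move=> gc mT; apply: (measurability _ (RGenOInfty.measurableE R)) => //.
move=> _ [_ [a ->] <-]; rewrite setTI.
pose box (s : rat * rat * nat) : set (R * R) :=
  (`](ratr s.1.1 - s.2.+1%:R^-1), (ratr s.1.1 + s.2.+1%:R^-1)[ `*`
   `](ratr s.1.2 - s.2.+1%:R^-1), (ratr s.1.2 + s.2.+1%:R^-1)[)%classic.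
pose U := (g @^-1` `]a, +oo[%classic) : set (R * R).
rewrite [X in measurable X](_ : _ = \bigcup_s (if `[< box s `<=` U >] then box s else set0)).
  apply: countable_bigcupT_measurable => [|s]; first exact: countableP.
  case: ifP => _ //.
  by apply: measurableX; apply: measurable_itv.
apply/seteqP; split; last by move=> z [s _]; case: asboolP => // sU /sU.
move=> [x y] /= Uxy.
have ga : a < g (x, y) by move: Uxy; rewrite in_itv /= andbT.
have [d d0 Hd] : exists2 d : R, 0 < d & forall x' y', `|x' - x| < d -> `|y' - y| < d ->
     `|g (x', y') - g (x, y)| < g (x, y) - a by apply: gc; rewrite subr_gt0.
have [n nd] : exists n : nat, 2 / d < n.+1%:R.
  by exists (Num.truncn (2 / d)); rewrite truncnS_gt.
have nV : n.+1%:R^-1 * 2 < d.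
  rewrite -ltr_pdivlMr // -[d / 2]invrK invf_div ltf_pV2 ?posrE ?divr_gt0 //.
have n0 : 0 < (n.+1%:R^-1 : R) by rewrite invr_gt0.
set k : R := n.+1%:R^-1 in nV n0.
have xlt : x - k < x + k by lra.
have ylt : y - k < y + k by lra.
have [r rx] := rat_in_itvoo xlt; have [s sy] := rat_in_itvoo ylt.
move: rx sy; rewrite !in_itv /= => /andP[r1 r2] /andP[s1 s2].
exists ((r, s), n) => //=; case: asboolP => [_|nU].
  by split => /=; rewrite in_itv /= -/k /=; apply/andP; split; lra.
case: nU => -[x' y'] [/=]; rewrite !in_itv /= -/k => /andP[x1 x2] /andP[y1 y2].
have := Hd x' y'; rewrite !ltr_norml => /(_ _ _)/andP[||h _].
- by apply/andP; split; lra.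
- by apply/andP; split; lra.
by rewrite /U /= in_itv /= andbT; lra.
Qed.

Lemma tonelliR (g : R -> R -> R) : measurable_fun setT (fun s : R * R => g s.1 s.2) ->
  (forall x y, 0 <= g x y) ->
  (\int[mu]_x \int[mu]_y (g x y)%:E = \int[mu]_y \int[mu]_x (g x y)%:E)%E.
Proof.
move=> mg g0.
have mg' : measurable_fun setT (fun s : R * R => (g s.1 s.2)%:E) by exact/measurable_EFinP.
exact: (@fubini_tonelli _ _ _ _ _ mu mu (fun s : R * R => (g s.1 s.2)%:E) mg' (fun s => g0 s.1 s.2)).
Qed.

(** The Poisson kernel of the upper half-plane at u + i v without the factor 1/pi; its total mass is
    pi. *)
Definition poisson (u v x : R) : R := v / ((x - u) ^+ 2 + v ^+ 2).

Lemma poisson_den (u v x : R) : 0 < v -> 0 < (x - u) ^+ 2 + v ^+ 2.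
Proof. by move=> v0; rewrite ltr_wpDl ?sqr_ge0 ?exprn_gt0. Qed.

Lemma poisson_ge0 (u v x : R) : 0 < v -> 0 <= poisson u v x.
Proof. by move=> v0; rewrite /poisson divr_ge0 ?ltW ?poisson_den. Qed.

Lemma poisson_continuous (u v : R) : 0 < v -> continuous (poisson u v).
Proof.
move=> v0 x; apply: cvgM; first exact: cvg_cst.
apply: cvgV; first by rewrite gt_eqF ?poisson_den.
apply: cvgD; last exact: cvg_cst.
apply: (@continuous_comp _ _ _ (fun x => x - u) (fun t => t ^+ 2)).
  by apply: cvgB; [exact: cvg_id|exact: cvg_cst].
exact: exprn_continuous.
Qed.

Lemma poisson_measurable (u v : R) : 0 < v -> measurable_fun setT (poisson u v).
Proof. by move=> v0; apply: continuous_measurable_fun; exact: poisson_continuous. Qed.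

Lemma poisson_primitive (u v x : R) : 0 < v ->
  is_derive x 1 (fun x => atan ((x - u) / v)) (poisson u v x).
Proof.
move=> v0.
have h : is_derive x 1 (fun x : R => (x - u) / v) (v^-1).
  apply: is_derive_eq; rewrite scaler0 add0r subr0; exact: mulr1.
have := @is_derive1_comp _ atan (fun x : R => (x - u) / v) x _ _ (is_derive1_atan _) h.
rewrite /poisson; congr (is_derive _ _ _ _).
by field; rewrite (gt_eqF v0) gt_eqF ?poisson_den //= expr_div_n -[1](divff (_ : v ^+ 2 != 0)) ?expf_neq0 ?gt_eqF // -mulrDl mulf_neq0 ?invr_neq0 ?expf_neq0 ?gt_eqF // addrC poisson_den.
Qed.

Lemma poisson_segment (u v a b : R) : 0 < v -> a < b ->
  (\int[mu]_(x in `[a, b]) (poisson u v x)%:E)%E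
  = (atan ((b - u) / v) - atan ((a - u) / v))%:E.
Proof.
move=> v0 ab.
have ca x : {for x, continuous (fun x => atan ((x - u) / v))}.
  apply: differentiable_continuous; apply/derivable1_diffP.
  exact: (@ex_derive _ _ _ _ _ _ _ (poisson_primitive u x v0)).
rewrite (@continuous_FTC2 R (poisson u v) (fun x => atan ((x - u) / v))) //.
- by apply: continuous_in_subspaceT => x _; exact: poisson_continuous.
- split.
  + by move=> x _; exact: (@ex_derive _ _ _ _ _ _ _ (poisson_primitive u x v0)).
  + by apply: cvg_at_right_filter; exact: ca.
  + by apply: cvg_at_left_filter; exact: ca.
- by move=> x _; rewrite derive1E; exact: (@derive_val _ _ _ _ _ _ _ (poisson_primitive u x v0)).
Qed.

Lemma atan_affine_cvg (u v : R) : 0 < v ->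
  atan ((n%:R - u) / v) - atan ((- n%:R - u) / v) @[n --> \oo] --> pi.
Proof.
move=> v0.
have h (w : R) : (n%:R - w) / v @[n --> \oo] --> +oo.
  apply/cvgryPge => A; near=> n.
  rewrite ler_pdivlMr // lerBrDr; near: n; exact: nbhs_infty_ger.
rewrite [X in _ --> X](_ : _ = pi / 2 - - (pi / 2)); last by field.
apply: (@cvgB _ _ _ _ _ (fun n : nat => atan ((n%:R - u) / v))
  (fun n : nat => atan ((- n%:R - u) / v))); first exact: (@cvg_comp _ _ _ (fun n : nat => (n%:R - u) / v) (@atan R) _ _ _ (h u) (@cvgy_atan R)).
rewrite (_ : (fun n => _) = (fun n : nat => - atan ((n%:R - (- u)) / v))); last first.
  by apply/funext => n; rewrite -atanN -mulNr; congr (atan (_ / _)); ring.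
apply: cvgN; exact: (@cvg_comp _ _ _ (fun n : nat => (n%:R - (- u)) / v) (@atan R) _ _ _ (h (- u)) (@cvgy_atan R)).
Unshelve. all: by end_near. Qed.

Lemma bigcup_segments : \bigcup_n `[- n%:R, n%:R]%classic = [set: R].
Proof.
apply/seteqP; split => // x _; exists (Num.truncn `|x|).+1 => //=.
by rewrite in_itv /= -ler_norml ltW // truncnS_gt.
Qed.

Lemma poisson_integral (u v : R) : 0 < v -> (\int[mu]_x (poisson u v x)%:E = pi%:E)%E.
Proof.
move=> v0.
have ndA : nondecreasing_seq (fun n : nat => `[- n%:R, n%:R]%classic : set R).
  move=> n m nm; apply/subsetPset; apply: subset_itv; rewrite bnd_simp ?lerN2 ler_nat //.
have := @ge0_nondecreasing_set_cvg_integral _ (measurableTypeR R) R (fun n : nat => `[- n%:R, n%:R]%classic : set R)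
  (EFin \o poisson u v) mu ndA (fun i => measurable_itv _).
have me : measurable_fun setT (EFin \o poisson u v).
  by apply/measurable_EFinP; exact: poisson_measurable.
rewrite bigcup_segments => /(_ (fun n => measurable_funTS me)).
move=> /(_ (fun _ x _ => poisson_ge0 u x v0)) H.
have K : (\int[mu]_(x in `[(- n%:R : R)%R, (n%:R : R)%R]) (EFin \o poisson u v) x)%E @[n --> \oo] --> (pi%:E)%E.
  (* The shift discards n = 0, whose segment is a point, outside the scope of [poisson_segment]. *)
  rewrite -cvg_shiftS /=.
  rewrite (_ : (fun n => _) = (fun n : nat => (atan ((n.+1%:R - u) / v) - atan ((- n.+1%:R - u) / v))%:E)).
    apply/fine_cvgP; split; first exact: nearW.
    have A := atan_affine_cvg u v0; rewrite -cvg_shiftS in A; exact: A.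
  apply/funext => n; rewrite poisson_segment //.
  by rewrite -subr_gt0 opprK addr_gt0.
exact: cvg_unique H K.
Qed.

Lemma poisson_integrable (u v : R) : 0 < v -> mu.-integrable setT (EFin \o poisson u v).
Proof.
move=> v0; apply: integral_lty_integrable => //; first exact: poisson_measurable.
  by move=> x _; exact: poisson_ge0.
by rewrite poisson_integral // ltry.
Qed.

(** Dominated convergence with |f| as majorant. The endpoints only have to tend to infinity, since
    the vertical sides of the contours used later sit at abscissae that are merely known to
    exist. *)
Lemma Rintegral_exhaust (f : R -> R) (b a : nat -> R) : mu.-integrable setT (EFin \o f) ->
  (forall A : R, exists N, forall n, (N <= n)%N -> A <= a n /\ b n <= - A) ->
  Rintegral mu `[b n, a n] f @[n --> \oo] --> Rintegral mu setT f.
Proof.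
move=> fi ha; have mf := integrableR_measurable fi.
pose f_ n x := (f \_ `[b n, a n]) x.
have [|||||_ _ H] := @dominated_convergence _ _ _ mu setT measurableT
   (fun n x => (f_ n x)%:E) (EFin \o f) (fun x => `|f x|%:E).
- move=> n; apply/measurable_EFinP; apply/measurable_restrict => //.
  by rewrite setTI; exact: measurable_funTS.
- exact/measurable_EFinP.
- apply: aeW => x _; have [N HN] := ha `|x|.
  apply: cvg_near_cst; exists N => // n /= /HN[h1 h2].
  have := ler_norm x; have := ler_norm (- x); rewrite normrN => h3 h4; rewrite /f_ patchE ifT // inE /= in_itv /=.
  by apply/andP; split; lra.
- exact: integrable_norm.
- apply: aeW => x n _; rewrite /f_ patchE; case: ifP => _ //.
  by rewrite /= normr0 lee_fin.
have E n : Rintegral mu `[b n, a n] f = fine (\int[mu]_x (f_ n x)%:E).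
  by rewrite Rintegral_mkcond.
under eq_fun do rewrite E.
apply: fine_cvg; rewrite /Rintegral fineK; last exact: integrable_fin_num.
exact: H.
Qed.

Lemma cint_exhaust p (b a : nat -> R) (e : R) : cintegrable setT p ->
  (forall A : R, exists N, forall n, (N <= n)%N -> A <= a n /\ b n <= - A) -> 0 < e ->
  exists N, forall n, (N <= n)%N -> cabs (cint setT p - cint `[b n, a n] p) <= e.
Proof.
move=> [p1 p2] ha e0; have e2 : 0 < e / 2 by rewrite divr_gt0.
have /cvgrPdist_le/(_ _ e2)[N1 _ H1] := Rintegral_exhaust p1 ha.
have /cvgrPdist_le/(_ _ e2)[N2 _ H2] := Rintegral_exhaust p2 ha.
exists (maxn N1 N2) => n; rewrite geq_max => /andP[n1 n2].
apply: le_trans (cabs_le_reim _) _; rewrite re_add im_add re_opp im_opp /=.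
by have := H1 n n1; have := H2 n n2 => /=; lra.
Qed.

End RealIntegrals.

(** * Contour integrals at infinity in the half-plane *)

Section HalfPlane.
Context {R : realType}.
Local Notation C := R[i].
Local Notation re := (@complex.Re R).
Local Notation im := (@complex.Im R).
Local Notation mu := (@lebesgue_measure R).
Implicit Types (F Q : C -> C).

(** At a real point this is differentiability on both sides of the axis, as f/E has when E has no
    real zeros; boundary values are then ordinary values. *)
Definition uhol F := forall z, 0 <= im z -> holomorphic_at F z.

Definition hline F (y : R) : \bar R := (\int[mu]_x (cabs (F (x +i* y)%C) ^+ 2)%:E)%E.

Definition hbounded F (M : R) := forall y, 0 <= y -> (hline F y <= M%:E)%E.

Lemma uhol_ccont F z : uhol F -> 0 <= im z -> ccont F z.
Proof. by move=> Fh /Fh/holo_hasd[d /hasd_ccont]. Qed.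

Lemma uhol_rcont F y : uhol F -> 0 <= y -> forall x, rcont (fun x => F (x +i* y)%C) x.
Proof. by move=> Fh y0 x; apply: rcont_hor; exact: uhol_ccont. Qed.

Lemma uhol_sqr_measurable F (y : R) : uhol F -> 0 <= y ->
  measurable_fun setT (fun x : R => cabs (F (x +i* y)%C) ^+ 2).
Proof.
by move=> Fh y0; apply: cmeasurable_sqr; apply: rcont_cmeasurable; exact: uhol_rcont.
Qed.

Lemma hline_integrable F M (y : R) : uhol F -> hbounded F M -> 0 <= y ->
  mu.-integrable setT (EFin \o (fun x : R => cabs (F (x +i* y)%C) ^+ 2)).
Proof.
move=> Fh FM y0; apply: integral_lty_integrable => //.
- exact: uhol_sqr_measurable.
- by move=> x _; rewrite exprn_ge0 ?cabs_ge0.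
- by apply: le_lt_trans (FM y y0) _; rewrite ltry.
Qed.

Lemma sqr_cabs_near (u v : C) (e : R) : 0 < e ->
  cabs (u - v) < Num.min 1 (e / (2 * cabs v + 1)) ->
  `|cabs u ^+ 2 - cabs v ^+ 2| < e.
Proof.
move=> e0; have v0 := cabs_ge0 v; have u0 := cabs_ge0 u.
have k0 : 0 < 2 * cabs v + 1 by lra.
rewrite lt_min => /andP[h1]; rewrite ltr_pdivlMr // => h2.
have a1 := ler_cabs_sub u v; have a2 := ler_cabs_sub v u; rewrite cabsBC in a2.
have d0 := cabs_ge0 (u - v).
rewrite subr_sqr normrM (ger0_norm (addr_ge0 u0 v0)).
have : `|cabs u - cabs v| <= cabs (u - v) by rewrite ler_norml; apply/andP; split; lra.
nra.
Qed.

(** Taking the absolute value of the ordinate gives a function continuous on the whole plane,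
    although F is controlled only above the axis. *)
Lemma abs_plane_measurable F : uhol F ->
  measurable_fun setT (fun s : R * R => cabs (F (s.1 +i* `|s.2|)%C) ^+ 2).
Proof.
move=> Fh; apply: plane_measurable => x y e e0 /=.
have := uhol_ccont (z := (x +i* `|y|)%C) Fh (normr_ge0 y).
set v := F _ => /(_ (Num.min 1 (e / (2 * cabs v + 1)))) [].
  rewrite lt_min ltr01 divr_gt0 //; have := cabs_ge0 v; lra.
move=> d d0 Hd; exists (d / 2); first by rewrite divr_gt0.
move=> x' y' hx hy; apply: sqr_cabs_near => //; apply: Hd.
apply: le_lt_trans (cabs_le_reim _) _; rewrite /=.
have := ler_dist_dist y' y; lra.
Qed.

(** By Tonelli the integral of |F|^2 over the strip of height h is at most h M. A window of length h
    M + 1 therefore contains an abscissa whose vertical integral is at most 1. *)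
Lemma vertical_small F (M h : R) : uhol F -> hbounded F M -> 0 <= M -> 0 < h -> forall c : R,
  exists x : R, c <= x <= c + (h * M + 1) /\
  Rintegral mu `[0, h] (fun y => cabs (F (x +i* y)%C) ^+ 2) <= 1.
Proof.
move=> Fh FM M0 h0 c.
pose g (x y : R) := cabs (F (x +i* `|y|)%C) ^+ 2 * \1_(`[0, h]%classic : set R) y.
have g0 x y : 0 <= g x y by rewrite mulr_ge0 ?exprn_ge0 ?cabs_ge0.
have mg : measurable_fun setT (fun s : R * R => g s.1 s.2).
  apply: measurable_funM; first exact: abs_plane_measurable.
  apply: measurableT_comp; last exact: measurable_snd.
  by apply: measurable_indic; exact: measurable_itv.
have inner x : (\int[mu]_y (g x y)%:E = \int[mu]_(y in `[0%R, h]) (cabs (F (x +i* y)%C) ^+ 2)%:E)%E.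
  rewrite [RHS]integral_mkcond; apply: eq_integral => y _.
  rewrite /g indicE; have [yin|yin] := boolP (y \in (`[0, h]%classic : set R)).
    rewrite patchE ifT // mulr1 ger0_norm //.
    by move: yin; rewrite inE /= in_itv /= => /andP[].
  by rewrite patchE ifF ?mulr0 //; exact: negbTE.
have T : (\int[mu]_x \int[mu]_y (g x y)%:E <= (h * M)%:E)%E.
  rewrite tonelliR //.
  apply: (@le_trans _ _ (\int[mu]_y (M%:E * (\1_(`[0%R, h]%classic : set R) y)%:E))%E).
    apply: ge0_le_integral => //.
    - by move=> y _; apply: integral_ge0 => x _; rewrite lee_fin.
    - apply: (@measurable_fun_fubini_tonelli_G _ _ _ _ _ mu (fun s => (g s.1 s.2)%:E)).
        exact/measurable_EFinP.
      by move=> s; rewrite lee_fin.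
    - by apply: measurable_funeM; apply/measurable_EFinP; apply: measurable_indic; exact: measurable_itv.
    move=> y _; rewrite indicE; have [yin|yin] := boolP (y \in (`[0, h]%classic : set R)).
      have y0 : 0 <= y by move: yin; rewrite inE /= in_itv /= => /andP[].
      rewrite mule1; apply: le_trans (FM y y0); rewrite le_eqVlt; apply/orP; left; apply/eqP.
      by apply: eq_integral => x _; rewrite /g indicE yin mulr1 ger0_norm.
    by rewrite mule0 integral0_eq // => x _; rewrite /g indicE (negbTE yin) mulr0.
  rewrite ge0_integralZl //; last first.
    by apply/measurable_EFinP; apply: measurable_indic; exact: measurable_itv.
  have hmu : (mu `[0%R, h] = h%:E)%E by rewrite lebesgue_measure_itv /= lte_fin h0 sube0.
  by rewrite integral_indic // setIT [X in (_ * X)%E](_ : _ = h%:E)%E // -EFinM mulrC.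
apply: contrapT => H.
have big x : c <= x <= c + (h * M + 1) -> (1%:E <= \int[mu]_y (g x y)%:E)%E.
  move=> xc; rewrite inner integrable_integralE //; last first.
    apply: continuous_compact_integrable; first exact: segment_compact.
    apply: continuous_in_subspaceT => y /set_mem /=; rewrite in_itv /= => /andP[y0 _].
    apply/cvgrPdist_lt => e e0; set v := F (x +i* y)%C.
    have k0 : 0 < Num.min 1 (e / (2 * cabs v + 1)).
      rewrite lt_min ltr01 divr_gt0 //; have := cabs_ge0 v; lra.
    have [d d0 Hd] := rcont_ver (uhol_ccont (z := (x +i* y)%C) Fh y0) k0.
    by exists d => //= t; rewrite /ball /= distrC => /Hd ?; rewrite distrC; exact: sqr_cabs_near.
  by rewrite lee_fin leNgt; apply/negP => /ltW ?; apply: H; exists x; split.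
have : ((h * M + 1)%:E <= (h * M)%:E)%E.
  apply: le_trans T.
  have cc : c <= c + (h * M + 1) by rewrite lerDl addr_ge0 // mulr_ge0 // ltW.
  have -> : ((h * M + 1)%:E = \int[mu]_(x in `[c, (c + (h * M + 1))%R]) 1%:E)%E.
    by rewrite integral_segment_cst //; congr (_%:E); ring.
  apply: (integral_sub_le (f := fun=> 1)) => //.
  - apply: (@measurable_fun_fubini_tonelli_F _ _ _ _ _ mu (fun s => (g s.1 s.2)%:E)).
      exact/measurable_EFinP.
    by move=> s; rewrite lee_fin.
  - by move=> x; apply: integral_ge0 => y _; rewrite lee_fin.
by rewrite lee_fin gerDl ler10.
Qed.

(* Contour [b, a] x [0, k^2]; the vertical sides are controlled by vertical_small and
   the top side by AM-GM with weight 1/k. *)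
Lemma halfplane_vanish F Q (M B r0 : R) : uhol F -> uhol Q -> hbounded F M -> 0 <= M ->
  0 <= B -> 1 <= r0 ->
  (forall z, 0 <= im z -> r0 <= cabs z ->
    cabs (Q z) <= B * (cabs (F z) / cabs z + (cabs z ^+ 2)^-1)) ->
  cintegrable setT (fun x => Q (x +i* 0)%C) -> cint setT (fun x => Q (x +i* 0)%C) = 0.
Proof.
move=> Fh Qh FM M0 B0 r1 QF Qi; set I := cint _ _.
have pi0 : 0 < pi :> R := pi_gt0 R.
(* The left side is independent of k, so a bound O(1/k) forces it to vanish. *)
suff H (k : R) : r0 <= k -> cabs I <= B * (M + 3 * pi) / (2 * k).
  apply/eqP; rewrite -cabs_eq0 eq_le cabs_ge0 andbT leNgt; apply/negP => I0.
  have S0 : 0 <= B * (M + 3 * pi) by rewrite mulr_ge0 // addr_ge0 // mulr_ge0 // ltW.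
  pose k := r0 + B * (M + 3 * pi) / cabs I.
  have q0 : 0 <= B * (M + 3 * pi) / cabs I by rewrite divr_ge0 // ltW.
  have k0 : 0 < k by rewrite /k; lra.
  have := H k; rewrite ler_pdivlMr ?mulr_gt0 // => /(_ _).
  have -> : cabs I * (2 * k) = 2 * r0 * cabs I + 2 * (B * (M + 3 * pi)).
    by rewrite /k; field; rewrite gt_eqF.
  have : 0 < r0 * cabs I by rewrite mulr_gt0 //; lra.
  by move=> h1 h2; have := h2 (ler_wpDr q0 (lexx _)); lra.
move=> rk; have k0 : 0 < k by lra.
(* On the line at height h, 1/|z|^2 is the Poisson kernel divided by h. Its weight k/2 + 1 thus
   costs pi (k/2 + 1)/h, which is at most 3 pi/(2 k). *)
pose h := k ^+ 2; have h0 : 0 < h by rewrite exprn_gt0.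
have k1 : 1 <= k by lra.
have kh : k <= h by rewrite /h expr2 ler_peMr // ltW.
have line_int y b a : 0 <= y -> cintegrable `[b, a] (fun x => Q (x +i* y)%C).
  by move=> y0; apply: rcont_cintegrable => x _; exact: uhol_rcont.
have ver_int x : cintegrable `[0, h] (fun y => Q (x +i* y)%C).
  by apply: rcont_cintegrable => y /andP[y0 _]; apply: rcont_ver; exact: uhol_ccont.
have amgm (u t s : R) : 0 < s -> u * t <= s / 2 * u ^+ 2 + (2 * s)^-1 * t ^+ 2.
  move=> s0; have := sqr_ge0 (s * u - t).
  have -> : s / 2 * u ^+ 2 + (2 * s)^-1 * t ^+ 2 = (2 * s)^-1 * ((s * u) ^+ 2 + t ^+ 2).
    by field; rewrite gt_eqF.
  move=> h2; rewrite [leRHS]mulrC ler_pdivlMr ?mulr_gt0 //; nra.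
have top b a : b <= a -> cabs (cint `[b, a] (fun x => Q (x +i* h)%C)) <= B * (M + 3 * pi) / (2 * k).
  move=> ba; apply: le_trans (cabs_cint_le _ (line_int h b a (ltW h0))) _ => //.
  pose G x := B * (k^-1 / 2 * cabs (F (x +i* h)%C) ^+ 2 + (k / 2 + 1) / h * poisson 0 h x).
  have Gi : mu.-integrable setT (EFin \o G).
    apply: integrableR_Z => //; apply: integrableR_D => //.
      by apply: integrableR_Z => //; apply: hline_integrable FM _; rewrite ?ltW.
    by apply: integrableR_Z => //; exact: poisson_integrable.
  have G0 x : 0 <= G x.
    apply: mulr_ge0 => //; apply: addr_ge0; first by rewrite mulr_ge0 ?exprn_ge0 ?cabs_ge0 // divr_ge0 // invr_ge0 ltW.
    apply: mulr_ge0; last exact: poisson_ge0.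
    by rewrite divr_ge0 ?ltW //; lra.
  have step1 : Rintegral mu `[b, a] (fun x => cabs (Q (x +i* h)%C)) <= Rintegral mu setT G.
    rewrite -lee_fin -!integrable_integralE //; last by apply: integrable_cabs => //; exact/line_int/ltW.
    apply: integral_sub_le => //.
    - by apply: measurable_cabs; exact/line_int/ltW.
    - by apply/measurable_EFinP; exact: integrableR_measurable.
    - by move=> x _; exact: cabs_ge0.
    move=> x _; rewrite lee_fin.
    have zh : h <= cabs (x +i* h)%C.
      by have := cabs_im (x +i* h)%C; rewrite /= gtr0_norm.
    have z0 : 0 < cabs (x +i* h)%C by lra.
    have q1 : 0 <= im (x +i* h)%C by exact: ltW.
    have q2 : r0 <= cabs (x +i* h)%C by lra.
    apply: le_trans (QF _ q1 q2) _.
    rewrite /G; apply: ler_wpM2l => //.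
    have kV : 0 < k^-1 by rewrite invr_gt0.
    have := amgm (cabs (F (x +i* h)%C)) (cabs (x +i* h)%C)^-1 _ kV.
    have -> : (k / 2 + 1) / h * poisson 0 h x = (k / 2 + 1) * (cabs (x +i* h)%C ^+ 2)^-1.
      rewrite /poisson subr0 cabs_sqr /=; field.
      by rewrite (gt_eqF h0) -[x ^+ 2](subr0) -{1}(subr0 x) subr0 gt_eqF // ltr_wpDl ?sqr_ge0 ?exprn_gt0.
    have -> : (2 * k^-1)^-1 * (cabs (x +i* h)%C)^-1 ^+ 2 = k / 2 * (cabs (x +i* h)%C ^+ 2)^-1.
      by field; rewrite !gt_eqF.
    lra.
  apply: le_trans step1 _; rewrite /G RintegralZl //; last first.
    apply: integrableR_D => //.
      by apply: integrableR_Z => //; apply: hline_integrable FM _; rewrite ?ltW.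
    by apply: integrableR_Z => //; exact: poisson_integrable.
  rewrite RintegralD //; last 2 first.
  - by apply: integrableR_Z => //; apply: hline_integrable FM _; rewrite ?ltW.
  - by apply: integrableR_Z => //; exact: poisson_integrable.
  have -> : Rintegral mu setT (fun x => k^-1 / 2 * cabs (F (x +i* h)%C) ^+ 2) =
      k^-1 / 2 * Rintegral mu setT (fun x => cabs (F (x +i* h)%C) ^+ 2).
    by apply: RintegralZl => //; apply: hline_integrable FM _; rewrite ?ltW.
  have -> : Rintegral mu setT (fun x => (k / 2 + 1) / h * poisson 0 h x) =
      (k / 2 + 1) / h * Rintegral mu setT (poisson 0 h).
    by apply: RintegralZl => //; exact: poisson_integrable.
  rewrite {2}/Rintegral poisson_integral // [fine _]/=.
  have FM' : Rintegral mu setT (fun x => cabs (F (x +i* h)%C) ^+ 2) <= M.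
    rewrite -lee_fin -integrable_integralE //; first by apply: FM; exact: ltW.
    by apply: hline_integrable FM _; rewrite ?ltW.
  rewrite -[leRHS]mulrA; apply: ler_wpM2l => //.
  have -> : (M + 3 * pi) / (2 * k) = k^-1 / 2 * M + 3 * pi / (2 * k) by field; rewrite gt_eqF.
  apply: lerD; first by rewrite ler_wpM2l // divr_ge0 // invr_ge0 ltW.
  have -> : 3 * pi / (2 * k) = 3 / (2 * k) * pi by field; rewrite gt_eqF.
  rewrite ler_pM2r // ler_pdivrMr // /h.
  have -> : 3 / (2 * k) * k ^+ 2 = 3 / 2 * k by field; rewrite gt_eqF.
  lra.
have vert x : r0 <= `|x| -> Rintegral mu `[0, h] (fun y => cabs (F (x +i* y)%C) ^+ 2) <= 1 ->
    cabs (cint `[0, h] (fun y => Q (x +i* y)%C)) <= B * (1 + 2 * h) / `|x|.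
  move=> rx Fx; have x0 : 0 < `|x| by lra.
  apply: le_trans (cabs_cint_le _ (ver_int x)) _ => //.
  have Fi : mu.-integrable `[0, h] (EFin \o (fun y => cabs (F (x +i* y)%C) ^+ 2)).
    apply: continuous_compact_integrable; first exact: segment_compact.
    apply: continuous_in_subspaceT => y /set_mem /=; rewrite in_itv /= => /andP[y0 _].
    apply/cvgrPdist_lt => e e0; set v := F (x +i* y)%C.
    have t0 : 0 < Num.min 1 (e / (2 * cabs v + 1)).
      rewrite lt_min ltr01 divr_gt0 //; have := cabs_ge0 v; lra.
    have [d d0 Hd] := rcont_ver (uhol_ccont (z := (x +i* y)%C) Fh y0) t0.
    by exists d => //= t; rewrite /ball /= distrC => /Hd ?; rewrite distrC; exact: sqr_cabs_near.
  have ci : mu.-integrable `[0, h] (EFin \o (fun=> 2 : R)).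
    by have [] := @rcont_cintegrable R 0 h (fun=> 2%:C); rewrite // => t _ e e0; exists 1 => // y _; rewrite subrr cabs0.
  apply: (@le_trans _ _ (Rintegral mu `[0, h] (fun y => B / `|x| * (cabs (F (x +i* y)%C) ^+ 2 + 2)))).
    apply: le_Rintegral => //.
    - by apply: integrable_cabs.
    - by apply: integrableR_Z => //; exact: integrableR_D.
    move=> y /=; rewrite in_itv /= => /andP[y0 _].
    have zx : `|x| <= cabs (x +i* y)%C by exact: cabs_re (x +i* y)%C.
    have z0 : 0 < cabs (x +i* y)%C by lra.
    have q2 : r0 <= cabs (x +i* y)%C by lra.
    apply: le_trans (QF (x +i* y)%C y0 q2) _.
    rewrite -[leRHS]mulrA; apply: ler_wpM2l => //.
    set f := cabs (F _); set t := cabs (x +i* y)%C in zx z0 *.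
    have f0 : 0 <= f := cabs_ge0 _.
    have tV : t^-1 <= `|x|^-1 by rewrite lef_pV2.
    have xV : 0 < `|x|^-1 by rewrite invr_gt0.
    have tV0 : 0 < t^-1 by rewrite invr_gt0.
    have xV1 : `|x|^-1 <= 1 by rewrite invf_le1 //; lra.
    have e1 : (t ^+ 2)^-1 <= `|x|^-1.
      have : t^-1 * t^-1 <= t^-1 * 1 by apply: ler_wpM2l; [exact: ltW|lra].
      by rewrite -exprVn expr2; lra.
    have e2 : f / t <= f / `|x| by rewrite ler_wpM2l.
    have e3 : f <= f ^+ 2 + 1 by have := sqr_ge0 (f - 1); nra.
    have := ler_wpM2r (ltW xV) e3; lra.
  rewrite RintegralZl //; last exact: integrableR_D.
  rewrite RintegralD // (Rintegral_segment_cst 2 (ltW h0)) subr0.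
  rewrite [leRHS]mulrAC; apply: ler_wpM2l; first by rewrite divr_ge0 // ltW.
  by rewrite lerD2r.
suff H e : 0 < e -> cabs I <= B * (M + 3 * pi) / (2 * k) + e.
  rewrite leNgt; apply/negP => hI; have := H ((cabs I - B * (M + 3 * pi) / (2 * k)) / 2).
  by rewrite divr_gt0 ?subr_gt0 // => /(_ isT); lra.
move=> e0.
pose L := h * M + 1.
have L0 : 0 <= L by rewrite /L addr_ge0 // mulr_ge0 // ltW.
(* The sides are taken in windows of length L beyond r0 + n on the right and before -(r0 + n) on the
   left; the subtraction of L places the left window entirely before that point. *)
have [a Ha] := choice (fun n : nat => vertical_small Fh FM M0 h0 (r0 + n%:R)).
have [b Hb] := choice (fun n : nat => vertical_small Fh FM M0 h0 (- (r0 + n%:R) - L)).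
have far A : exists N, forall n, (N <= n)%N -> A <= a n /\ b n <= - A.
  exists (Num.truncn `|A|).+1 => n Nn.
  have An : A <= n%:R.
    apply: le_trans (ler_norm A) _; apply: ltW; apply: lt_le_trans (truncnS_gt _) _.
    by rewrite ler_nat.
  have [/andP[a1 _] _] := Ha n; have [/andP[_ b1] _] := Hb n.
  by move: b1; rewrite -/L => b1; split; lra.
have e3 : 0 < e / 3 by rewrite divr_gt0.
have [N1 H1] := cint_exhaust Qi far e3.
have BH0 : 0 <= B * (1 + 2 * h) by rewrite mulr_ge0 //; lra.
have [N2 H2] := far (B * (1 + 2 * h) / (e / 3)).
pose n := maxn N1 N2.
have {}H1 := H1 n (leq_maxl _ _); have [H2a H2b] := H2 n (leq_maxr _ _).
have [/andP[a1 _] a2] := Ha n; have [/andP[_ b1] b2] := Hb n; rewrite -/L in b1.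
have n0 : 0 <= n%:R :> R by [].
have ba : b n <= a n by lra.
have absa : `|a n| = a n by rewrite ger0_norm //; lra.
have absb : `|b n| = - b n by rewrite ler0_norm //; lra.
have va : cabs (cint `[0, h] (fun y => Q (a n +i* y)%C)) <= e / 3.
  apply: le_trans (vert (a n) _ a2) _; rewrite absa; first lra.
  rewrite ler_pdivrMr; last lra.
  by rewrite -ler_pdivrMl // mulrC.
have vb : cabs (cint `[0, h] (fun y => Q (b n +i* y)%C)) <= e / 3.
  apply: le_trans (vert (b n) _ b2) _; rewrite absb; first lra.
  rewrite ler_pdivrMr; last lra.
  rewrite -ler_pdivrMl // mulrC; lra.
have := @goursat R Q (b n) (a n) 0 h ba (ltW h0).
move=> /(_ (fun z zin => Qh z (proj1 (andP (proj2 (andP (proj2 (andP zin)))))))).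
rewrite /rectint; move: va vb H1 (top _ _ ba).
set T1 := cint `[b n, a n] (fun x => Q (x +i* 0)%C); set T2 := cint `[b n, a n] _.
set V1 := cint _ _; set V2 := cint _ _ => va vb H1 t2 E.
have -> : I = (I - T1) + (T2 + ('i%C * V2 - 'i%C * V1)).
  have : T1 - T2 + ('i%C * V1 - 'i%C * V2) = 0 by [].
  by move=> E'; rewrite -[LHS]subr0 -E'; ring.
have ci : cabs ('i%C : C) = 1 by rewrite /cabs /= expr0n /= add0r expr1n sqrtr1.
apply: le_trans (ler_cabsD _ _) _; apply: le_trans (lerD H1 (ler_cabsD _ _)) _.
have := ler_cabsB ('i%C * V2) ('i%C * V1); rewrite !cabsM ci !mul1r; lra.
Qed.

End HalfPlane.

(** * Cauchy and Poisson formulas, and bounds in the Hardy space *)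

Section HardyBounds.
Context {R : realType}.
Local Notation C := R[i].
Local Notation re := (@complex.Re R).
Local Notation im := (@complex.Im R).
Local Notation mu := (@lebesgue_measure R).
Implicit Types (F Q : C -> C) (w : C).

Lemma hasd_inv_sub (w z : C) : z != w -> exists d, hasd (fun v => (v - w)^-1) z d.
Proof.
by move=> zw; eexists; apply: hasdV (hasdB (hasd_id z) (hasd_cst w z)) _; rewrite subr_eq0.
Qed.

Lemma real_neq (x : R) w : im w != 0 -> (x +i* 0)%C != w.
Proof. by apply: contra_neq => <-. Qed.

Lemma real_dist_sqr (x : R) w : cabs ((x +i* 0)%C - w) ^+ 2 = (x - re w) ^+ 2 + im w ^+ 2.
Proof. by rewrite cabs_sqr re_add im_add re_opp im_opp /= sub0r sqrrN. Qed.

Lemma hbounded_ge0 F M : hbounded F M -> 0 <= M.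
Proof.
move=> /(_ 0 (lexx _)); rewrite -lee_fin; apply: le_trans.
by apply: integral_ge0 => x _; rewrite lee_fin exprn_ge0 ?cabs_ge0.
Qed.

Lemma cauchy_line_integrable F M w : uhol F -> hbounded F M -> im w != 0 ->
  cintegrable setT (fun x => F (x +i* 0)%C * ((x +i* 0)%C - w)^-1).
Proof.
move=> Fh FM w0; have v0 : 0 < `|im w| by rewrite normr_gt0.
have pc x : rcont (fun x => F (x +i* 0)%C * ((x +i* 0)%C - w)^-1) x.
  apply: (rcont_hor (f := fun z => F z * (z - w)^-1)).
  have [d hd] := hasd_inv_sub (real_neq x w0).
  by apply: ccontM; [exact: uhol_ccont|exact: hasd_ccont hd].
have [m1 m2] := rcont_cmeasurable pc.
have Fi := hline_integrable Fh FM (lexx 0).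
(* Majorant from 2 |F| |x - w|^(-1) <= |F|^2 + |x - w|^(-2), whose last term is a multiple of the
   Poisson kernel. *)
apply: (@cintegrable_le _ _ (fun x => 2^-1 * cabs (F (x +i* 0)%C) ^+ 2 +
    (2 * `|im w|)^-1 * poisson (re w) `|im w| x)) => //.
  apply: integrableR_D => //; apply: integrableR_Z => //; exact: poisson_integrable.
move=> x _; rewrite cabs_div.
have -> : (2 * `|im w|)^-1 * poisson (re w) `|im w| x = 2^-1 * (cabs ((x +i* 0)%C - w))^-1 ^+ 2.
  rewrite exprVn real_dist_sqr /poisson real_normK ?num_real //; field.
  by rewrite (gt_eqF v0) gt_eqF // ltr_wpDl ?sqr_ge0 // -real_normK ?num_real ?exprn_gt0.
set a := cabs _; set b := (cabs _)^-1; have := sqr_ge0 (a - b); nra.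
Qed.

Lemma cpoisson_integrable (u v : R) : 0 < v -> cintegrable setT (fun x => (poisson u v x)%:C).
Proof.
move=> v0; split; first exact: poisson_integrable.
rewrite (_ : EFin \o _ = cst 0%E); first exact: integrable0.
by apply/funext.
Qed.

Lemma cpoisson_integral (u v : R) : 0 < v -> cint setT (fun x => (poisson u v x)%:C) = pi%:C.
Proof.
move=> v0; apply: complex_ext => /=.
  by rewrite /Rintegral poisson_integral.
by rewrite /Rintegral integral0_eq.
Qed.

Lemma poisson_split (x : R) w : 0 < im w ->
  ((x +i* 0)%C - w)^-1 - ((x +i* 0)%C - w^*%C)^-1 = 2 * 'i%C * (poisson (re w) (im w) x)%:C.
Proof.
move=> v0; have n1 := real_neq x (lt0r_neq0 v0).
have n2 : (x +i* 0)%C != w^*%C by apply: real_neq; rewrite im_conj oppr_eq0 lt0r_neq0.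
have E : ((x +i* 0)%C - w) * ((x +i* 0)%C - w^*%C) = ((x - re w) ^+ 2 + im w ^+ 2)%:C.
  by case: (w) => u v; apply: complex_ext => /=; ring.
have D : (x - re w) ^+ 2 + im w ^+ 2 != 0 by rewrite gt_eqF // poisson_den.
apply: (@mulIf _ ((x - re w) ^+ 2 + im w ^+ 2)%:C); first by rewrite fmorph_eq0.
rewrite -[RHS]mulrA -rmorphM /= /poisson divfK // -{1}E mulrBl mulKf ?subr_eq0 //.
rewrite [X in _ - _ * X]mulrC mulKf ?subr_eq0 //.
by case: (w) => u v; apply: complex_ext => /=; ring.
Qed.

Lemma halfplane_cauchy_outer F M w : uhol F -> hbounded F M -> 0 < im w ->
  cint setT (fun x => F (x +i* 0)%C * ((x +i* 0)%C - w^*%C)^-1) = 0.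
Proof.
move=> Fh FM v0; have M0 := hbounded_ge0 FM.
have nz z : 0 <= im z -> z != w^*%C.
  by move=> z0; apply: contraTneq z0 => ->; rewrite im_conj -ltNge oppr_lt0.
have Qh : uhol (fun z => F z * (z - w^*%C)^-1).
  move=> z z0; have /holo_hasd[a ha] := Fh z z0; have [b hb] := hasd_inv_sub (nz z z0).
  by apply/holo_hasd; eexists; exact: hasdM ha hb.
have w0 := cabs_ge0 w.
(* Beyond the radius 1 + 2 |w|, the distance of z to the conjugate of w is at least |z|/2. *)
have r1 : 1 <= 1 + 2 * cabs w by rewrite lerDl mulr_ge0.
have QF z : 0 <= im z -> 1 + 2 * cabs w <= cabs z -> cabs (F z * (z - w^*%C)^-1) <=
    2 * (cabs (F z) / cabs z + (cabs z ^+ 2)^-1).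
  move=> z0 zr; rewrite cabs_div.
  have h := ler_cabs_sub z w^*%C; rewrite cabs_conj in h.
  have d0 : 0 < cabs (z - w^*%C) by lra.
  have c0 : 0 < cabs z by lra.
  have k : (cabs (z - w^*%C))^-1 <= 2 * (cabs z)^-1.
    have -> : 2 * (cabs z)^-1 = (cabs z / 2)^-1 by rewrite invf_div.
    by rewrite lef_pV2 ?posrE ?divr_gt0 //; lra.
  have s0 : 0 < (cabs z ^+ 2)^-1 by rewrite invr_gt0 exprn_gt0.
  by have := ler_wpM2l (cabs_ge0 (F z)) k; lra.
have n0 : im w^*%C != 0 by rewrite im_conj oppr_eq0 lt0r_neq0.
have Qi := cauchy_line_integrable Fh FM n0.
exact: (halfplane_vanish Fh Qh FM M0 (ler0n _ 2) r1 QF Qi).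
Qed.

(** Subtracting from F the multiple k of the Cauchy kernel at the conjugate of w that matches F at w
    removes the pole, so [halfplane_vanish] applies to Q. On the real line the subtracted part is 2
    i F(w) times the Poisson kernel, of mass pi. *)
Lemma halfplane_cauchy F M w : uhol F -> hbounded F M -> 0 < im w ->
  cint setT (fun x => F (x +i* 0)%C * ((x +i* 0)%C - w)^-1) = 2 * 'i%C * pi%:C * F w.
Proof.
move=> Fh FM v0; have M0 := hbounded_ge0 FM.
have nz z : 0 <= im z -> z != w^*%C.
  by move=> z0; apply: contraTneq z0 => ->; rewrite im_conj -ltNge oppr_lt0.
pose k := F w * (w - w^*%C).
pose G z := F z - k * (z - w^*%C)^-1.
have Gh : uhol G.
  move=> z z0; have /holo_hasd[a ha] := Fh z z0; have [b hb] := hasd_inv_sub (nz z z0).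
  by apply/holo_hasd; eexists; exact: hasdB ha (hasdZ k hb).
have Gw : G w = 0 by rewrite /G /k mulfK ?subrr // subr_eq0 nz // ltW.
have win : inside (re w - 1) (re w + 1) (im w / 2) (2 * im w) w by apply/and4P; split; lra.
have [|Q [QE Qh]] := divdiff win (f := G).
  by move=> z /and4P[_ _ z1 _]; apply: Gh; lra.
have QE' z : z != w -> Q z = G z * (z - w)^-1.
  by move=> zw; rewrite [G z]QE Gw add0r mulfK // subr_eq0.
have rn x := real_neq x (lt0r_neq0 v0).
have QR x : Q (x +i* 0)%C = F (x +i* 0)%C * ((x +i* 0)%C - w)^-1 -
    (2 * 'i%C * F w) * (poisson (re w) (im w) x)%:C.
  rewrite QE' // /G mulrBl; congr (_ - _).
  have n2 : (x +i* 0)%C - w^*%C != 0 by rewrite subr_eq0 nz //= lexx.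
  have n1 : (x +i* 0)%C - w != 0 by rewrite subr_eq0.
  have -> : 2 * 'i%C * F w * (poisson (re w) (im w) x)%:C = F w * (2 * 'i%C * (poisson (re w) (im w) x)%:C) by ring.
  by rewrite -poisson_split // /k; field; rewrite n1 n2.
have i1 := cauchy_line_integrable Fh FM (lt0r_neq0 v0).
have i2 := cintegrableZ (2 * 'i%C * F w) measurableT (cpoisson_integrable (re w) v0).
have Qi : cintegrable setT (fun x => Q (x +i* 0)%C).
  by apply: eq_cintegrable (cintegrableB measurableT i1 i2) => // x _; rewrite QR.
(* For large z one has |Q| <= (|F| + 2 |k|/|z|) (2/|z|). *)
pose B := 2 + 4 * cabs k.
have k0 := cabs_ge0 k; have w0 := cabs_ge0 w.
have := @halfplane_vanish R F Q M B (1 + 2 * cabs w) Fh (fun z z0 => Qh z (Gh z z0)) FM M0.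
rewrite lerDl mulr_ge0 // => /(_ _ isT _ Qi) V.
have {}V : cint setT (fun x => Q (x +i* 0)%C) = 0.
  apply: V; first by rewrite /B; lra.
  move=> z z0 zr.
  have zw : z != w by apply: contraTneq zr => ->; rewrite -ltNge; lra.
  rewrite QE' // cabs_div.
  have h1 := ler_cabs_sub z w^*%C; rewrite cabs_conj in h1.
  have h2 := ler_cabs_sub z w.
  have c0 : 0 < cabs z by lra.
  have cV : 0 < (cabs z)^-1 by rewrite invr_gt0.
  have half (t : C) : cabs z / 2 <= cabs t -> (cabs t)^-1 <= 2 * (cabs z)^-1.
    move=> ht; have -> : 2 * (cabs z)^-1 = (cabs z / 2)^-1 by rewrite invf_div.
    by rewrite lef_pV2 ?posrE ?divr_gt0 // (lt_le_trans _ ht) // divr_gt0.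
  have g1 : (cabs (z - w))^-1 <= 2 * (cabs z)^-1 by apply: half; lra.
  have g2 : (cabs (z - w^*%C))^-1 <= 2 * (cabs z)^-1 by apply: half; lra.
  have g3 : cabs (G z) <= cabs (F z) + 2 * cabs k * (cabs z)^-1.
    apply: le_trans (ler_cabsB _ _) _; rewrite lerD2l cabs_div.
    by have := ler_wpM2l k0 g2; lra.
  apply: le_trans (ler_pM (cabs_ge0 _) _ g3 g1) _; first by rewrite invr_ge0 cabs_ge0.
  rewrite /B -exprVn; have F0 := cabs_ge0 (F z).
  have : 0 <= cabs (F z) * (cabs z)^-1 by rewrite mulr_ge0 // ltW.
  move=> /(mulr_ge0 k0); have := sqr_ge0 (cabs z)^-1.
  have := mulr_ge0 F0 (ltW cV); nra.
move: V; rewrite (@eq_cint _ _ _ _ (fun x _ => QR x)) cintB // cintZ //; last exact: cpoisson_integrable.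
rewrite cpoisson_integral // => /eqP; rewrite subr_eq0 => /eqP ->; ring.
Qed.

Lemma poisson_formula F M w : uhol F -> hbounded F M -> 0 < im w ->
  cint setT (fun x => F (x +i* 0)%C * (poisson (re w) (im w) x)%:C) = pi%:C * F w.
Proof.
move=> Fh FM v0; have n0 : im w^*%C != 0 by rewrite im_conj oppr_eq0 lt0r_neq0.
have i1 := cauchy_line_integrable Fh FM (lt0r_neq0 v0).
have i2 := cauchy_line_integrable Fh FM n0.
have i2' : (2 * 'i%C : C) != 0.
  by rewrite mulf_neq0 ?pnatr_eq0 //; apply/eqP => /(congr1 im) /eqP; rewrite /= oner_eq0.
apply: (mulfI i2'); rewrite [RHS](_ : _ = 2 * 'i%C * pi%:C * F w); last by ring.
rewrite -(halfplane_cauchy Fh FM v0) -[RHS]subr0 -(halfplane_cauchy_outer Fh FM v0) -cintB //.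
have E x : F (x +i* 0)%C * (poisson (re w) (im w) x)%:C =
    (2 * 'i%C)^-1 * (F (x +i* 0)%C * ((x +i* 0)%C - w)^-1 - F (x +i* 0)%C * ((x +i* 0)%C - w^*%C)^-1).
  by rewrite -mulrBr poisson_split // [RHS]mulrCA mulKf.
rewrite (@eq_cint _ _ _ _ (fun x _ => E x)) cintZ ?mulVKf //; exact: cintegrableB.
Qed.

Lemma poisson_le (u v x : R) : 0 < v -> poisson u v x <= v^-1.
Proof.
move=> v0; rewrite /poisson ler_pdivrMr ?poisson_den // mulrDr.
rewrite [X in _ <= _ + X](_ : _ = v); last by rewrite expr2 mulKf ?gt_eqF.
by rewrite lerDr mulr_ge0 ?sqr_ge0 // invr_ge0 ltW.
Qed.

Lemma poisson_sym (u v x : R) : poisson u v x = poisson x v u.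
Proof. by rewrite /poisson -(opprB u x) sqrrN. Qed.

(** Jensen's inequality for the Poisson kernel: [poisson_formula] is combined with 2 t |F| <= |F|^2
    + t^2 for t = |F(w)|. *)
Lemma poisson_jensen F M w : uhol F -> hbounded F M -> 0 < im w ->
  ((pi * cabs (F w) ^+ 2)%:E <=
   \int[mu]_x (cabs (F (x +i* 0)%C) ^+ 2 * poisson (re w) (im w) x)%:E)%E.
Proof.
move=> Fh FM v0; set P := poisson _ _; set t := cabs (F w).
have Fi := hline_integrable Fh FM (lexx 0).
have P0 x : 0 <= P x by exact: poisson_ge0.
have mP : measurable_fun setT P by exact: poisson_measurable.
have Pi : mu.-integrable setT (EFin \o P) by exact: poisson_integrable.
have pi0 : 0 < pi :> R := pi_gt0 R.
have gi : mu.-integrable setT (EFin \o (fun x => cabs (F (x +i* 0)%C) ^+ 2 * P x)).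
  apply: (integrableR_le _ _ (integrableR_Z (im w)^-1 measurableT Fi)) => //.
    by apply: measurable_funM => //; exact: uhol_sqr_measurable.
  move=> x _; rewrite ger0_norm; last first.
    by apply: mulr_ge0; [rewrite exprn_ge0 ?cabs_ge0|exact: P0].
  rewrite [leLHS]mulrC; by apply: ler_wpM2r; [rewrite exprn_ge0 ?cabs_ge0|exact: poisson_le].
rewrite integrable_integralE // lee_fin.
have ci : cintegrable setT (fun x => F (x +i* 0)%C * (P x)%:C).
  have [m1 m2] : cmeasurable (fun x => F (x +i* 0)%C * (P x)%:C).
    apply: cmeasurableM; first by apply: rcont_cmeasurable; exact: uhol_rcont.
    by split => //=; exact: measurable_cst.
  apply: (cintegrable_le measurableT m1 m2 (g := fun x => cabs (F (x +i* 0)%C) ^+ 2 * P x + P x)).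
    exact: integrableR_D.
  move=> x _; rewrite cabsM cabs_real ger0_norm // -[X in _ + X]mul1r -mulrDl.
  apply: ler_wpM2r => //; set a := cabs _; have := sqr_ge0 (a - 1); have := sqr_ge0 a; nra.
have h := cabs_cint_le measurableT ci; rewrite (poisson_formula Fh FM v0) cabsM cabs_real (gtr0_norm pi0) in h.
have ai := integrable_cabs measurableT ci.
have t0 : 0 <= t := cabs_ge0 _.
have h2 : 2 * t * (pi * t) <= Rintegral mu setT (fun x => cabs (F (x +i* 0)%C) ^+ 2 * P x) + t ^+ 2 * pi.
  apply: (@le_trans _ _ (2 * t * Rintegral mu setT (fun x => cabs (F (x +i* 0)%C * (P x)%:C)))).
    by apply: ler_wpM2l => //; rewrite mulr_ge0.
  have -> : pi = Rintegral mu setT P by rewrite /Rintegral poisson_integral.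
  rewrite -!RintegralZl // -RintegralD //; last exact: integrableR_Z.
  apply: le_Rintegral => //.
  - exact: integrableR_Z.
  - by apply: integrableR_D => //; exact: integrableR_Z.
  move=> x _; rewrite cabsM cabs_real ger0_norm // mulrA -mulrDl; apply: ler_wpM2r => //.
  set a := cabs _; have := sqr_ge0 (a - t); nra.
nra.
Qed.

(** The Poisson kernel is at most 1/Im w. This is the pointwise growth of order (Im w)^(-1/2) on
    which the bound for the logarithm rests. *)
Lemma hline_point F M w : uhol F -> hbounded F M -> 0 < im w ->
  ((pi * im w * cabs (F w) ^+ 2)%:E <= hline F 0)%E.
Proof.
move=> Fh FM v0; have Fi := hline_integrable Fh FM (lexx 0).
have H := poisson_jensen Fh FM v0.
have K : (\int[mu]_x (cabs (F (x +i* 0)%C) ^+ 2 * poisson (re w) (im w) x)%:E <=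
   \int[mu]_x ((im w)^-1 * cabs (F (x +i* 0)%C) ^+ 2)%:E)%E.
  apply: ge0_le_integralR => //.
  - by apply: measurable_funM; [exact: uhol_sqr_measurable|exact: poisson_measurable].
  - by apply: measurable_funM; [exact: measurable_cst|exact: uhol_sqr_measurable].
  - move=> x _; by apply: mulr_ge0; [rewrite exprn_ge0 ?cabs_ge0|exact: poisson_ge0].
  by move=> x _; rewrite [leLHS]mulrC; apply: ler_wpM2r; [rewrite exprn_ge0 ?cabs_ge0|exact: poisson_le].
have := le_trans H K; rewrite integrable_integralE //; last exact: integrableR_Z.
rewrite /hline integrable_integralE // !lee_fin RintegralZl //.
by rewrite [X in _ <= X -> _]mulrC ler_pdivlMr // => h; apply: le_trans h; rewrite mulrAC.
Qed.

(** Integrating [poisson_jensen] over the line and exchanging the integrals leaves a Poisson kernel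
    of mass pi, as the kernel is symmetric in x and u. An arbitrary common bound M is thereby
    sharpened to the norm on the axis. *)
Lemma hline_le F M (v : R) : uhol F -> hbounded F M -> 0 < v -> (hline F v <= hline F 0)%E.
Proof.
move=> Fh FM v0; have pi0 : 0 < pi :> R := pi_gt0 R.
pose g (u x : R) := pi^-1 * (cabs (F (x +i* 0)%C) ^+ 2 * poisson u v x).
have g0 u x : 0 <= g u x.
  apply: mulr_ge0; first by rewrite invr_ge0 ltW.
  by apply: mulr_ge0; [rewrite exprn_ge0 ?cabs_ge0|exact: poisson_ge0].
have mg : measurable_fun setT (fun s : R * R => g s.1 s.2).
  apply: measurable_funM; first exact: measurable_cst.
  apply: measurable_funM.
    apply: (measurableT_comp (f := fun x : R => cabs (F (x +i* 0)%C) ^+ 2)) => //.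
    exact: uhol_sqr_measurable.
  rewrite (_ : (fun s : R * R => _) = (poisson 0 v) \o (fun s : R * R => s.2 - s.1)).
    apply: measurableT_comp; first exact: poisson_measurable.
    by apply: measurable_funB; [exact: measurable_snd|exact: measurable_fst].
  by apply/funext => s; rewrite /poisson /= subr0.
apply: (@le_trans _ _ (\int[mu]_u \int[mu]_x (g u x)%:E)%E).
  rewrite /hline; apply: ge0_le_integral => //.
  - by move=> u _; rewrite lee_fin exprn_ge0 ?cabs_ge0.
  - apply/measurable_EFinP; apply: uhol_sqr_measurable => //; exact: ltW.
  - apply: (@measurable_fun_fubini_tonelli_F _ _ _ _ _ mu (fun s => (g s.1 s.2)%:E)).
      exact/measurable_EFinP.
    by move=> s; rewrite lee_fin.
  move=> u _; have := @poisson_jensen F M (u +i* v)%C Fh FM v0.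
  rewrite [re _]/= [im _]/= => H.
  under eq_integral => x _ do rewrite EFinM.
  rewrite ge0_integralZl //; last first.
  - by rewrite lee_fin invr_ge0 ltW.
  - move=> x _; rewrite lee_fin; by apply: mulr_ge0; [rewrite exprn_ge0 ?cabs_ge0|exact: poisson_ge0].
  - apply/measurable_EFinP; apply: measurable_funM; last exact: poisson_measurable.
    exact: uhol_sqr_measurable.
  have := @lee_pmul2l R (pi^-1)%:E isT; rewrite lte_fin invr_gt0 pi0 => /(_ isT) L.
  apply: le_trans (_ : ((pi^-1)%:E * (pi * cabs (F (u +i* v)%C) ^+ 2)%:E <= _)%E); last by rewrite L.
  by rewrite -EFinM mulKf ?gt_eqF.
rewrite tonelliR // /hline; apply: ge0_le_integral => //.
- by move=> x _; apply: integral_ge0 => u _; rewrite lee_fin.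
- apply: (@measurable_fun_fubini_tonelli_G _ _ _ _ _ mu (fun s => (g s.1 s.2)%:E)).
    exact/measurable_EFinP.
  by move=> s; rewrite lee_fin.
- by apply/measurable_EFinP; exact: uhol_sqr_measurable.
move=> x _.
have E u : (g u x)%:E = ((pi^-1 * cabs (F (x +i* 0)%C) ^+ 2)%:E * (poisson x v u)%:E)%E.
  by rewrite -EFinM /g (poisson_sym u v x) mulrA.
under eq_integral => u _ do rewrite E.
rewrite ge0_integralZl //.
- by rewrite poisson_integral // -EFinM lee_fin mulrAC mulVf ?mul1r // gt_eqF.
- by apply/measurable_EFinP; exact: poisson_measurable.
- by move=> u _; rewrite lee_fin poisson_ge0.
- by rewrite lee_fin mulr_ge0 ?exprn_ge0 ?cabs_ge0 // invr_ge0 ltW.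
Qed.

Lemma hardy2P F : hardy2 F -> exists2 M : R, 0 <= M &
  (forall z, 0 < im z -> holomorphic_at F z) /\ (forall y, 0 < y -> (hline F y <= M%:E)%E).
Proof.
case=> Fh; set s := ereal_sup _ => s1.
have H y : 0 < y -> (hline F y <= s)%E.
  by move=> y0; apply: ereal_sup_ubound; exists y => //=; rewrite in_itv /= y0.
have s0 : (0 <= s)%E.
  apply: le_trans (H 1 ltr01); apply: integral_ge0 => x _.
  by rewrite lee_fin exprn_ge0 ?cabs_ge0.
exists (fine s); first exact: fine_ge0.
by split => // y y0; rewrite fineK ?H // ge0_fin_numE.
Qed.

Lemma hardy2I F (M : R) : (forall z, 0 < im z -> holomorphic_at F z) ->
  (forall y, 0 < y -> (hline F y <= M%:E)%E) -> hardy2 F.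
Proof.
move=> Fh FM; split => //; apply: (@le_lt_trans _ _ M%:E); last exact: ltry.
by apply: ge_ereal_sup => z [y /=]; rewrite in_itv /= andbT => y0 <-; exact: FM.
Qed.

(** F lives on the open half-plane, so [hline_point] is applied to F shifted by i Im w/2, which
    costs the factor 2. This version applies even while E may have real zeros. *)
Lemma hardy2_point F (M : R) w : (forall z, 0 < im z -> holomorphic_at F z) ->
  (forall y, 0 < y -> (hline F y <= M%:E)%E) -> 0 < im w ->
  pi * im w * cabs (F w) ^+ 2 <= 2 * M.
Proof.
move=> Fh FM v0; pose e := im w / 2; have e0 : 0 < e by rewrite divr_gt0.
pose G z := F (z + (0 +i* e)%C).
have Gh : uhol G.
  move=> z z0; have /holo_hasd[d h] : holomorphic_at F (z + (0 +i* e)%C).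
    by apply: Fh; rewrite im_add /= ltr_wpDl.
  apply/holo_hasd; eexists; exact: hasd_comp (hasdD (hasd_id z) (hasd_cst _ z)) h.
have GM : hbounded G M.
  move=> y y0; rewrite (_ : hline G y = hline F (y + e)); first by apply: FM; rewrite ltr_wpDl.
  apply: eq_integral => x _; congr ((cabs (F _) ^+ 2)%:E).
  by apply: complex_ext => /=; ring.
have w2 : 0 < im (re w +i* e)%C by [].
have := le_trans (hline_point Gh GM w2) (GM 0 (lexx _)); rewrite lee_fin.
rewrite /G (_ : (re w +i* e)%C + (0 +i* e)%C = w); last first.
  by rewrite -[RHS]complex_eta; apply: complex_ext; rewrite /= ?addr0 // /e; field.
by rewrite /= /e; lra.
Qed.

End HardyBounds.

(** * Reproducing kernel Hilbert spaces *)

Section ReproducingKernel.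
Context {R : realType}.
Local Notation C := R[i].
Local Notation re := (@complex.Re R).
Local Notation im := (@complex.Im R).
Implicit Types (f g h m : C -> C) (H M : set (C -> C)) (ip : (C -> C) -> (C -> C) -> C).

Definition fadd f g : C -> C := fun z => f z + g z.
Definition fscale (c : C) f : C -> C := fun z => c * f z.
Definition fsub f g : C -> C := fun z => f z - g z.

Lemma sqr_cabsD (x y : C) : cabs (x + y) ^+ 2 <= 2 * (cabs x ^+ 2 + cabs y ^+ 2).
Proof.
have h := ler_cabsD x y; have : cabs (x + y) ^+ 2 <= (cabs x + cabs y) ^+ 2.
  by apply: lerXn2r; rewrite ?nnegrE ?addr_ge0 ?cabs_ge0.
have := sqr_ge0 (cabs x - cabs y); nra.
Qed.

Lemma sqr_cabs_tri (a b c : C) :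
  cabs (b - c) ^+ 2 <= 2 * (cabs (a - b) ^+ 2 + cabs (a - c) ^+ 2).
Proof.
by rewrite -(cabsN (a - b)) (_ : b - c = - (a - b) + (a - c)) ?sqr_cabsD //; ring.
Qed.

(** The form is semidefinite; definiteness comes from [eval_bounded], by which a function of norm 0
    vanishes at every point. *)
Record prehilbert H ip : Prop := Prehilbert {
  ph_lin : linear_subspace H;
  ph_add : forall f g h, H f -> H g -> H h -> ip (fadd f g) h = ip f h + ip g h;
  ph_scale : forall c f h, H f -> H h -> ip (fscale c f) h = c * ip f h;
  ph_conj : forall f g, H f -> H g -> ip g f = (ip f g)^*%C;
  ph_ge0 : forall f, H f -> 0 <= re (ip f f) }.

Definition nsq ip f : R := re (ip f f).

Definition hcomplete ip M := forall u : nat -> C -> C, (forall n, M (u n)) ->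
  (forall e : R, 0 < e -> exists N, forall n k, (N <= n)%N -> (N <= k)%N ->
     nsq ip (fsub (u n) (u k)) <= e) ->
  exists2 f, M f & forall e : R, 0 < e -> exists N, forall n, (N <= n)%N ->
     nsq ip (fsub (u n) f) <= e.

Definition eval_bounded ip H := forall w : C, exists2 c : R, 0 <= c &
  forall f, H f -> cabs (f w) ^+ 2 <= c * nsq ip f.

Lemma lin_sub H f g : linear_subspace H -> H f -> H g -> H (fsub f g).
Proof.
move=> [_ HD HZ] Hf Hg; have := HD _ _ Hf (HZ (-1) _ Hg).
by congr H; apply/funext => z; rewrite /fsub mulN1r.
Qed.

Section Pre.
Variables (H : set (C -> C)) (ip : (C -> C) -> (C -> C) -> C).
Hypothesis PH : prehilbert H ip.

Let Hlin := ph_lin PH.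
Let H0 : H (fun=> 0). Proof. by case: Hlin. Qed.
Let HD f g : H f -> H g -> H (fadd f g). Proof. by case: Hlin => _ h _; exact: h. Qed.
Let HZ c f : H f -> H (fscale c f). Proof. by case: Hlin => _ _; exact. Qed.
Let HB f g : H f -> H g -> H (fsub f g). Proof. exact: lin_sub. Qed.

Lemma fsubE f g : fsub f g = fadd f (fscale (-1) g).
Proof. by apply/funext => z; rewrite /fsub /fadd /fscale mulN1r. Qed.

Lemma ipBl f g h : H f -> H g -> H h -> ip (fsub f g) h = ip f h - ip g h.
Proof.
by move=> *; rewrite fsubE (ph_add PH) ?(ph_scale PH) ?mulN1r //; exact: HZ.
Qed.

Lemma ipDr f g h : H f -> H g -> H h -> ip h (fadd f g) = ip h f + ip h g.
Proof.
move=> Hf Hg Hh; rewrite (ph_conj PH _ Hh); last exact: HD.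
by rewrite (ph_add PH) // conjcD -!(ph_conj PH).
Qed.

Lemma ipZr c f h : H f -> H h -> ip h (fscale c f) = c^*%C * ip h f.
Proof.
move=> Hf Hh; rewrite (ph_conj PH _ Hh); last exact: HZ.
by rewrite (ph_scale PH) // conjcM -!(ph_conj PH).
Qed.

Lemma ipBr f g h : H f -> H g -> H h -> ip h (fsub f g) = ip h f - ip h g.
Proof.
move=> Hf Hg Hh; rewrite (ph_conj PH _ Hh); last exact: HB.
by rewrite ipBl // conjcB -!(ph_conj PH).
Qed.

Lemma nsqB f g : H f -> H g -> nsq ip (fsub f g) = nsq ip f + nsq ip g - 2 * re (ip f g).
Proof.
move=> Hf Hg; rewrite /nsq ipBl ?ipBr //; try exact: HB.
by rewrite (ph_conj PH Hf Hg) !(re_add, re_opp, re_conj); ring.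
Qed.

Lemma nsqZ c f : H f -> nsq ip (fscale c f) = cabs c ^+ 2 * nsq ip f.
Proof.
move=> Hf; rewrite /nsq (ph_scale PH) ?ipZr //; last exact: HZ.
by rewrite mulrA mulc_conj re_mul /= mul0r subr0.
Qed.

Lemma nsqD f g : H f -> H g -> nsq ip (fadd f g) = nsq ip f + nsq ip g + 2 * re (ip f g).
Proof.
move=> Hf Hg; rewrite /nsq (ph_add PH) ?ipDr //; try exact: HD.
by rewrite (ph_conj PH Hf Hg) !(re_add, re_conj); ring.
Qed.

Lemma nsq_ge0 f : H f -> 0 <= nsq ip f. Proof. exact: ph_ge0. Qed.

(* Take c = ip f g / (nsq g + 1). *)
Lemma almost_orthogonal f g (e : R) : H f -> H g ->
  (forall c, nsq ip f - e <= nsq ip (fsub f (fscale c g))) ->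
  cabs (ip f g) ^+ 2 <= e * (nsq ip g + 1).
Proof.
move=> Hf Hg Hc; pose K := nsq ip g + 1.
have g0 := nsq_ge0 Hg.
have K0 : 0 < K by rewrite /K; lra.
have := Hc (K^-1%:C * ip f g); rewrite nsqB ?nsqZ //; last exact: HZ.
rewrite ipZr // conjcM conjc_real -mulrA [_^*%C * _]mulrC mulc_conj cabsM cabs_real.
rewrite re_mul /= mul0r subr0 ger0_norm; last by rewrite invr_ge0 ltW.
set s := cabs (ip f g) ^+ 2; have s0 : 0 <= s by rewrite /s exprn_ge0 ?cabs_ge0.
rewrite exprMn -/s -/K => h.
have h2 : 2 * (K^-1 * s) - K^-1 ^+ 2 * s * nsq ip g <= e by lra.
have h3 : K^-1 ^+ 2 * s * nsq ip g <= K^-1 * s.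
  have -> : K^-1 * s = K^-1 ^+ 2 * s * K by field; rewrite gt_eqF.
  by apply: ler_wpM2l; [rewrite mulr_ge0 // exprn_ge0 // invr_ge0 ltW|rewrite /K; lra].
have : K^-1 * s <= e by lra.
by rewrite mulrC ler_pdivrMr.
Qed.

(** The summand 1 keeps the divisor of [almost_orthogonal] positive when g has norm 0. The
    inequality still gives continuity of the form and the orthogonality of null vectors. *)
Lemma weak_cauchy_schwarz f g : H f -> H g ->
  cabs (ip f g) ^+ 2 <= nsq ip f * (nsq ip g + 1).
Proof.
move=> Hf Hg; apply: almost_orthogonal => // c; rewrite subrr.
by apply: nsq_ge0; apply: HB => //; exact: HZ.
Qed.

(** A minimizing sequence is Cauchy by the parallelogram law. Its members are almost orthogonal to M
    from f, by [almost_orthogonal], and orthogonality follows in the limit. *)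
Lemma projection M f : M `<=` H -> linear_subspace M -> hcomplete ip M -> H f ->
  exists2 p, M p & forall m, M m -> ip (fsub f p) m = 0.
Proof.
move=> MH Ml Mc Hf; have [M0 MD MZ] := Ml.
pose S := [set nsq ip (fsub f m) | m in M].
have Slb : has_lbound S by exists 0 => _ [m Mm <-]; apply: nsq_ge0; apply: HB => //; exact: MH.
have Sinf : has_inf S by split=> //; exists (nsq ip (fsub f (fun=> 0))), (fun=> 0).
pose d := inf S.
have dle m : M m -> d <= nsq ip (fsub f m) by move=> Mm; apply: ge_inf => //; exists m.
have ex n : exists m, M m /\ nsq ip (fsub f m) < d + n.+1%:R^-1.
  have n0 : 0 < n.+1%:R^-1 :> R by rewrite invr_gt0.
  have [_ [m Mm <-] h] := inf_adherent n0 Sinf.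
  by exists m.
have [u Hu] := choice ex.
have uM n : M (u n) by case: (Hu n).
have und n : nsq ip (fsub f (u n)) <= d + n.+1%:R^-1 by case: (Hu n) => _ /ltW.
have uH n : H (u n) by exact: MH.
have small (e : R) : 0 < e -> exists N, forall n, (N <= n)%N -> n.+1%:R^-1 <= e.
  move=> e0; exists (Num.truncn e^-1) => n Nn.
  rewrite -[e]invrK lef_pV2 ?posrE ?invr_gt0 //.
  by apply: ltW; apply: lt_le_trans (truncnS_gt _) _; rewrite ler_nat.
have cauchy e : 0 < e -> exists N, forall n k, (N <= n)%N -> (N <= k)%N ->
    nsq ip (fsub (u n) (u k)) <= e.
  move=> e0; have [N HN] := small (e / 4) (divr_gt0 e0 (ltr0n _ 4)).
  exists N => n k Nn Nk.
  pose a := fsub f (u n); pose b := fsub f (u k).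
  have Ha : H a by exact: HB.
  have Hb : H b by exact: HB.
  have Eab : fsub (u n) (u k) = fsub b a by apply/funext => z; rewrite /a /b /fsub; ring.
  (* The midpoint lies in M, so its squared distance to f is at least d, and the parallelogram law
     bounds nsq(u n - u k) by 4 (d + e/4) - 4 d = e. *)
  pose mid := fscale (2^-1) (fadd (u n) (u k)).
  have Mmid : M mid by apply: MZ; exact: MD.
  have Emid : fadd b a = fscale 2 (fsub f mid).
    by apply/funext => z; rewrite /fadd /fscale /mid /a /b /fsub /fscale /fadd; field.
  have c2 : cabs (2 : C) = 2 by have := cabs_real (2 : R); rewrite normr_nat rmorphMn.
  have an : nsq ip a <= d + e / 4 by apply: le_trans (und n) _; rewrite lerD2l HN.
  have bn : nsq ip b <= d + e / 4 by apply: le_trans (und k) _; rewrite lerD2l HN.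
  have p1 := nsqD Hb Ha; have p2 := nsqB Hb Ha; have p3 := dle _ Mmid.
  rewrite Emid nsqZ ?c2 in p1; last by apply: HB => //; exact: MH.
  by rewrite Eab; lra.
have [p Mp pl] := Mc u uM cauchy.
exists p => // m Mm; have Hm := MH _ Mm; have Hp := MH _ Mp.
have m0 := nsq_ge0 Hm.
apply/eqP; rewrite -cabs_eq0 -sqrf_eq0 eq_le sqr_ge0 andbT leNgt; apply/negP.
set s := cabs _ ^+ 2 => s0.
(* Each of the two errors is then at most s/8, so s <= 2 (s/8 + s/8), which contradicts s > 0. *)
pose K := 4 * (nsq ip m + 1); have K0 : 0 < K by rewrite /K; lra.
have sk : 0 < s / (2 * K) by rewrite divr_gt0 // mulr_gt0.
have [N1 H1] := small _ sk; have [N2 H2] := pl _ sk.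
pose n := maxn N1 N2.
have h1 := H1 n (leq_maxl _ _); have h2 := H2 n (leq_maxr _ _).
have a1 : cabs (ip (fsub f (u n)) m) ^+ 2 <= n.+1%:R^-1 * (nsq ip m + 1).
  apply: almost_orthogonal => //; first exact: HB.
  move=> c; have := dle (fadd (u n) (fscale c m)) (MD _ _ (uM n) (MZ c _ Mm)).
  have -> : fsub f (fadd (u n) (fscale c m)) = fsub (fsub f (u n)) (fscale c m).
    by apply/funext => z; rewrite /fsub /fadd; ring.
  by move=> h; rewrite lerBlDr; apply: le_trans (und n) _; rewrite lerD2r.
have a2 := weak_cauchy_schwarz (HB (uH n) Hp) Hm.
have E : ip (fsub f p) m = ip (fsub f (u n)) m + ip (fsub (u n) p) m.
  by rewrite !ipBl //; ring.
have sE : s <= 2 * (cabs (ip (fsub f (u n)) m) ^+ 2 + cabs (ip (fsub (u n) p) m) ^+ 2).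
  by rewrite /s E; exact: sqr_cabsD.
have m1 : 0 < nsq ip m + 1 by lra.
have b1 : n.+1%:R^-1 * (nsq ip m + 1) <= s / (2 * K) * (nsq ip m + 1) by rewrite ler_pM2r.
have b2 : nsq ip (fsub (u n) p) * (nsq ip m + 1) <= s / (2 * K) * (nsq ip m + 1) by rewrite ler_pM2r.
have KE : s / (2 * K) * (nsq ip m + 1) = s / 8 by rewrite /K; field; rewrite gt_eqF.
rewrite KE in b1 b2.
have {}a1 := le_trans a1 b1; have {}a2 : cabs (ip (fsub (u n) p) m) ^+ 2 <= s / 8.
  exact: le_trans a2 b2.
lra.
Qed.

Lemma eval_limit (u : nat -> C -> C) f w : eval_bounded ip H -> (forall n, H (u n)) -> H f ->
  (forall e : R, 0 < e -> exists N, forall n, (N <= n)%N -> nsq ip (fsub (u n) f) <= e) ->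
  forall e : R, 0 < e -> exists N, forall n, (N <= n)%N -> cabs (u n w - f w) ^+ 2 <= e.
Proof.
move=> Hev Hu Hf ul e e0; have [c c0 Hc] := Hev w.
have c1 : 0 < c + 1 by lra.
have [N HN] := ul _ (divr_gt0 e0 c1); exists N => n Nn.
have Hd := HB (Hu n) Hf.
apply: le_trans (Hc _ Hd) _; have := HN n Nn; rewrite ler_pdivlMr //.
have := nsq_ge0 Hd; nra.
Qed.

(** The functions vanishing at w form a complete subspace of codimension at most 1. A vector g
    orthogonal to it, suitably scaled, represents the evaluation; if all functions vanish at w, the
    kernel is 0. *)
Lemma riesz_eval w : hcomplete ip H -> eval_bounded ip H ->
  exists2 K, H K & forall f, H f -> f w = ip f K.
Proof.
move=> Hc Hev; have [[f0 [Hf0 f00]]|nf] := pselect (exists f, H f /\ f w != 0); last first.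
  exists (fun=> 0) => // f Hf.
  have -> : f w = 0 by apply: contrapT => /eqP fw; apply: nf; exists f.
  have E : (fun=> 0 : C) = fscale 0 f by apply/funext => z; rewrite /fscale mul0r.
  by rewrite E ipZr // conjc0 mul0r.
pose M : set (C -> C) := [set h | H h /\ h w = 0].
have Ml : linear_subspace M.
  split; first by split.
    by move=> f g [Hf fw] [Hg gw]; split; [exact: HD|rewrite fw gw addr0].
  by move=> c f [Hf fw]; split; [exact: HZ|rewrite fw mulr0].
have Mc : hcomplete ip M.
  move=> u uM ucau; have [f Hf fl] := Hc u (fun n => proj1 (uM n)) ucau.
  exists f => //; split=> //.
  apply/eqP; rewrite -cabs_eq0 -sqrf_eq0 eq_le sqr_ge0 andbT leNgt; apply/negP => s0.
  have [N HN] := eval_limit w Hev (fun n => proj1 (uM n)) Hf fl (divr_gt0 s0 (ltr0n _ 2)).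
  have := HN N (leqnn N); rewrite (proj2 (uM N)) sub0r cabsN; lra.
have MH : M `<=` H by move=> f [].
have [p [Hp pw] porth] := projection MH Ml Mc Hf0.
pose g := fsub f0 p; have Hg : H g by exact: HB.
have gw : g w = f0 w by rewrite /g /fsub pw subr0.
have gw0 : g w != 0 by rewrite gw.
have [c c0 Hcc] := Hev w.
have n0 : nsq ip g != 0.
  apply/eqP => n0; have := Hcc g Hg; rewrite n0 mulr0 => h.
  by move: gw0; rewrite -cabs_gt0 => /(exprn_gt0 2); lra.
have ggE : ip g g = (nsq ip g)%:C.
  apply: complex_ext => //=; have /(congr1 im) := ph_conj PH Hg Hg.
  by rewrite im_conj /nsq => h; lra.
exists (fscale ((g w)^*%C / (nsq ip g)%:C) g); first exact: HZ.
move=> f Hf; rewrite ipZr // conjcM conjcK conjc_inv conjc_real.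
pose h := fsub f (fscale (f w / g w) g).
have Mh : M h.
  split; first by apply: HB => //; exact: HZ.
  by rewrite /h /fsub /fscale divfK // subrr.
have := porth h Mh; rewrite -/g => E.
have : ip h g = 0 by rewrite (ph_conj PH Hg (MH _ Mh)) E conjc0.
rewrite /h ipBl ?(ph_scale PH) //; last exact: HZ.
move=> /eqP; rewrite subr_eq0 => /eqP ->; rewrite ggE; field.
by rewrite gw0 fmorph_eq0 n0.
Qed.

End Pre.

(* M is the set of common elements on which the two inner products agree; it is
   complete and contains the kernels. *)
Lemma same_kernel_sub H1 ip1 H2 ip2 (S : set C) (K : C -> C -> C) :
  prehilbert H1 ip1 -> prehilbert H2 ip2 -> hcomplete ip1 H1 -> hcomplete ip2 H2 ->
  eval_bounded ip1 H1 -> eval_bounded ip2 H2 ->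
  (forall w, S w -> H1 (K w) /\ H2 (K w)) ->
  (forall w f, S w -> H1 f -> f w = ip1 f (K w)) ->
  (forall w f, S w -> H2 f -> f w = ip2 f (K w)) ->
  (forall f, H1 f -> (forall w, S w -> f w = 0) -> forall w, f w = 0) ->
  H1 `<=` H2.
Proof.
move=> P1 P2 C1 C2 E1 E2 KH K1 K2 S1.
pose M : set (C -> C) := [set f | [/\ H1 f, H2 f & forall g, H1 g -> H2 g -> ip1 f g = ip2 f g]].
have [z1 d1 s1] := ph_lin P1; have [z2 d2 s2] := ph_lin P2.
have MH : M `<=` H1 by move=> f [].
have Ml : linear_subspace M.
  split.
  - split=> // g g1 g2; have -> : (fun=> 0 : C) = fscale 0 g.
      by apply/funext => z; rewrite /fscale mul0r.
    by rewrite (ph_scale P1) ?(ph_scale P2) // !mul0r.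
  - move=> f g [f1 f2 fe] [g1 g2 ge]; split; [exact: d1|exact: d2|move=> h h1 h2].
    by rewrite -[fun z => _]/(fadd f g) (ph_add P1) ?(ph_add P2) // fe // ge.
  - move=> c f [f1 f2 fe]; split; [exact: s1|exact: s2|move=> h h1 h2].
    by rewrite -[fun z => _]/(fscale c f) (ph_scale P1) ?(ph_scale P2) // fe.
have Mc : hcomplete ip1 M.
  move=> u uM ucau.
  have u1 n : H1 (u n) by case: (uM n).
  have u2 n : H2 (u n) by case: (uM n).
  have nE n k : nsq ip1 (fsub (u n) (u k)) = nsq ip2 (fsub (u n) (u k)).
    have [a1 a2 ae] : M (fsub (u n) (u k)) by apply: lin_sub.
    by rewrite /nsq ae.
  have [f f1 fl1] := C1 u u1 ucau.
  have [|f' f2 fl2] := C2 u u2.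
    by move=> e /ucau[N HN]; exists N => n k Nn Nk; rewrite -nE HN.
  (* The limits for the two norms agree, because evaluation at each point is continuous for both. *)
  have ff : f = f'.
    apply/funext => w; apply/eqP; rewrite -subr_eq0 -cabs_eq0 -sqrf_eq0 eq_le sqr_ge0 andbT leNgt.
    apply/negP; set s := cabs _ ^+ 2 => s0; have s8 : 0 < s / 8 by rewrite divr_gt0.
    have [N1 h1] := eval_limit P1 w E1 u1 f1 fl1 s8.
    have [N2 h2] := eval_limit P2 w E2 u2 f2 fl2 s8.
    have {}h1 := h1 (maxn N1 N2) (leq_maxl _ _); have {}h2 := h2 (maxn N1 N2) (leq_maxr _ _).
    have : s <= 2 * (cabs (u (maxn N1 N2) w - f w) ^+ 2 + cabs (u (maxn N1 N2) w - f' w) ^+ 2).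
      exact: sqr_cabs_tri.
    lra.
  rewrite -ff in f2 fl2; exists f => //; split=> // g g1 g2.
  apply/eqP; rewrite -subr_eq0 -cabs_eq0 -sqrf_eq0 eq_le sqr_ge0 andbT leNgt.
  apply/negP; set s := cabs _ ^+ 2 => s0.
  have n1 := nsq_ge0 P1 g1; have n2 := nsq_ge0 P2 g2.
  pose k := 8 * (nsq ip1 g + nsq ip2 g + 1).
  have k0 : 0 < k by rewrite /k; lra.
  have sk : 0 < s / k by rewrite divr_gt0.
  have [N1 h1] := fl1 _ sk; have [N2 h2] := fl2 _ sk.
  pose n := maxn N1 N2.
  have {}h1 := h1 n (leq_maxl _ _); have {}h2 := h2 n (leq_maxr _ _).
  have a1 := weak_cauchy_schwarz P1 (lin_sub (ph_lin P1) (u1 n) f1) g1.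
  have a2 := weak_cauchy_schwarz P2 (lin_sub (ph_lin P2) (u2 n) f2) g2.
  rewrite (ipBl P1) // in a1; rewrite (ipBl P2) // in a2.
  have [_ _ ue] := uM n; rewrite -(ue g g1 g2) in a2.
  have : s <= 2 * (cabs (ip1 (u n) g - ip1 f g) ^+ 2 + cabs (ip1 (u n) g - ip2 f g) ^+ 2).
    exact: sqr_cabs_tri.
  have b1 : nsq ip1 (fsub (u n) f) * (nsq ip1 g + 1) <= s / k * (nsq ip1 g + 1).
    by rewrite ler_wpM2r //; lra.
  have b2 : nsq ip2 (fsub (u n) f) * (nsq ip2 g + 1) <= s / k * (nsq ip2 g + 1).
    by rewrite ler_wpM2r //; lra.
  have kE : s / k * (nsq ip1 g + nsq ip2 g + 1) = s / 8 by rewrite /k; field; rewrite gt_eqF //; lra.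
  have m1 : s / k * (nsq ip1 g + 1) <= s / 8 by rewrite -kE ler_pM2l //; lra.
  have m2 : s / k * (nsq ip2 g + 1) <= s / 8 by rewrite -kE ler_pM2l //; lra.
  lra.
have KM w : S w -> M (K w).
  move=> Sw; have [k1 k2] := KH w Sw; split=> // g g1 g2.
  by rewrite (ph_conj P1 g1 k1) (ph_conj P2 g2 k2) -(K1 w g) // -(K2 w g).
move=> f f1; have [p Mp porth] := projection P1 MH Ml Mc f1.
have p1 := MH _ Mp.
(* The difference is orthogonal to the kernels, hence vanishes on [S], hence everywhere. *)
have fp : f = p.
  apply/funext => w; apply/eqP; rewrite -subr_eq0; apply/eqP.
  apply: (S1 (fsub f p)); first exact: lin_sub (ph_lin P1) f1 p1.
  by move=> v Sv; rewrite (K1 v) //; [apply: porth; exact: KM|exact: lin_sub (ph_lin P1) f1 p1].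
by rewrite fp; case: Mp.
Qed.

End ReproducingKernel.

(** * The de Branges space of a function without real zeros *)

Section DeBrangesSpace.
Context {R : realType}.
Local Notation C := R[i].
Local Notation re := (@complex.Re R).
Local Notation im := (@complex.Im R).
Local Notation mu := (@lebesgue_measure R).
Implicit Types (f g F G : C -> C) (w z : C).

Lemma fstarK f : fstar (fstar f) = f.
Proof. by apply/funext => z; rewrite /fstar !conjcK. Qed.

Lemma fstar_real f (x : R) : fstar f x%:C = (f x%:C)^*%C.
Proof. by rewrite /fstar conjc_real. Qed.

Lemma holo_star f z : holomorphic_at f z^*%C -> holomorphic_at (fstar f) z.
Proof. by move=> /holo_hasd[d hd]; apply/holo_hasd; eexists; exact: hasd_star hd. Qed.

Lemma entire_star f : entire f -> entire (fstar f).
Proof. by move=> fh z; exact: holo_star. Qed.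

Lemma holoD f g z : holomorphic_at f z -> holomorphic_at g z ->
  holomorphic_at (fun v => f v + g v) z.
Proof. by move=> /holo_hasd[a ha] /holo_hasd[b hb]; apply/holo_hasd; eexists; exact: hasdD ha hb. Qed.

Lemma holoM f g z : holomorphic_at f z -> holomorphic_at g z ->
  holomorphic_at (fun v => f v * g v) z.
Proof. by move=> /holo_hasd[a ha] /holo_hasd[b hb]; apply/holo_hasd; eexists; exact: hasdM ha hb. Qed.

Lemma holo_cst (c : C) z : holomorphic_at (fun=> c) z.
Proof. by apply/holo_hasd; eexists; exact: hasd_cst. Qed.

Lemma holo_id z : holomorphic_at (fun v : C => v) z.
Proof. by apply/holo_hasd; eexists; exact: hasd_id. Qed.

Lemma holoV f z : holomorphic_at f z -> f z != 0 -> holomorphic_at (fun v => (f v)^-1) z.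
Proof. by move=> /holo_hasd[a ha] n; apply/holo_hasd; eexists; exact: hasdV ha n. Qed.

Lemma holo_cexp f z : holomorphic_at f z -> holomorphic_at (fun v => cexp (f v)) z.
Proof. by move=> /holo_hasd[a ha]; apply/holo_hasd; eexists; exact: hasd_comp ha (hasd_cexp _). Qed.

Lemma holo_ccont f z : holomorphic_at f z -> ccont f z.
Proof. by move=> /holo_hasd[a ha]; exact: hasd_ccont ha. Qed.

Lemma hboundedD F G (M N : R) : uhol F -> uhol G -> hbounded F M -> hbounded G N ->
  hbounded (fun z => F z + G z) (2 * (M + N)).
Proof.
move=> Fh Gh FM GN y y0.
have hF := uhol_sqr_measurable Fh y0; have hG := uhol_sqr_measurable Gh y0.
have Sh : uhol (fun z => F z + G z) by move=> z z0; apply: holoD; [exact: Fh|exact: Gh].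
have hS := uhol_sqr_measurable Sh y0.
have iF := hline_integrable Fh FM y0; have iG := hline_integrable Gh GN y0.
have i2 : mu.-integrable setT (EFin \o (fun x : R => cabs (F (x +i* y)%C) ^+ 2 + cabs (G (x +i* y)%C) ^+ 2)).
  exact: integrableR_D.
apply: (@le_trans _ _ (\int[mu]_x (2 * (cabs (F (x +i* y)%C) ^+ 2 + cabs (G (x +i* y)%C) ^+ 2))%:E)%E).
  apply: ge0_le_integralR => //.
  - by apply: measurable_funM; [exact: measurable_cst|exact: measurable_funD].
  - by move=> x _; rewrite exprn_ge0 ?cabs_ge0.
  - by move=> x _; exact: sqr_cabsD.
rewrite integrable_integralE //; last exact: integrableR_Z.
rewrite lee_fin RintegralZl // RintegralD //.
apply: ler_wpM2l => //; have := FM y y0; have := GN y y0.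
by rewrite /hline !integrable_integralE // !lee_fin => a b; rewrite lerD.
Qed.

Lemma hboundedZ F (c : C) (M : R) : uhol F -> hbounded F M ->
  hbounded (fun z => c * F z) (cabs c ^+ 2 * M).
Proof.
move=> Fh FM y y0; rewrite /hline.
under eq_integral => x _ do rewrite cabsM exprMn.
have iF := hline_integrable Fh FM y0.
rewrite integrable_integralE //; last exact: integrableR_Z.
rewrite lee_fin RintegralZl //; apply: ler_wpM2l; first by rewrite exprn_ge0 ?cabs_ge0.
by have := FM y y0; rewrite /hline integrable_integralE // lee_fin.
Qed.

Lemma hbounded_cauchy F (w : C) (c : R) : uhol F -> im w < 0 -> 0 <= c ->
  (forall z, 0 <= im z -> cabs (F z) * cabs (z - w) <= c) ->
  hbounded F (c ^+ 2 * (pi * (- im w)^-1)).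
Proof.
move=> Fh w0 c0 Fc y y0; have v0 : 0 < y - im w by lra.
have nw : 0 < - im w by lra.
have hP := poisson_measurable (re w) v0.
apply: (@le_trans _ _ (\int[mu]_x (c ^+ 2 * (- im w)^-1 * poisson (re w) (y - im w) x)%:E)%E).
  apply: ge0_le_integralR => //.
  - exact: uhol_sqr_measurable.
  - by apply: measurable_funM; [exact: measurable_cst|].
  - by move=> x _; rewrite exprn_ge0 ?cabs_ge0.
  move=> x _; have d0 := poisson_den (re w) x v0.
  have := Fc (x +i* y)%C y0; set a := cabs (F _) => h.
  have a0 : 0 <= a := cabs_ge0 _.
  have : (a * cabs ((x +i* y)%C - w)) ^+ 2 <= c ^+ 2.
    by apply: lerXn2r; rewrite ?nnegrE ?mulr_ge0 ?cabs_ge0.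
  have -> : (a * cabs ((x +i* y)%C - w)) ^+ 2 = a ^+ 2 * ((x - re w) ^+ 2 + (y - im w) ^+ 2).
    by rewrite exprMn [X in _ * X]cabs_sqr; case: (w) => u v.
  move=> h2; rewrite /poisson mulrA ler_pdivlMr //; apply: le_trans h2 _.
  rewrite -mulrA ler_peMr ?sqr_ge0 // mulrC ler_pdivlMr // mul1r; lra.
rewrite integrable_integralE //; last by apply: integrableR_Z => //; exact: poisson_integrable.
rewrite lee_fin RintegralZl //; last exact: poisson_integrable.
by rewrite /Rintegral poisson_integral //= -mulrA [_ * pi]mulrC.
Qed.

Definition db_regular (E : C -> C) := de_branges_function E /\ forall x : R, E x%:C != 0.

Section Regular.
Variable E : C -> C.
Hypothesis ER : db_regular E.

Let Eh : entire E. Proof. by case: ER => -[]. Qed.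

Lemma db_neq0 z : 0 <= im z -> E z != 0.
Proof.
case: z => x y /=; rewrite le_eqVlt => /orP[/eqP <-|y0]; first by case: ER => _; exact.
by case: ER => -[_ h] _; have := h (x +i* y)%C y0; rewrite -cabs_gt0; apply: le_lt_trans; exact: cabs_ge0.
Qed.

Definition quot f : C -> C := fun z => f z / E z.

Lemma quot_uhol f : entire f -> uhol (quot f).
Proof. by move=> fh z z0; apply: holoM => //; apply: holoV => //; exact: db_neq0. Qed.

Lemma hline_star f : hline (quot (fstar f)) 0 = hline (quot f) 0.
Proof.
apply: eq_integral => x _; rewrite /quot !cabs_div.
by rewrite -[(x +i* 0)%C]/(x%:C) fstar_real cabs_conj.
Qed.

Lemma quot_fstar0 (x : R) f : quot (fstar f) x%:C = (f x%:C / fstar E x%:C)^*%C.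
Proof. by rewrite /quot !fstar_real conjcM conjc_inv conjcK. Qed.

Lemma db_spaceI f (M M' : R) : entire f -> hbounded (quot f) M -> hbounded (quot (fstar f)) M' ->
  db_space E f.
Proof.
move=> fh h1 h2; split => //.
- by apply: (hardy2I (M := M)) => [z z0|y y0]; [apply: quot_uhol => //|apply: h1]; exact: ltW.
- by apply: (hardy2I (M := M')) => [z z0|y y0]; [apply: quot_uhol; [exact: entire_star|]|apply: h2]; exact: ltW.
- by apply: le_lt_trans (h1 0 (lexx _)) _; exact: ltry.
Qed.

Lemma db_star f : db_space E f -> db_space E (fstar f).
Proof.
case=> fh h1 h2 h3; split; [exact: entire_star|exact: h2|by rewrite fstarK|].
by rewrite -[db_sqnorm _ _]/(hline (quot (fstar f)) 0) hline_star.
Qed.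

Lemma db_sqnormE f : db_space E f -> db_sqnorm E f = (fine (db_sqnorm E f))%:E.
Proof.
case=> _ _ _ h; rewrite fineK // ge0_fin_numE //.
by apply: integral_ge0 => x _; rewrite lee_fin exprn_ge0 ?cabs_ge0.
Qed.

(** The Hardy condition bounds the lines above the axis by some M and the norm is the line y = 0;
    with a common bound available, [hline_le] brings every line below the norm. *)
Lemma db_hbounded f : db_space E f -> hbounded (quot f) (fine (db_sqnorm E f)).
Proof.
move=> fE; have s0 := db_sqnormE fE; have [fh /hardy2P[M M0 [_ FM]] _ _] := fE.
pose n := fine (db_sqnorm E f).
have n0 : 0 <= n by apply: fine_ge0; apply: integral_ge0 => x _; rewrite lee_fin exprn_ge0 ?cabs_ge0.
have hb : hbounded (quot f) (M + n).
  move=> y; rewrite le_eqVlt => /orP[/eqP <-|y0].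
    by rewrite -[hline _ _]/(db_sqnorm E f) s0 lee_fin lerDr.
  by apply: le_trans (FM y y0) _; rewrite lee_fin lerDl.
move=> y; rewrite le_eqVlt => /orP[/eqP <-|y0].
  by rewrite -[hline _ _]/(db_sqnorm E f) s0.
by rewrite -s0 -[db_sqnorm E f]/(hline (quot f) 0); exact: hline_le (quot_uhol fh) hb y0.
Qed.

Lemma db_lin : linear_subspace (db_space E).
Proof.
split.
- have h0 : hbounded (quot (fun=> 0)) 0.
    move=> y y0; rewrite /hline (eq_integral (fun=> 0%E)) ?integral0 // => x _.
    by rewrite /quot mul0r cabs0 expr0n.
  apply: (db_spaceI _ h0 (M' := 0)); first by move=> z; exact: holo_cst.
  by rewrite (_ : fstar _ = fun=> 0) //; apply/funext => z; rewrite /fstar conjc0.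
- move=> f g fE gE; have [fh _ _ _] := fE; have [gh _ _ _] := gE.
  have QD f' g' : quot (fun z => f' z + g' z) = fun z => quot f' z + quot g' z.
    by apply/funext => z; rewrite /quot mulrDl.
  have hD f' g' : db_space E f' -> db_space E g' -> exists M, hbounded (quot (fun z => f' z + g' z)) M.
    move=> f'E g'E; have [f'h _ _ _] := f'E; have [g'h _ _ _] := g'E.
    eexists; rewrite QD; exact: hboundedD (quot_uhol f'h) (quot_uhol g'h) (db_hbounded f'E) (db_hbounded g'E).
  have [M HM] := hD f g fE gE; have [M' HM'] := hD _ _ (db_star fE) (db_star gE).
  apply: (db_spaceI _ HM (M' := M')); first by move=> z; exact: holoD.
  by rewrite (_ : fstar _ = fun z => fstar f z + fstar g z) //; apply/funext => z; rewrite /fstar conjcD.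
- move=> c f fE; have [fh _ _ _] := fE.
  have hZ k f' : db_space E f' -> exists M, hbounded (quot (fun z => k * f' z)) M.
    move=> f'E; have [f'h _ _ _] := f'E; eexists.
    rewrite (_ : quot _ = fun z => k * quot f' z); first exact: hboundedZ (quot_uhol f'h) (db_hbounded f'E).
    by apply/funext => z; rewrite /quot mulrA.
  have [M HM] := hZ c f fE; have [M' HM'] := hZ c^*%C _ (db_star fE).
  apply: (db_spaceI _ HM (M' := M')); first by move=> z; apply: holoM => //; exact: holo_cst.
  by rewrite (_ : fstar _ = fun z => c^*%C * fstar f z) //; apply/funext => z; rewrite /fstar conjcM.
Qed.

Definition dbip f g : C := cint setT (fun x : R => quot f x%:C * (quot g x%:C)^*%C).

Lemma uhol_cmeasurable F : uhol F -> cmeasurable (fun x : R => F x%:C).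
Proof. by move=> Fh; apply: rcont_cmeasurable => x; exact: (uhol_rcont Fh (lexx 0)). Qed.

Lemma dbip_integrable f g : db_space E f -> db_space E g ->
  cintegrable setT (fun x : R => quot f x%:C * (quot g x%:C)^*%C).
Proof.
move=> fE gE; have [fh _ _ _] := fE; have [gh _ _ _] := gE.
have [m1 m2] : cmeasurable (fun x : R => quot f x%:C * (quot g x%:C)^*%C).
  apply: cmeasurableM; first exact: uhol_cmeasurable (quot_uhol fh).
  apply: cmeasurable_conj; exact: uhol_cmeasurable (quot_uhol gh).
apply: (@cintegrable_le _ _ (fun x : R => cabs (quot f x%:C) ^+ 2 + cabs (quot g x%:C) ^+ 2)) => //.
  apply: integrableR_D => //.
    exact: hline_integrable (quot_uhol fh) (db_hbounded fE) (lexx 0).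
  exact: hline_integrable (quot_uhol gh) (db_hbounded gE) (lexx 0).
move=> x _; rewrite cabsM cabs_conj; set a := cabs _; set b := cabs _.
have := sqr_ge0 (a - b); have := mulr_ge0 (cabs_ge0 (quot f x%:C)) (cabs_ge0 (quot g x%:C)).
rewrite -/a -/b; nra.
Qed.

Lemma nsq_dbip f : nsq dbip f = fine (db_sqnorm E f).
Proof.
rewrite /nsq /dbip /cint /= /Rintegral; congr fine; apply: eq_integral => x _.
by rewrite mulc_conj.
Qed.

Lemma cint_conj D (p : R -> C) : measurable D -> cintegrable D p ->
  cint D (fun x => (p x)^*%C) = (cint D p)^*%C.
Proof.
move=> mD [h1 h2]; apply: complex_ext; rewrite ?re_conj ?im_conj /cint /=.
  by congr fine; apply: eq_integral => x _; rewrite re_conj.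
rewrite -[in RHS]mulN1r -RintegralZl //; congr fine; apply: eq_integral => x _.
by rewrite im_conj mulN1r.
Qed.

Lemma cintegrable_conj D (p : R -> C) : measurable D -> cintegrable D p ->
  cintegrable D (fun x => (p x)^*%C).
Proof.
move=> mD [h1 h2]; split.
  by rewrite (_ : (fun x => re _) = (fun x => re (p x))) //; apply/funext => x; rewrite re_conj.
rewrite (_ : (fun x => im _) = (fun x => (-1) * im (p x))); first exact: integrableR_Z.
by apply/funext => x; rewrite im_conj mulN1r.
Qed.

Lemma db_prehilbert : prehilbert (db_space E) dbip.
Proof.
split; first exact: db_lin.
- move=> f g h fE gE hE; rewrite /dbip -cintD //; try exact: dbip_integrable.
  by apply: eq_cint => x _; rewrite /quot /fadd !mulrDl.
- move=> c f h fE hE; rewrite /dbip -cintZ //; last exact: dbip_integrable.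
  by apply: eq_cint => x _; rewrite /quot /fscale !mulrA.
- move=> f g fE gE; rewrite /dbip -cint_conj //; last exact: dbip_integrable.
  by apply: eq_cint => x _; rewrite [RHS]conjcM conjcK mulrC.
- move=> f fE; rewrite -[X in _ <= X]/(nsq dbip f) nsq_dbip; apply: fine_ge0.
  by apply: integral_ge0 => x _; rewrite lee_fin exprn_ge0 ?cabs_ge0.
Qed.

Lemma db_upper_bound f z : db_space E f -> 0 < im z ->
  im z * cabs (f z) ^+ 2 <= cabs (E z) ^+ 2 * nsq dbip f.
Proof.
move=> fE z0; have [fh _ _ _] := fE.
have := hline_point (quot_uhol fh) (db_hbounded fE) z0.
rewrite -[hline _ 0]/(db_sqnorm E f) (db_sqnormE fE) lee_fin -nsq_dbip /quot cabs_div => h.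
have E0 : 0 < cabs (E z) by rewrite cabs_gt0 db_neq0 // ltW.
have pi1 : 1 <= pi :> R by have := pi_ge2 R; lra.
rewrite mulrC -ler_pdivrMl ?exprn_gt0 //.
apply: le_trans h; rewrite expr_div_n mulrC -!mulrA [_^-1 * _]mulrC.
rewrite [X in _ <= X](_ : _ = pi * (cabs (f z) ^+ 2 * (cabs (E z) ^+ 2)^-1 * im z)); last by ring.
by rewrite [leLHS](_ : _ = cabs (f z) ^+ 2 * (cabs (E z) ^+ 2)^-1 * im z);
  [rewrite ler_peMl // !mulr_ge0 ?invr_ge0 ?exprn_ge0 ?cabs_ge0 ?ltW|ring].
Qed.

(* Multiplying f by z^2 - a^2 compensates the growth |f(z)|^2 = O(1/|Im z|) on
   the vertical sides of the square of half-side a. *)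
Lemma db_local_bound (a : R) : 0 < a -> exists2 c : R, 0 <= c &
  forall f z, db_space E f -> cabs z <= a / 2 -> cabs (f z) ^+ 2 <= c * nsq dbip f.
Proof.
move=> a0; have aa : - a <= a by lra.
have [B B0 HB] := rect_bounded aa aa (fun z (_ : inrect (-a) a (-a) a z) => holo_ccont (@Eh z)).
(* On the boundary |v^2 - a^2|^2 <= 25 a^2 |Im v|^2, of which one factor |Im v| cancels the growth
   of |f|^2 and the other is at most a. The division by a^4/4 comes from |z^2 - a^2| >= a^2/2 for
   |z| <= a/2. *)
pose c := 25 * a ^+ 3 * B ^+ 2; have c0 : 0 < c by rewrite /c !mulr_gt0 ?exprn_gt0.
exists (4 * c / a ^+ 4); first by rewrite divr_ge0 ?exprn_ge0 ?mulr_ge0 ?ltW.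
move=> f z fE za; have [fh _ _ _] := fE.
have n0 : 0 <= nsq dbip f by apply: ph_ge0 fE; exact: db_prehilbert.
have ns : nsq dbip (fstar f) = nsq dbip f.
  by rewrite !nsq_dbip; congr fine; exact: hline_star.
(* Below the axis the bound is that of [fstar f], which has the same norm as f. *)
have H v : inrect (-a) a (-a) a v -> `|im v| * cabs (f v) ^+ 2 <= B ^+ 2 * nsq dbip f.
  move=> Qv; have [v0|v0|v0] := ltrgtP (im v) 0.
  - have Qv' : inrect (-a) a (-a) a v^*%C.
      by move: Qv; rewrite /inrect re_conj im_conj => /and4P[-> -> h1 h2] /=; rewrite !lerN2 lerNl; lra.
    have := db_upper_bound (db_star fE) (z := v^*%C); rewrite im_conj oppr_gt0 => /(_ v0).
    rewrite /fstar conjcK cabs_conj -/(fstar f) ns ltr0_norm // => h; apply: le_trans h _.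
    by apply: ler_wpM2r => //; apply: lerXn2r; rewrite ?nnegrE ?cabs_ge0 ?(ltW B0) ?HB.
  - rewrite gtr0_norm //; apply: le_trans (db_upper_bound fE v0) _.
    by apply: ler_wpM2r => //; apply: lerXn2r; rewrite ?nnegrE ?cabs_ge0 ?(ltW B0) ?HB.
  - by rewrite v0 normr0 mul0r mulr_ge0 ?sqr_ge0.
pose q (v : C) := v ^+ 2 - (a ^+ 2)%:C; pose g v := f v * q v.
have gh v : inrect (-a) a (-a) a v -> holomorphic_at g v.
  move=> _; apply: holoM => //; apply: holoD; last exact: holo_cst.
  by rewrite /=; apply/holo_hasd; exact: hasdX (hasd_id v).
have qE (v : C) : q v = (v - a%:C) * (v + a%:C) by rewrite /q rmorphXn /=; ring.
have q2 (v : C) : cabs (q v) ^+ 2 =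
    ((re v - a) ^+ 2 + im v ^+ 2) * ((re v + a) ^+ 2 + im v ^+ 2).
  by rewrite qE cabsM exprMn !cabs_sqr !(re_add, im_add, re_opp, im_opp) /= oppr0 !addr0.
have gb v : onrect (-a) a (-a) a v -> cabs (g v) <= Num.sqrt (c * nsq dbip f).
  move=> /andP[Qv bv]; have yE : im v ^+ 2 = `|im v| ^+ 2 by rewrite real_normK // num_real.
  have ya : `|im v| <= a by move/and4P: Qv => [_ _ h1 h2]; rewrite ler_norml h1.
  have qb : cabs (q v) ^+ 2 <= 25 * a ^+ 2 * `|im v| ^+ 2.
    rewrite -yE q2; move/and4P: Qv => [x1 x2 y1 y2].
    have i2 : im v ^+ 2 <= a ^+ 2 by nra.
    case/or4P: bv => /eqP e; rewrite e.
    - by have := sqr_ge0 (im v); nra.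
    - by have := sqr_ge0 (im v); nra.
    - have u1 : (re v - a) ^+ 2 + (- a) ^+ 2 <= 5 * a ^+ 2 by nra.
      have u2 : (re v + a) ^+ 2 + (- a) ^+ 2 <= 5 * a ^+ 2 by nra.
      by apply: le_trans (ler_pM _ _ u1 u2) _; rewrite ?addr_ge0 ?sqr_ge0 // le_eqVlt; apply/orP; left; apply/eqP; ring.
    - have u1 : (re v - a) ^+ 2 + a ^+ 2 <= 5 * a ^+ 2 by nra.
      have u2 : (re v + a) ^+ 2 + a ^+ 2 <= 5 * a ^+ 2 by nra.
      by apply: le_trans (ler_pM _ _ u1 u2) _; rewrite ?addr_ge0 ?sqr_ge0 // le_eqVlt; apply/orP; left; apply/eqP; ring.
  rewrite -[leLHS]ger0_norm ?cabs_ge0 // -sqrtr_sqr; apply: ler_wsqrtr.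
  rewrite /g cabsM exprMn; have f0 : 0 <= cabs (f v) ^+ 2 by rewrite exprn_ge0 ?cabs_ge0.
  apply: le_trans (ler_wpM2l f0 qb) _.
  have k0 : 0 <= 25 * a ^+ 2 * `|im v| by apply: mulr_ge0 => //; apply: mulr_ge0; rewrite ?ler0n ?sqr_ge0.
  have s1 := ler_wpM2l k0 (H v Qv).
  have b0 : 0 <= B ^+ 2 * nsq dbip f by rewrite mulr_ge0 ?sqr_ge0.
  have s2 : 25 * a ^+ 2 * `|im v| * (B ^+ 2 * nsq dbip f) <= 25 * a ^+ 2 * a * (B ^+ 2 * nsq dbip f).
    by apply: ler_wpM2r => //; apply: ler_wpM2l => //; apply: mulr_ge0; rewrite ?ler0n ?sqr_ge0.
  rewrite /c; move: s1 s2; set t := `|im v|; set u := cabs _ ^+ 2; set m := B ^+ 2 * _.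
  rewrite (_ : 25 * a ^+ 3 * B ^+ 2 * nsq dbip f = 25 * a ^+ 2 * a * m); last by rewrite /m; ring.
  rewrite (_ : u * (25 * a ^+ 2 * t ^+ 2) = 25 * a ^+ 2 * t * (t * u)); last by ring.
  exact: le_trans.
have zin : inside (-a) a (-a) a z.
  have := cabs_re z; have := cabs_im z; rewrite !ler_norml => /andP[h1 h2] /andP[h3 h4].
  by apply/and4P; split; lra.
have := max_modulus gh gb zin; rewrite -(@ler_pXn2r _ 2) ?nnegrE ?cabs_ge0 ?sqrtr_ge0 //.
rewrite sqr_sqrtr; last by rewrite mulr_ge0 // ltW.
rewrite /g cabsM exprMn => h.
have q0 : (a ^+ 2 / 2) ^+ 2 <= cabs (q z) ^+ 2.
  apply: lerXn2r; rewrite ?nnegrE ?cabs_ge0 ?divr_ge0 ?sqr_ge0 //.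
  have := ler_cabs_sub (a ^+ 2)%:C (z ^+ 2); rewrite cabsBC -/(q z) cabs_real cabsX ger0_norm ?sqr_ge0 //.
  have : cabs z ^+ 2 <= (a / 2) ^+ 2 by apply: lerXn2r; rewrite ?nnegrE ?cabs_ge0 // divr_ge0 ?ltW.
  have := sqr_ge0 a; lra.
have a4 : 0 < a ^+ 4 by rewrite exprn_gt0.
rewrite -mulrA [_^-1 * _]mulrC mulrA ler_pdivlMr //.
have -> : a ^+ 4 = 4 * (a ^+ 2 / 2) ^+ 2 by field.
have f0 : 0 <= cabs (f z) ^+ 2 by rewrite exprn_ge0 ?cabs_ge0.
have := ler_wpM2l f0 q0; lra.
Qed.

End Regular.
End DeBrangesSpace.

(** * Completeness and reproducing kernel of the de Branges space *)

Section DeBrangesComplete.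
Context {R : realType}.
Local Notation C := R[i].
Local Notation re := (@complex.Re R).
Local Notation im := (@complex.Im R).
Local Notation mu := (@lebesgue_measure R).
Implicit Types (f g F G : C -> C) (w z : C).

Lemma real_complete (s : nat -> R) :
  (forall e : R, 0 < e -> exists N, forall n k, (N <= n)%N -> (N <= k)%N -> `|s n - s k| <= e) ->
  exists l, forall e : R, 0 < e -> exists N, forall n, (N <= n)%N -> `|s n - l| <= e.
Proof.
move=> sc; have : cvgn s.
  apply: cauchy_cvg; apply: cauchy_exP => e e0.
  have [N HN] := sc _ (divr_gt0 e0 (ltr0n R 2)).
  exists (s N); exists N => // n /= Nn; rewrite /ball /=.
  by apply: le_lt_trans (HN N n (leqnn N) Nn) _; rewrite ltr_pdivrMr // ltr_pMr // ltr1n.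
move=> /cvgrPdist_le sl; exists (limn s) => e e0.
have [N _ HN] := sl e e0; exists N => n Nn; rewrite distrC; exact: HN.
Qed.

Lemma complex_complete (s : nat -> C) :
  (forall e : R, 0 < e -> exists N, forall n k, (N <= n)%N -> (N <= k)%N -> cabs (s n - s k) <= e) ->
  exists l, forall e : R, 0 < e -> exists N, forall n, (N <= n)%N -> cabs (s n - l) <= e.
Proof.
move=> sc.
have [a Ha] : exists l, forall e : R, 0 < e -> exists N, forall n, (N <= n)%N -> `|re (s n) - l| <= e.
  apply: real_complete => e /sc[N HN]; exists N => n k Nn Nk.
  by apply: le_trans (HN n k Nn Nk); rewrite -re_opp -re_add cabs_re.
have [b Hb] : exists l, forall e : R, 0 < e -> exists N, forall n, (N <= n)%N -> `|im (s n) - l| <= e.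
  apply: real_complete => e /sc[N HN]; exists N => n k Nn Nk.
  by apply: le_trans (HN n k Nn Nk); rewrite -im_opp -im_add cabs_im.
exists (a +i* b)%C => e e0; have e2 : 0 < e / 2 by rewrite divr_gt0.
have [N1 h1] := Ha _ e2; have [N2 h2] := Hb _ e2; exists (maxn N1 N2) => n.
rewrite geq_max => /andP[n1 n2]; apply: le_trans (cabs_le_reim _) _.
by rewrite re_add im_add re_opp im_opp /=; have := h1 n n1; have := h2 n n2; lra.
Qed.

Lemma limit_entire (u : nat -> C -> C) f : (forall n, entire (u n)) ->
  (forall a e : R, 0 < a -> 0 < e -> exists N, forall n z, (N <= n)%N -> cabs z <= a ->
     cabs (u n z - f z) <= e) -> entire f.
Proof.
move=> uh ul z.
have a0 (v : C) : 0 < cabs v + 2 by have := cabs_ge0 v; lra.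
have fc v : ccont f v.
  move=> e e0; have e4 : 0 < e / 4 by rewrite divr_gt0.
  have [N HN] := ul _ _ (a0 v) e4; have [d d0 Hd] := holo_ccont (@uh N v) e4.
  exists (Num.min d 1) => [|t]; first by rewrite lt_min d0 ltr01.
  rewrite lt_min => /andP[td t1].
  have h1 : cabs (u N t - f t) <= e / 4.
    by apply: HN => //; have := ler_cabs_sub t v; lra.
  have h2 : cabs (u N v - f v) <= e / 4 by apply: HN => //; lra.
  have h3 := Hd t td.
  have -> : f t - f v = (u N t - u N v) - ((u N t - f t) - (u N v - f v)) by ring.
  have := ler_cabsB (u N t - u N v) ((u N t - f t) - (u N v - f v)).
  have := ler_cabsB (u N t - f t) (u N v - f v); lra.
apply: (@unif_limit_holo _ u f (re z - 2^-1) (re z + 2^-1) (im z - 2^-1) (im z + 2^-1)).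
- by move=> n v _; exact: uh.
- move=> e e0; have [N HN] := ul _ _ (a0 z) e0; exists N => v Qv; apply: HN => //.
  have := ler_cabs_sub v z; have := cabs_le_reim (v - z).
  rewrite re_add im_add re_opp im_opp.
  have : `|re v - re z| <= 2^-1 by case/and4P: Qv => *; rewrite ler_norml; lra.
  have : `|im v - im z| <= 2^-1 by case/and4P: Qv => *; rewrite ler_norml; lra.
  lra.
- by move=> v _; exact: fc.
- by apply/and4P; split; lra.
Qed.

(** Fatou's lemma on one horizontal line. *)
Lemma hline_limit (F : nat -> C -> C) G (y M : R) : 0 <= y -> (forall n, uhol (F n)) ->
  (forall n, (hline (F n) y <= M%:E)%E) ->
  (forall x e : R, 0 < e -> exists N, forall n, (N <= n)%N -> cabs (F n (x +i* y)%C - G (x +i* y)%C) <= e) ->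
  (hline G y <= M%:E)%E.
Proof.
move=> y0 Fh FM Fl.
pose q n x : \bar R := (cabs (F n (x +i* y)%C) ^+ 2)%:E.
have qm n : measurable_fun setT (q n).
  by apply/measurable_EFinP; apply: uhol_sqr_measurable.
have ql x : limn_einf (q ^~ x) = (cabs (G (x +i* y)%C) ^+ 2)%:E.
  suff h : q n x @[n --> \oo] --> (cabs (G (x +i* y)%C) ^+ 2)%:E by rewrite (cvg_limn_einf_sup h).1.
  apply: cvg_EFin; first exact: nearW.
  apply/cvgrPdist_le => e e0 /=; set v := G _.
  have k0 : 0 < 2 * cabs v + 1 by have := cabs_ge0 v; lra.
  have m0 : 0 < Num.min 1 (e / (2 * cabs v + 1)) by rewrite lt_min ltr01 divr_gt0.
  have [N HN] := Fl x _ (divr_gt0 m0 (ltr0n R 2)).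
  exists N => // n /= Nn; rewrite distrC; apply: ltW; apply: sqr_cabs_near => //.
  by apply: le_lt_trans (HN n Nn) _; rewrite ltr_pdivrMr // ltr_pMr // ltr1n.
have -> : hline G y = (\int[mu]_x limn_einf (q ^~ x))%E.
  by apply: eq_integral => x _; rewrite ql.
apply: (@le_trans _ _ (limn_einf (fun n => \int[mu]_x q n x))%E).
  by apply: fatou => // n x _; rewrite lee_fin exprn_ge0 ?cabs_ge0.
rewrite limn_einf_lim; apply: lime_le; first exact: is_cvg_einfs.
apply: nearW => n; apply: le_trans (FM n); apply: ereal_inf_lbound.
by exists n => //=.
Qed.

Variable E : C -> C.
Hypothesis ER : db_regular E.

Lemma fstar_sub f g : fstar (fsub f g) = fsub (fstar f) (fstar g).
Proof. by apply/funext => z; rewrite /fstar /fsub conjcB. Qed.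

Lemma quot_sub f g z : quot E (fsub f g) z = quot E f z - quot E g z.
Proof. by rewrite /quot /fsub mulrBl. Qed.

Lemma db_eval_bounded : eval_bounded (dbip E) (db_space E).
Proof.
move=> w; have c0 := cabs_ge0 w.
have a0 : 0 < 2 * (cabs w + 1) by rewrite mulr_gt0 //; lra.
have [c c_ge0 Hc] := db_local_bound ER a0; exists c => // f fE; apply: Hc => //.
by rewrite mulrC mulKf //; lra.
Qed.

(** By [db_local_bound] a Cauchy sequence converges uniformly on discs, so its limit f is entire.
    Fatou's lemma, applied to u n - u k on each line as k grows, bounds u n - f and its reflection,
    which gives both membership and convergence. *)
Lemma db_complete : hcomplete (dbip E) (db_space E).
Proof.
move=> u uE uc; have PH := db_prehilbert ER; have lE := db_lin ER.
have uh n : entire (u n) by case: (uE n).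
have un (a e : R) : 0 < a -> 0 < e -> exists N, forall n k z, (N <= n)%N -> (N <= k)%N ->
    cabs z <= a -> cabs (u n z - u k z) <= e.
  move=> a0 e0; have [c c0 Hc] := db_local_bound ER (mulr_gt0 a0 (ltr0n R 2)).
  have c1 : 0 < c + 1 by lra.
  have [N HN] := uc _ (divr_gt0 (exprn_gt0 2 e0) c1).
  exists N => n k z Nn Nk za; rewrite -(@ler_pXn2r _ 2) ?nnegrE ?cabs_ge0 ?(ltW e0) //.
  have dE := lin_sub lE (uE n) (uE k).
  apply: le_trans (Hc _ z dE _) _; first by rewrite mulfK.
  have := HN n k Nn Nk; rewrite ler_pdivlMr //; have := nsq_ge0 PH dE; nra.
have ex z : exists l, forall e : R, 0 < e -> exists N, forall n, (N <= n)%N -> cabs (u n z - l) <= e.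
  apply: complex_complete => e e0; have k0 : 0 < cabs z + 1 by have := cabs_ge0 z; lra.
  have [N HN] := un _ _ k0 e0; exists N => n k Nn Nk; apply: HN => //; lra.
have [f fl] := choice ex.
have fun_ (a e : R) : 0 < a -> 0 < e -> exists N, forall n z, (N <= n)%N -> cabs z <= a ->
     cabs (u n z - f z) <= e.
  move=> a0 e0; have e2 := divr_gt0 e0 (ltr0n R 2).
  have [N HN] := un _ _ a0 e2; exists N => n z Nn za.
  have [N' HN'] := fl z _ e2.
  have h1 := HN n (maxn N N') z Nn (leq_maxl _ _) za; have h2 := HN' _ (leq_maxr N N').
  have -> : u n z - f z = (u n z - u (maxn N N') z) + (u (maxn N N') z - f z) by ring.
  by apply: le_trans (ler_cabsD _ _) _; lra.
have fh : entire f by exact: limit_entire uh fun_.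
have key (e : R) : 0 < e -> exists N, forall n, (N <= n)%N ->
    hbounded (quot E (fsub (u n) f)) e /\ hbounded (quot E (fstar (fsub (u n) f))) e.
  move=> e0; have [N HN] := uc _ e0; exists N => n Nn.
  have dE k := lin_sub lE (uE n) (uE (k + N)%N).
  have dh k : entire (fsub (u n) (u (k + N)%N)) by case: (dE k).
  have nE k : nsq (dbip E) (fsub (u n) (u (k + N)%N)) <= e by apply: HN => //; exact: leq_addl.
  split=> y y0.
    apply: (@hline_limit (fun k => quot E (fsub (u n) (u (k + N)%N)))) => //.
    - by move=> k; apply: (quot_uhol ER); exact: dh.
    - by move=> k; apply: le_trans (db_hbounded ER (dE k) y0) _; rewrite -nsq_dbip lee_fin.
    move=> x d d0; set z := (x +i* y)%C; have E0 : 0 < cabs (E z) by rewrite cabs_gt0 db_neq0.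
    have [N' HN'] := fl z _ (mulr_gt0 d0 E0); exists N' => k Nk.
    rewrite !quot_sub (_ : _ - _ = - ((u (k + N)%N z - f z) / E z)); last by rewrite /quot; ring.
    by rewrite cabsN cabs_div ler_pdivrMr // HN' // (leq_trans Nk) // leq_addr.
  apply: (@hline_limit (fun k => quot E (fstar (fsub (u n) (u (k + N)%N))))) => //.
  - by move=> k; apply: (quot_uhol ER); apply: entire_star; exact: dh.
  - move=> k; apply: le_trans (db_hbounded ER (db_star (dE k)) y0) _.
    rewrite (_ : db_sqnorm E (fstar _) = db_sqnorm E (fsub (u n) (u (k + N)%N))); last exact: hline_star.
    by rewrite -nsq_dbip lee_fin.
  move=> x d d0; set z := (x +i* y)%C; have E0 : 0 < cabs (E z) by rewrite cabs_gt0 db_neq0.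
  have [N' HN'] := fl z^*%C _ (mulr_gt0 d0 E0); exists N' => k Nk.
  rewrite !fstar_sub !quot_sub (_ : _ - _ = - ((u (k + N)%N z^*%C - f z^*%C)^*%C / E z)).
    by rewrite cabsN cabs_div cabs_conj ler_pdivrMr // HN' // (leq_trans Nk) // leq_addr.
  by rewrite /quot /fstar conjcB; ring.
have mem n (e : R) : hbounded (quot E (fsub (u n) f)) e -> hbounded (quot E (fstar (fsub (u n) f))) e ->
    db_space E (fsub (u n) f).
  move=> h1 h2; apply: (db_spaceI ER _ h1 h2) => z.
  apply/holo_hasd; have /holo_hasd[a ha] := @uh n z; have /holo_hasd[b hb] := @fh z.
  by eexists; exact: hasdB ha hb.
exists f.
  have [N HN] := key 1 ltr01; have [h1 h2] := HN N (leqnn N).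
  have -> : f = fsub (u N) (fsub (u N) f) by apply/funext => z; rewrite /fsub; ring.
  exact: (lin_sub lE (uE N) (mem _ _ h1 h2)).
move=> e e0; have [N HN] := key e e0; exists N => n Nn; have [h1 h2] := HN n Nn.
have := h1 0 (lexx 0); rewrite -[hline _ 0]/(db_sqnorm E (fsub (u n) f)).
by rewrite (db_sqnormE (mem _ _ h1 h2)) lee_fin nsq_dbip.
Qed.

Lemma closed_complete N : closed_subspace E N -> hcomplete (dbip E) N.
Proof.
move=> [NE Nl Nc] u uN uc; have [f fE fl] := db_complete (fun n => NE _ (uN n)) uc.
exists f => //; apply: Nc => // e e0.
have e2 : 0 < (e / 2) ^+ 2 by rewrite exprn_gt0 ?divr_gt0.
have [k Hk] := fl _ e2; exists (u k) => //.
have dE : db_space E (fsub f (u k)) by apply: lin_sub => //; [exact: db_lin|exact: NE].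
have dE' := lin_sub (db_lin ER) (NE _ (uN k)) fE.
have : db_norm E (fsub f (u k)) <= e / 2.
  rewrite /db_norm -nsq_dbip (_ : fsub f (u k) = fscale (-1) (fsub (u k) f)).
    rewrite (nsqZ (db_prehilbert ER)) // cabsN cabs1 expr1n mul1r.
    rewrite -[leRHS]gtr0_norm ?divr_gt0 // -sqrtr_sqr; apply: ler_wsqrtr; exact: Hk.
  by apply/funext => z; rewrite /fscale /fsub; ring.
by rewrite -[db_norm _ _]/(db_norm E (fun z => f z - u k z)); lra.
Qed.

(** Where z is the conjugate of w the divisor is 0 and so is the value; hence the lemmas below speak
    of a function K that agrees with it elsewhere. *)
Definition dbkernel w z : C :=
  (E z * (E w)^*%C - fstar E z * (fstar E w)^*%C) / (2 * 'i%C * pi%:C * (w^*%C - z)).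

Lemma ipi_neq0 : (2 * 'i%C * pi%:C : C) != 0.
Proof.
rewrite -cabs_gt0 !cabsM cabs_real.
have p0 := pi_gt0 R; rewrite (gtr0_norm p0).
have -> : cabs ('i%C : C) = 1.
  by apply/eqP; rewrite -(@eqrXn2 _ 2) ?cabs_ge0 // cabs_sqr /= expr0n expr1n add0r.
by rewrite mulr1 mulr_gt0 // cabs_gt0 pnatr_eq0.
Qed.

(** On the real line the integrand splits into Cauchy integrals of f/E and of the conjugate of
    f^*/E. For w above the axis the first gives f(w) and the second vanishes; below the axis the
    roles are exchanged. *)
Lemma db_reproducing w f K : im w != 0 -> db_space E f -> 
  (forall x : R, K x%:C = dbkernel w x%:C) -> f w = dbip E f K.
Proof.
move=> w0 fE KE; have [fh _ _ _] := fE; have fsE := db_star fE.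
have wc0 : im w^*%C != 0 by rewrite im_conj oppr_eq0.
pose F := quot E f; pose G := quot E (fstar f).
have Fh : uhol F by apply: (quot_uhol ER).
have Gh : uhol G by apply: (quot_uhol ER); apply: entire_star.
have iF := cauchy_line_integrable Fh (db_hbounded ER fE) w0.
have iG := cauchy_line_integrable Gh (db_hbounded ER fsE) wc0.
have pE x : F x%:C * (quot E K x%:C)^*%C = (2 * 'i%C * pi%:C)^-1 *
   (E w * (F x%:C * (x%:C - w)^-1) - fstar E w * (G x%:C * (x%:C - w^*%C)^-1)^*%C).
  rewrite /quot KE /dbkernel !fstar_real /F /G quot_fstar0 fstar_real /quot.
  have Ex : E x%:C != 0 by case: ER => _; exact.
  have Ecx : (E x%:C)^*%C != 0 by rewrite conjc_eq0.
  have n1 : x%:C - w != 0 by rewrite subr_eq0; exact: real_neq.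
  have n2 : w - x%:C != 0 by rewrite -opprB oppr_eq0.
  rewrite !(conjcM, conjcB, conjc_inv, conjcK, conjc_real).
  rewrite conjc_i conjc_2.
  have ip0 := ipi_neq0; move: ip0; rewrite !mulf_eq0 !negb_or => /andP[/andP[t0 i0] p0].
  by move: i0 p0; move: ('i%C : C) (pi%:C : C) => j p i0 p0; field; rewrite n1 n2 Ex Ecx i0 p0.
pose a (x : R) := F x%:C * (x%:C - w)^-1; pose b (x : R) := (G x%:C * (x%:C - w^*%C)^-1)^*%C.
have ia : cintegrable setT a by exact: iF.
have ib : cintegrable setT b by exact: cintegrable_conj.
have -> : dbip E f K = (2 * 'i%C * pi%:C)^-1 * (E w * cint setT a - fstar E w * cint setT b).
  rewrite /dbip (eq_cint (fun x _ => pE x)).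
  rewrite -(cintZ (E w) _ ia) // -(cintZ (fstar E w) _ ib) // -cintB //; try exact: cintegrableZ.
  by rewrite -cintZ //; apply: cintegrableB => //; exact: cintegrableZ.
have -> : cint setT b = (cint setT (fun x : R => G x%:C * (x%:C - w^*%C)^-1))^*%C.
  exact: cint_conj.
rewrite /a.
have [w1|w1|] := ltrgtP (im w) 0; last by move/eqP; rewrite (negPf w0).
- have v1 : 0 < im w^*%C by rewrite im_conj oppr_gt0.
  have := halfplane_cauchy_outer Fh (db_hbounded ER fE) v1; rewrite conjcK => ->.
  have -> := halfplane_cauchy Gh (db_hbounded ER fsE) v1.
  rewrite mulr0 sub0r !(conjcM, conjc_inv, conjc_real).
  rewrite conjc_i conjc_2.
  have Ew : (E w^*%C)^*%C != 0 by rewrite conjc_eq0; apply: db_neq0 => //; exact: ltW.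
  have ip0 := ipi_neq0; move: ip0; rewrite !mulf_eq0 !negb_or => /andP[/andP[t0 i0] p0].
  by rewrite /fstar !conjcK; move: i0 p0; move: ('i%C : C) (pi%:C : C) => j p i0 p0; field; rewrite Ew i0 p0.
- have := halfplane_cauchy_outer Gh (db_hbounded ER fsE) w1 => ->.
  have -> := halfplane_cauchy Fh (db_hbounded ER fE) w1.
  rewrite conjc0 mulr0 subr0 /F /quot.
  have Ew : E w != 0 by apply: db_neq0 => //; exact: ltW.
  have ip0 := ipi_neq0; move: ip0; rewrite !mulf_eq0 !negb_or => /andP[/andP[t0 i0] p0].
  by move: i0 p0; move: ('i%C : C) (pi%:C : C) => j p i0 p0; field; rewrite Ew i0 p0.
Qed.

Lemma star_le z : 0 <= im z -> cabs (fstar E z) <= cabs (E z).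
Proof.
case: z => x y /=; rewrite le_eqVlt => /orP[/eqP <-|y0].
  by rewrite -[(x +i* 0)%C]/(x%:C) fstar_real cabs_conj.
by case: ER => -[_ h] _; rewrite /fstar cabs_conj; apply: ltW; exact: (h (x +i* y)%C).
Qed.

(** Since |E^*| <= |E| on the closed half-plane, K/E decays like the inverse distance to the
    conjugate of w, and [hbounded_cauchy] applies when that point is below the axis. When it is
    above, the decay is measured from w instead. *)
Lemma kernel_hbounded w K : im w != 0 -> entire K ->
  (forall z, z != w^*%C -> K z = dbkernel w z) -> exists M, hbounded (quot E K) M.
Proof.
move=> w0 Kh KE; have Qh : uhol (quot E K) by apply: (quot_uhol ER).
pose k0 := (cabs (E w) + cabs (fstar E w)) / cabs (2 * 'i%C * pi%:C : C).
have ip0 : 0 < cabs (2 * 'i%C * pi%:C : C) by rewrite cabs_gt0 ipi_neq0.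
have k00 : 0 <= k0 by rewrite divr_ge0 ?addr_ge0 ?cabs_ge0.
have far z : 0 <= im z -> z != w^*%C -> cabs (quot E K z) * cabs (z - w^*%C) <= k0.
  move=> z0 zw; have Ez : 0 < cabs (E z) by rewrite cabs_gt0 db_neq0.
  have zw0 : 0 < cabs (z - w^*%C) by rewrite cabs_gt0 subr_eq0.
  rewrite /quot KE // /dbkernel !cabs_div cabsM [cabs (_ - z)]cabsBC.
  set d := cabs (z - _); set t := cabs (2 * _ * _); set e := cabs (E z); set n := cabs (_ - _).
  rewrite (_ : n / (t * d) / e * d = n / e / t); last by field; rewrite !gt_eqF.
  rewrite ler_pM2r ?invr_gt0 // ler_pdivrMr //; apply: le_trans (ler_cabsB _ _) _.
  rewrite !cabsM !cabs_conj mulrDl -/e [e * _]mulrC lerD2l [leRHS]mulrC.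
  by apply: ler_wpM2r; [exact: cabs_ge0|have := star_le z0; rewrite /fstar cabs_conj].
have [w1|w1|] := ltrgtP (im w) 0; last by move/eqP; rewrite (negPf w0).
- have v1 : 0 <= im w^*%C by rewrite im_conj oppr_ge0 ltW.
  have [d d0 Hd] := uhol_ccont Qh v1 ltr01.
  (* Within d of the conjugate of w, continuity bounds the quotient by B; farther away, the
     distances to w and to its conjugate are comparable, with ratio at most 1 + t/d. *)
  pose t := cabs (w^*%C - w); pose B := cabs (quot E K w^*%C) + 1.
  have t0 : 0 <= t := cabs_ge0 _.
  have B0 : 0 <= B by rewrite /B; have := cabs_ge0 (quot E K w^*%C); lra.
  have c0 : 0 <= k0 * (1 + t / d) + B * (d + t).
    have td : 0 <= t / d by rewrite divr_ge0 // ltW.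
    have := mulr_ge0 k00 td; nra.
  eexists; apply: (hbounded_cauchy Qh w1 c0) => z z0.
  have tri : cabs (z - w) <= cabs (z - w^*%C) + t.
    by rewrite (_ : z - w = (z - w^*%C) + (w^*%C - w)) ?ler_cabsD //; ring.
  set q := cabs (quot E K z); have q0 : 0 <= q := cabs_ge0 _.
  apply: le_trans (ler_wpM2l q0 tri) _.
  have [zd|zd] := ltP (cabs (z - w^*%C)) d.
    have qB : q <= B.
      by have := ler_cabs_sub (quot E K z) (quot E K w^*%C); have := Hd z zd; rewrite -/q /B; lra.
    have h : q * (cabs (z - w^*%C) + t) <= B * (d + t).
      by apply: ler_pM => //; [rewrite addr_ge0 ?cabs_ge0|rewrite lerD2r ltW].
    have td : 0 <= t / d by rewrite divr_ge0 // ltW.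
    have := mulr_ge0 k00 td; lra.
  have zw : z != w^*%C by rewrite -subr_eq0 -cabs_gt0; exact: lt_le_trans zd.
  have f := far z z0 zw.
  have tl : t <= t / d * cabs (z - w^*%C) by rewrite mulrAC ler_pdivlMr // ler_wpM2l.
  have h : q * (cabs (z - w^*%C) + t) <= q * (cabs (z - w^*%C) * (1 + t / d)).
    by apply: ler_wpM2l => //; rewrite mulrDr mulr1 lerD2l [leRHS]mulrC.
  apply: le_trans h _; rewrite mulrA.
  have td : 0 <= t / d by rewrite divr_ge0 // ltW.
  have h2 : q * cabs (z - w^*%C) * (1 + t / d) <= k0 * (1 + t / d).
    by apply: ler_wpM2r => //; rewrite addr_ge0.
  have : 0 <= B * (d + t) by rewrite mulr_ge0 // addr_ge0 // ltW.
  lra.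
have v1 : im w^*%C < 0 by rewrite im_conj oppr_lt0.
eexists; apply: (hbounded_cauchy Qh v1 k00) => z z0; apply: far => //.
by apply: contraTneq z0 => ->; rewrite -ltNge.
Qed.

Lemma db_kernel_mem w K : im w != 0 -> entire K ->
  (forall z, z != w^*%C -> K z = dbkernel w z) -> db_space E K.
Proof.
move=> w0 Kh KE; have [M HM] := kernel_hbounded w0 Kh KE.
have wc0 : im w^*%C != 0 by rewrite im_conj oppr_eq0.
(* The reflection of the kernel at w is the kernel at the conjugate of w. *)
have [|M' HM'] := kernel_hbounded wc0 (entire_star Kh).
  move=> z; rewrite conjcK => zw; rewrite /fstar KE; last first.
    by apply: contra_neq zw => /(congr1 conjc); rewrite !conjcK.
  rewrite /dbkernel /fstar !(conjcM, conjcB, conjc_inv, conjcK, conjc_real).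
  rewrite conjc_i conjc_2.
  have n1 : w - z != 0 by rewrite subr_eq0 eq_sym.
  have ip0 := ipi_neq0; move: ip0; rewrite !mulf_eq0 !negb_or => /andP[/andP[t0 i0] p0].
  by move: i0 p0; move: ('i%C : C) (pi%:C : C) => j p i0 p0; field; rewrite n1 i0 p0.
exact: (db_spaceI ER Kh HM HM').
Qed.

End DeBrangesComplete.

(** * Kernels of a nearly invariant subspace *)

Section KernelStructure.
Context {R : realType}.
Local Notation C := R[i].
Local Notation re := (@complex.Re R).
Local Notation im := (@complex.Im R).
Implicit Types (f g h : C -> C) (w z : C).

(** Approach along the vertical through x. With k = 0 it also extends the vanishing of a continuous
    function from nonreal to real points. *)
Lemma vanish_real f (x k d : R) : ccont f x%:C -> 0 <= k -> 0 < d ->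
  (forall y, 0 < y < d -> cabs (f (x +i* y)%C) ^+ 2 <= k * y) -> f x%:C = 0.
Proof.
move=> fc k0 d0 fk; apply/eqP; rewrite -cabs_eq0 eq_le cabs_ge0 andbT leNgt; apply/negP => t0.
set t := cabs _ in t0; have t2 : 0 < t / 2 by rewrite divr_gt0.
have [r r0 Hr] := fc _ t2.
have k1 : 0 < 8 * (k + 1) by rewrite mulr_gt0 //; lra.
have [y [y0 yd yr yk]] : exists y : R, [/\ 0 < y, y < d, y < r & y <= t ^+ 2 / (8 * (k + 1))].
  exists (Num.min (Num.min d r / 2) (t ^+ 2 / (8 * (k + 1)))).
  have m0 : 0 < Num.min d r by rewrite lt_min d0.
  have h1 : Num.min d r <= d by rewrite ge_min lexx.
  have h2 : Num.min d r <= r by rewrite ge_min lexx orbT.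
  split.
  - by rewrite lt_min !divr_gt0 // exprn_gt0.
  - by rewrite gt_min; apply/orP; left; lra.
  - by rewrite gt_min; apply/orP; left; lra.
  - by rewrite ge_min lexx orbT.
have h1 : cabs (f (x +i* y)%C - f x%:C) < t / 2.
  apply: Hr; rewrite (_ : (x +i* y)%C - x%:C = (0 +i* y)%C).
    by apply: le_lt_trans (cabs_le_reim _) _; rewrite /= normr0 add0r gtr0_norm.
  by apply: complex_ext => /=; ring.
have h2 : cabs (f (x +i* y)%C) ^+ 2 <= k * y by apply: fk; rewrite y0.
have h3 : t / 2 < cabs (f (x +i* y)%C).
  by have := ler_cabs_sub (f x%:C) (f (x +i* y)%C); rewrite cabsBC -/t; lra.
move: yk; rewrite ler_pdivlMr // => yk.
have : (t / 2) ^+ 2 < cabs (f (x +i* y)%C) ^+ 2 by rewrite ltrXn2r // ?nnegrE ?cabs_ge0 ?(ltW t2).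
have : 0 < y * k + y by rewrite ltr_wpDl // mulr_ge0 // ltW.
lra.
Qed.

Lemma vanish_nonreal f z : ccont f z -> (forall w, im w != 0 -> f w = 0) -> f z = 0.
Proof.
move=> fc f0; have [z0|] := eqVneq (im z) 0; last exact: f0.
have zE : z = (re z)%:C by rewrite -[LHS]complex_eta z0.
rewrite zE; rewrite zE in fc; apply: (vanish_real fc (lexx 0) ltr01) => y /andP[y0 _].
by rewrite f0 ?cabs0 ?expr0n ?mul0r //= gt_eqF.
Qed.

(** Above x, |E| = O(y) and |f/E| = O(y^(-1/2)), so f = O(y^(1/2)). *)
Lemma db_real_zero (E : C -> C) f (x : R) : de_branges_function E -> E x%:C = 0 ->
  db_space E f -> f x%:C = 0.
Proof.
move=> [Eh EE] Ex [fh /hardy2P[M M0 [Fh FM]] _ _].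
have /holo_hasd[a Ha] := @Eh x%:C.
have [r r0 Hr] := Ha 1 ltr01.
(* The factor 2 M is the bound of [hardy2_point], and |E| <= (|a| + 1) y with a the derivative of E
   at x. *)
apply: (vanish_real (k := 2 * M * (cabs a + 1) ^+ 2) (d := r)) => //.
- exact: holo_ccont (@fh x%:C).
- by rewrite mulr_ge0 ?sqr_ge0 // mulr_ge0.
move=> y /andP[y0 yr]; set z := (x +i* y)%C.
have zE : z - x%:C = (0 +i* y)%C by apply: complex_ext => /=; ring.
have yn : cabs (0 +i* y)%C = y.
  by apply/eqP; rewrite -(@eqrXn2 _ 2) ?cabs_ge0 ?ltW // cabs_sqr /= expr0n add0r.
have E1 : cabs (E z) <= (cabs a + 1) * y.
  have := Hr z; rewrite zE yn => /(_ yr); rewrite Ex subr0 mul1r => h.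
  have := ler_cabs_sub (E z) (a * (0 +i* y)%C); rewrite cabsM yn mulrDl mul1r; lra.
have Ez : E z != 0 by rewrite -cabs_gt0; apply: le_lt_trans (EE z y0); exact: cabs_ge0.
have := hardy2_point Fh FM (w := z) y0; rewrite /= cabs_div => h.
have E0 : 0 < cabs (E z) by rewrite cabs_gt0.
have p1 : 1 <= pi :> R by have := pi_ge2 R; lra.
have h1 : y * (cabs (f z) / cabs (E z)) ^+ 2 <= 2 * M.
  by apply: le_trans h; rewrite -mulrA ler_peMl // mulr_ge0 ?sqr_ge0 // ltW.
have h2 : y * cabs (f z) ^+ 2 <= 2 * M * cabs (E z) ^+ 2.
  rewrite (_ : y * _ = y * (cabs (f z) / cabs (E z)) ^+ 2 * cabs (E z) ^+ 2); last by field; rewrite gt_eqF.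
  by apply: ler_wpM2r; rewrite ?sqr_ge0.
have h3 : cabs (E z) ^+ 2 <= ((cabs a + 1) * y) ^+ 2.
  by apply: lerXn2r; rewrite ?nnegrE ?cabs_ge0 ?mulr_ge0 ?addr_ge0 ?cabs_ge0 ?(ltW y0).
have h4 : y * cabs (f z) ^+ 2 <= y * (2 * M * (cabs a + 1) ^+ 2 * y).
  apply: le_trans h2 _; rewrite (_ : y * _ = 2 * M * ((cabs a + 1) * y) ^+ 2); last by ring.
  by apply: ler_wpM2l => //; rewrite mulr_ge0.
by move: h4; rewrite ler_pM2l.
Qed.

Lemma no_common_zeros_regular (E : C -> C) (N : set (C -> C)) : de_branges_function E ->
  N `<=` db_space E -> no_common_zeros N -> db_regular E.
Proof.
move=> Edb NE nz; split=> // x; apply/negP => /eqP Ex; apply: nz.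
by exists x%:C => f /NE; exact: db_real_zero.
Qed.

Lemma prehilbert_sub (H N : set (C -> C)) (ip : (C -> C) -> (C -> C) -> C) : prehilbert H ip ->
  N `<=` H -> linear_subspace N -> prehilbert N ip.
Proof.
move=> [_ h1 h2 h3 h4] NH Nl; split => //.
- by move=> f g h /NH ? /NH ? /NH ?; exact: h1.
- by move=> c f h /NH ? /NH ?; exact: h2.
- by move=> f g /NH ? /NH ?; exact: h3.
- by move=> f /NH; exact: h4.
Qed.

Lemma divide_zeroK f l : f l = 0 -> forall z, (z - l) * divide_zero f l z = f z.
Proof.
move=> fl z; rewrite /divide_zero; case: eqP => [->|/eqP zl]; first by rewrite subrr mul0r fl.
by rewrite mulrC divfK // subr_eq0.
Qed.

Variables (E : C -> C) (N : set (C -> C)).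
Hypotheses (ER : db_regular E) (Nc : closed_subspace E N).
Hypotheses (Nz : no_common_zeros N) (Ni : nearly_invariant N).
Local Notation ip := (dbip E).

Let NE : N `<=` db_space E. Proof. by case: Nc. Qed.
Let Nlin : linear_subspace N. Proof. by case: Nc. Qed.
Let PN : prehilbert N ip. Proof. exact: prehilbert_sub (db_prehilbert ER) NE Nlin. Qed.
Let NZ c f : N f -> N (fscale c f). Proof. by case: Nlin => _ _ h; exact: h. Qed.
Let ND f g : N f -> N g -> N (fadd f g). Proof. by case: Nlin => _ h _; exact: h. Qed.

Lemma sub_eval_bounded : eval_bounded ip N.
Proof.
move=> w; have [c c0 Hc] := db_eval_bounded ER w.
by exists c => // f /NE; exact: Hc.
Qed.

Lemma sub_kernels : exists K : C -> C -> C, forall w, N (K w) /\ forall f, N f -> f w = ip f (K w).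
Proof.
have ex w : exists k, N k /\ forall f, N f -> f w = ip f k.
  by have [k Nk Hk] := riesz_eval PN w (closed_complete ER Nc) sub_eval_bounded; exists k.
by have [K HK] := choice ex; exists K.
Qed.

Section Kernels.
Variable K : C -> C -> C.
Hypothesis HK : forall w, N (K w) /\ forall f, N f -> f w = ip f (K w).

Let KN w : N (K w). Proof. by case: (HK w). Qed.
Let KE w f : N f -> f w = ip f (K w). Proof. by case: (HK w) => _; exact. Qed.

Lemma kernel_sym w z : K w z = (K z w)^*%C.
Proof. by rewrite (KE z (KN w)) (KE w (KN z)) (ph_conj PN (KN z) (KN w)). Qed.

(** If K_w had norm 0, it would be orthogonal to N, and w would be a common zero. *)
Lemma kernel_diag w : K w w = (nsq ip (K w))%:C /\ 0 < nsq ip (K w).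
Proof.
have E1 : K w w = (nsq ip (K w))%:C.
  apply: complex_ext; first by rewrite [in LHS](KE w (KN w)).
  by have := congr1 im (kernel_sym w w); rewrite im_conj /=; lra.
split=> //; rewrite lt_neqAle (nsq_ge0 PN) // andbT; apply/negP => /eqP n0.
apply: Nz; exists w => f Nf; apply/eqP; rewrite -cabs_eq0 -sqrf_eq0 eq_le sqr_ge0 andbT.
rewrite (KE w Nf) (ph_conj PN (KN w) Nf) cabs_conj.
by apply: le_trans (weak_cauchy_schwarz PN (KN w) Nf) _; rewrite -n0 mul0r.
Qed.

Lemma kernel_diag_neq0 w : K w w != 0.
Proof. by have [-> h] := kernel_diag w; rewrite fmorph_eq0 gt_eqF. Qed.

(* The isometry f |-> f (z + i) / (z - i) from {f in N | f(i) = 0} onto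
   {f in N | f(-i) = 0}, as a relation. *)
Definition cayley_pair g f := forall z, (z - 'i%C) * f z = (z + 'i%C) * g z.

Let i2 : (2 * 'i%C : C) != 0.
Proof. by have := @ipi_neq0 R; rewrite mulf_eq0 negb_or => /andP[]. Qed.

(** (z + i)/(z - i) = 1 + 2 i/(z - i), so near invariance at i suffices. *)
Lemma cayley_right g : N g -> g 'i%C = 0 -> exists2 f, N f & cayley_pair g f.
Proof.
move=> Ng gi; exists (fadd g (fscale (2 * 'i%C) (divide_zero g 'i%C))).
  by apply: ND => //; apply: NZ; exact: Ni.
by move=> z; rewrite /fadd /fscale -(divide_zeroK gi z); ring.
Qed.

Lemma cayley_left f : N f -> f (- 'i%C) = 0 -> exists2 g, N g & cayley_pair g f.
Proof.
move=> Nf fi; exists (fadd f (fscale (- (2 * 'i%C)) (divide_zero f (- 'i%C)))).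
  by apply: ND => //; apply: NZ; exact: Ni.
by move=> z; rewrite /fadd /fscale -(divide_zeroK fi z); ring.
Qed.

(** The inner product sees only the real line, where (x + i)/(x - i) is unimodular. *)
Lemma cayley_isometry g f g' f' : cayley_pair g f -> cayley_pair g' f' -> ip f f' = ip g g'.
Proof.
move=> h h'; apply: eq_cint => x _; rewrite /quot.
have n1 : x%:C - 'i%C != 0 :> C by rewrite subr_eq0; apply: real_neq; rewrite /= oner_neq0.
have n2 : x%:C + 'i%C != 0 :> C.
  by rewrite -[_ + _]opprK opprD oppr_eq0 -[- x%:C]rmorphN /= subr_eq0; apply: real_neq; rewrite /= oner_neq0.
have fE u v : cayley_pair u v -> v x%:C = (x%:C + 'i%C) / (x%:C - 'i%C) * u x%:C.
  by move=> /(_ x%:C) e; rewrite mulrAC -e; field.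
rewrite (fE _ _ h) (fE _ _ h') !(conjcM, conjcD, conjcB, conjc_inv, conjc_real).
rewrite ?(conjc_i, conjc_Ni).
have Ex : E x%:C != 0 by case: ER => _; exact.
have Ecx : (E x%:C)^*%C != 0 by rewrite conjc_eq0.
by field; rewrite n1 n2 Ex Ecx.
Qed.

Lemma nsq0_eq0 f w : N f -> nsq ip f = 0 -> f w = 0.
Proof.
move=> Nf f0; have [c _ Hc] := sub_eval_bounded w; have := Hc f Nf.
by rewrite f0 mulr0 => h; apply/eqP; rewrite -cabs_eq0 -sqrf_eq0 eq_le sqr_ge0 andbT.
Qed.

(** [k] and [k'] are the kernels at w of the functions of N vanishing at i and at -i. The image [l]
    of [k] under the isometry must be a multiple of [k']; expanding that relation gives the
    identity. *)
Lemma kernel_identity w z : 2 * 'i%C * (w^*%C - z) * K w z =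
  (z + 'i%C) * (w^*%C - 'i%C) * K 'i%C z * (K 'i%C w)^*%C / K 'i%C 'i%C -
  (z - 'i%C) * (w^*%C + 'i%C) * K (- 'i%C) z * (K (- 'i%C) w)^*%C / K (- 'i%C) (- 'i%C).
Proof.
pose j : C := 'i%C.
have k1 := kernel_diag_neq0 j; have k2 := kernel_diag_neq0 (- j).
pose k := fsub (K w) (fscale (K w j / K j j) (K j)).
pose k' := fsub (K w) (fscale (K w (- j) / K (- j) (- j)) (K (- j))).
have Nk : N k by apply: lin_sub => //; exact: NZ.
have Nk' : N k' by apply: lin_sub => //; exact: NZ.
have kj : k j = 0 by rewrite /k /fsub /fscale divfK // subrr.
have kj' : k' (- j) = 0 by rewrite /k' /fsub /fscale divfK // subrr.
have kE g : N g -> g j = 0 -> ip g k = g w.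
  by move=> Ng gj; rewrite (ipBr PN) ?(ipZr PN) // -?(KE _ Ng) ?gj ?mulr0 ?subr0 //; exact: NZ.
have kE' g : N g -> g (- j) = 0 -> ip g k' = g w.
  by move=> Ng gj; rewrite (ipBr PN) ?(ipZr PN) // -?(KE _ Ng) ?gj ?mulr0 ?subr0 //; exact: NZ.
have [l Nl lk] := cayley_right Nk kj.
have lj : l (- j) = 0.
  have := lk (- j); rewrite addNr mul0r -opprD -mulr2n -mulr_natl => /eqP.
  by rewrite mulf_eq0 oppr_eq0 (negPf i2) => /eqP.
(* The expected proportionality, with denominators cleared so that w = i and w = -i are covered. D
   vanishes at -i, so it is the image of some g, and pairing it with itself gives (w - i) D(w) - (w
   + i) g(w) = 0. *)
pose D := fsub (fscale (w^*%C + j) k') (fscale (w^*%C - j) l).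
have ND' : N D by apply: lin_sub => //; exact: NZ.
have Dj : D (- j) = 0 by rewrite /D /fsub /fscale kj' lj !mulr0 subrr.
have cj : j^*%C = - j := conjc_i.
have DD : ip D D = 0.
  have [g Ng gD] := cayley_left ND' Dj.
  have gj : g j = 0.
    have := gD j; rewrite subrr mul0r -mulr2n -mulr_natl => /esym/eqP.
    by rewrite mulf_eq0 (negPf i2) => /eqP.
  rewrite {2}/D (ipBr PN) ?(ipZr PN) //; try exact: NZ.
  rewrite kE' // (cayley_isometry gD lk) kE // conjcD conjcB conjcK cj opprK.
  by rewrite gD subrr.
have := nsq0_eq0 z ND' (congr1 re DD); rewrite /D /fsub /fscale => /eqP; rewrite subr_eq0 => /eqP e.
have := lk z; rewrite -/j => e2.
have : (z - j) * ((w^*%C + j) * k' z) = (w^*%C - j) * ((z + j) * k z) by rewrite e -e2; ring.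
rewrite /k /k' /fsub /fscale (kernel_sym w j) (kernel_sym w (- j)).
have jj : j * j = -1 by apply: complex_ext => /=; ring.
set a := K w z; set b := K j z; set c := K (- j) z => h.
(* This splitting of the left side isolates the terms in which K_w enters through [k] and through
   [k']. *)
have -> : 2 * j * (w^*%C - z) * a = (w^*%C - j) * (z + j) * a - (z - j) * (w^*%C + j) * a by ring.
have -> : (w^*%C - j) * (z + j) * a = (w^*%C - j) * ((z + j) * (a - (K j w)^*%C / K j j * b)) +
   (w^*%C - j) * (z + j) * ((K j w)^*%C / K j j * b) by ring.
by rewrite -h; ring.
Qed.

End Kernels.
End KernelStructure.

(** * Exponential factor *)

Section InnerFactor.
Context {R : realType}.
Local Notation C := R[i].
Local Notation re := (@complex.Re R).
Local Notation im := (@complex.Im R).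
Implicit Types (f g h : C -> C) (w z : C).

Lemma holo_local f g z (r : R) : 0 < r -> (forall v, cabs (v - z) < r -> f v = g v) ->
  holomorphic_at f z -> holomorphic_at g z.
Proof.
by move=> r0 fg /holo_hasd[d hd]; apply/holo_hasd; exists d; exact: hasd_local r0 fg hd.
Qed.

Lemma ccont_neq0 f z : ccont f z -> f z != 0 ->
  exists2 r : R, 0 < r & forall v, cabs (v - z) < r -> f v != 0.
Proof.
move=> fc f0; have p : 0 < cabs (f z) by rewrite cabs_gt0.
have [r r0 Hr] := fc _ p; exists r => // v /Hr h.
rewrite -cabs_gt0; have := ler_cabs_sub (f z) (f v); rewrite cabsBC; lra.
Qed.

(** A/B^* and B/A^* agree wherever both make sense, because A A^* = B B^*. The divisor B^* has no
    zero on the closed upper half-plane and A^* none on the closed lower one, so together the two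
    quotients define U everywhere. *)
Lemma inner_factor (A B : C -> C) : entire A -> entire B ->
  (forall z, 0 < im z -> cabs (B z) < cabs (A z)) ->
  (forall z, im z < 0 -> cabs (A z) < cabs (B z)) ->
  (forall z, A z * fstar A z = B z * fstar B z) ->
  (forall x : R, A x%:C != 0) ->
  exists U : C -> C, [/\ entire U, forall z, U z != 0, forall z, A z = U z * fstar B z,
    forall z, B z = U z * fstar A z & forall z, U z * fstar U z = 1].
Proof.
move=> Ah Bh AB1 AB2 AAs Ax.
have Bx (x : R) : B x%:C != 0.
  apply: contraTneq (Ax x) => b0; have := AAs x%:C.
  rewrite b0 mul0r fstar_real => /eqP; rewrite mulf_eq0 conjc_eq0 orbb => /eqP ->.
  by rewrite eqxx.
have An z : 0 <= im z -> A z != 0.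
  case: z => x y /=; rewrite le_eqVlt => /orP[/eqP <-|y0]; first exact: Ax.
  by rewrite -cabs_gt0; apply: le_lt_trans (AB1 (x +i* y)%C y0); exact: cabs_ge0.
have Bn z : im z <= 0 -> B z != 0.
  case: z => x y /=; rewrite le_eqVlt => /orP[/eqP ->|y0]; first exact: Bx.
  by rewrite -cabs_gt0; apply: le_lt_trans (AB2 (x +i* y)%C y0); exact: cabs_ge0.
have Asn z : im z <= 0 -> fstar A z != 0.
  by move=> z0; rewrite /fstar conjc_eq0; apply: An; rewrite im_conj oppr_ge0.
have Bsn z : 0 <= im z -> fstar B z != 0.
  by move=> z0; rewrite /fstar conjc_eq0; apply: Bn; rewrite im_conj oppr_le0.
pose U z := if fstar B z == 0 then B z / fstar A z else A z / fstar B z.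
have U1 z : fstar B z != 0 -> U z = A z / fstar B z by rewrite /U => /negPf ->.
have U2 z : im z <= 0 -> U z = B z / fstar A z.
  rewrite /U => z0; case: eqP => // /eqP b0; have a0 := Asn z z0.
  by apply/eqP; rewrite eqr_div // AAs.
have lowE z : fstar B z = 0 -> im z < 0.
  by move=> b0; rewrite ltNge; apply/negP => /Bsn; rewrite b0 eqxx.
have UA z : A z = U z * fstar B z.
  have [b0|b0] := eqVneq (fstar B z) 0; last by rewrite U1 // divfK.
  have := AAs z; rewrite b0 !mulr0 => /eqP; rewrite mulf_eq0 => /orP[/eqP //|].
  by rewrite (negPf (Asn _ _)) // ltW // lowE.
have UB z : B z = U z * fstar A z.
  have [b0|b0] := eqVneq (fstar B z) 0.
    by have z0 := ltW (lowE z b0); rewrite U2 // divfK // Asn.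
  by rewrite U1 // mulrAC AAs mulfK.
have UU0 z : 0 <= im z -> U z * fstar U z = 1.
  move=> z0; apply: (mulIf (Bsn z z0)); rewrite mul1r mulrAC -UA.
  have -> : fstar B z = fstar U z * A z by rewrite /fstar (UB z^*%C) conjcM /fstar !conjcK.
  by rewrite mulrC.
have UU z : U z * fstar U z = 1.
  have [z0|z0] := leP 0 (im z); first exact: UU0.
  have := UU0 z^*%C; rewrite im_conj oppr_ge0 => /(_ (ltW z0)) /(congr1 conjc).
  by rewrite /fstar conjcM !conjcK mulrC conjc1.
have Un z : U z != 0.
  by apply/eqP => U0; have := UU z; rewrite U0 mul0r => /eqP; rewrite eq_sym oner_eq0.
exists U; split; [|exact: Un|exact: UA|exact: UB|exact: UU].
move=> z; have [b0|b0] := eqVneq (fstar B z) 0.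
  have z0 := lowE z b0; apply: (@holo_local (fun v => B v * (fstar A v)^-1) _ _ (- im z)).
  - by rewrite oppr_gt0.
  - move=> v vz; rewrite U2 //; have := cabs_im (v - z); rewrite im_add im_opp ler_norml; lra.
  - by apply: holoM (@Bh z) _; apply: holoV; [exact: (entire_star Ah)|apply: Asn; exact: ltW].
have Bsc : ccont (fstar B) z by apply: holo_ccont; exact: (entire_star Bh).
have [r r0 Hr] := ccont_neq0 Bsc b0.
apply: (@holo_local (fun v => A v * (fstar B v)^-1) _ _ r r0).
  by move=> v /Hr vb; rewrite U1.
by apply: holoM (@Ah z) _; apply: holoV b0; exact: (entire_star Bh).
Qed.

(** The hypothesis says e^(2 re L) <= m/Im z with m = n/|c|^2, and t <= e^t turns the right side
    into e^(m + 1/Im z), the one-sided bound that [log_growth] needs. *)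
Lemma log_bound (F : C -> C) (n : R) : 0 < n -> (forall z, 0 < im z -> holomorphic_at F z) ->
  (forall z, 0 < im z -> F z != 0) -> (forall z, 0 < im z -> im z * cabs (F z) ^+ 2 <= n) ->
  exists (L : C -> C) (c : C) (K : R), [/\ c != 0, 0 < K, forall z, 0 < im z -> holomorphic_at L z,
    forall z, 0 < im z -> F z = c * cexp (L z) & forall z, 0 < im z ->
    cabs (L z) <= K * (1 + cabs z ^+ 2) * ((im z)^-1 + (im z)^-1 ^+ 2)].
Proof.
move=> n0 Fh Fn Fb.
have [L [c [c0 Lh FL]]] := holomorphic_log upper_conv upper_open Fh Fn.
have cc : 0 < cabs c ^+ 2 by rewrite exprn_gt0 // cabs_gt0.
pose m := n / cabs c ^+ 2; have m0 : 0 < m by rewrite divr_gt0.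
have Lm z : 0 < im z -> re (L z) <= m + (im z)^-1.
  move=> z0; have y0 : 0 < (im z)^-1 by rewrite invr_gt0.
  suff : expR (re (L z) + re (L z)) <= expR (m + (im z)^-1).
    by rewrite ler_expR; lra.
  have := Fb z z0; rewrite FL // cabsM exprMn cabs_cexp => h.
  rewrite expRD -expr2; have {h} : expR (re (L z)) ^+ 2 <= m * (im z)^-1.
    rewrite ler_pdivlMr // ler_pdivlMr //; apply: le_trans h; lra.
  move=> h; apply: (le_trans h); rewrite expRD; apply: ler_pM; rewrite ?ltW //.
    by have := expR_ge1Dx m; lra.
  by have := expR_ge1Dx (im z)^-1; lra.
have [K K0 HK] := log_growth (ltW m0) Lh Lm.
by exists L, c, K; split.
Qed.

(** It absorbs additive constants into the growth bound. *)
Lemma growth_ge1 z (t : R) : t = `|im z|^-1 -> im z != 0 -> 1 <= (1 + cabs z ^+ 2) * (t + t ^+ 2).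
Proof.
move=> tE z0; have a0 : 0 < `|im z| by rewrite normr_gt0.
have t0 : 0 < t by rewrite tE invr_gt0.
have h : `|im z| ^+ 2 <= cabs z ^+ 2.
  by apply: lerXn2r; rewrite ?nnegrE ?cabs_ge0 ?normr_ge0 ?cabs_im.
have e : `|im z| ^+ 2 * t ^+ 2 = 1 by rewrite -exprMn tE mulfV ?gt_eqF // expr1n.
have s0 : 0 <= t ^+ 2 := sqr_ge0 t.
have := ler_wpM2r s0 h; have := sqr_ge0 (cabs z); nra.
Qed.

Lemma exponential_factor (U F1 F2 : C -> C) (k : C) (n : R) : entire U -> (forall z, U z != 0) ->
  (forall z, U z * fstar U z = 1) -> 0 < n -> k != 0 ->
  (forall z, 0 < im z -> holomorphic_at F1 z) -> (forall z, 0 < im z -> F1 z != 0) ->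
  (forall z, 0 < im z -> im z * cabs (F1 z) ^+ 2 <= n) ->
  (forall z, 0 < im z -> holomorphic_at F2 z) -> (forall z, 0 < im z -> F2 z != 0) ->
  (forall z, 0 < im z -> im z * cabs (F2 z) ^+ 2 <= n) ->
  (forall z, 0 < im z -> F1 z = k * U z * F2 z) ->
  exists (c : C) (a : R), c * c^*%C = 1 /\ forall z, U z = c * cexp ('i%C * (2 * a)%:C * z).
Proof.
move=> Uh Un UU n0 k0 h1 n1 b1 h2 n2 b2 F12.
have [G [c [c0 Gh UG]]] := holomorphic_log (@whole_conv R) (@whole_open R)
  (fun z _ => @Uh z) (fun z _ => Un z).
have [L1 [c1 [K1 [c10 K10 L1h L1E L1K]]]] := log_bound n0 h1 n1 b1.
have [L2 [c2 [K2 [c20 K20 L2h L2E L2K]]]] := log_bound n0 h2 n2 b2.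
have Ge : entire G by move=> z; exact: Gh.
pose H z := L1 z + - (L2 z) + - (G z).
have holoN f z : holomorphic_at f z -> holomorphic_at (fun v => - f v) z.
  by move=> /holo_hasd[a ha]; apply/holo_hasd; eexists; exact: hasdN ha.
have Hh z : 0 < im z -> holomorphic_at H z.
  move=> z0; apply: (@holoD _ (fun v => L1 v + - L2 v) (fun v => - G v)); last by apply: holoN; exact: Gh.
  by apply: (@holoD _ L1 (fun v => - L2 v)); [exact: L1h|apply: holoN; exact: L2h].
have HE z : 0 < im z -> cexp (H z) = k * c * c2 / c1.
  move=> z0; have := F12 z z0; rewrite L1E // L2E // UG // => e.
  rewrite /H !cexpD !cexpN.
  have -> : cexp (L1 z) = k * (c * cexp (G z)) * (c2 * cexp (L2 z)) / c1 by rewrite -e mulrC mulKf.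
  by field; rewrite !cexp_neq0 c10.
(* The three logarithms differ by a constant above the axis, so the growth of L1 and L2 passes to
   G. *)
have Hc z : 0 < im z -> H z = H 'i%C.
  by move=> z0; apply: (cexp_cst upper_conv upper_open Hh HE) => //=; exact: ltr01.
pose m := cabs (H 'i%C).
have Gup z : 0 < im z -> cabs (G z) <=
    (K1 + K2 + m) * (1 + cabs z ^+ 2) * ((im z)^-1 + (im z)^-1 ^+ 2).
  move=> z0; have e := Hc z z0.
  have -> : G z = (L1 z - L2 z) - H 'i%C by rewrite -e /H; ring.
  have zE : `|im z|^-1 = (im z)^-1 by rewrite gtr0_norm.
  have g1 := growth_ge1 (esym zE) (lt0r_neq0 z0).
  have m0 : 0 <= m := cabs_ge0 _.
  have := ler_wpM2l m0 g1; rewrite mulr1.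
  have := ler_cabsB (L1 z - L2 z) (H 'i%C); have := ler_cabsB (L1 z) (L2 z).
  have := L1K z z0; have := L2K z z0; rewrite -/m.
  set t := (im z)^-1 + _; set s := 1 + cabs z ^+ 2; lra.
have GG z : cexp (G z + fstar G z) = (c * c^*%C)^-1.
  have := UU z; rewrite /fstar !UG // conjcM -cexp_conj cexpD => e.
  have cc0 : c^*%C != 0 by rewrite conjc_eq0.
  apply: (mulfI (mulf_neq0 c0 cc0)); rewrite divff ?mulf_neq0 // -[RHS]e; ring.
(* The logarithmic form of U U^* = 1; it gives the bound below the axis by reflection. *)
have GGc z : G z + fstar G z = G 0 + fstar G 0.
  have hh v : True -> holomorphic_at (fun v => G v + fstar G v) v.
    by move=> _; apply: holoD; [exact: Gh|exact: (entire_star Ge)].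
  exact: (cexp_cst (@whole_conv R) (@whole_open R) hh (fun v _ => GG v) I I).
pose m2 := cabs (G 0 + fstar G 0).
have m20 : 0 <= m2 := cabs_ge0 _.
have m0 : 0 <= m := cabs_ge0 _.
pose K := K1 + K2 + m + m2.
have K0 : 0 < K by rewrite /K; lra.
have Gb z : im z != 0 -> cabs (G z) <= K * (1 + cabs z ^+ 2) * (`|im z|^-1 + `|im z|^-1 ^+ 2).
  move=> zn; have g1 := growth_ge1 (erefl _) zn.
  have := ler_wpM2l m20 g1; rewrite mulr1.
  have [z0|z0|] := ltrgtP (im z) 0; last by move=> e; rewrite e eqxx in zn.
    have -> : G z = (G 0 + fstar G 0) - fstar G z by rewrite -(GGc z); ring.
    have := ler_cabsB (G 0 + fstar G 0) (fstar G z).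
    have := Gup z^*%C; rewrite im_conj oppr_gt0 => /(_ z0); rewrite cabs_conj ltr0_norm //.
    rewrite [cabs (fstar G z)]cabs_conj -/m2 /K.
    set t := (- im z)^-1 + _; set s := 1 + cabs z ^+ 2; lra.
  have := Gup z z0; rewrite gtr0_norm // /K.
  set t := (im z)^-1 + _; set s := 1 + cabs z ^+ 2; lra.
have [g0 [g1 GE]] := liouville_linear K0 Ge Gb.
(* Comparing G + G^* at 1 and at 0 gives re g1 = 0. *)
have g1i : g1 = 'i%C * (2 * (im g1 / 2))%:C.
  have := GGc 1; rewrite /fstar !GE conjc1 conjc0 !mulr0 !mulr1 !addr0 conjcD => /(congr1 re).
  rewrite !(re_add, re_conj) => h; apply: complex_ext => /=; last by field.
  by rewrite mul0r mul1r sub0r oppr0; lra.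
exists (c * cexp g0), (im g1 / 2); split.
  have := GG 0; rewrite /fstar conjc0 !GE mulr0 addr0 cexpD cexp_conj => e.
  have cc0 : c^*%C != 0 by rewrite conjc_eq0.
  rewrite conjcM mulrACA e divff // mulf_neq0 //.
by move=> z; rewrite UG // GE cexpD -g1i mulrA.
Qed.

End InnerFactor.

(** * Division of a Hilbert space of functions by a zero-free factor *)

Section Multiplier.
Context {R : realType}.
Local Notation C := R[i].
Local Notation re := (@complex.Re R).
Local Notation im := (@complex.Im R).
Implicit Types (f g : C -> C) (w z : C).
Variables (m : C -> C) (H : set (C -> C)) (ip : (C -> C) -> (C -> C) -> C).
Hypotheses (mn : forall z, m z != 0) (PH : prehilbert H ip).

Definition fmul f : C -> C := fun z => m z * f z.
Definition mul_preim : set (C -> C) := [set f | H (fmul f)].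
(** The inner product for which multiplication by m is unitary from [mul_preim] onto H. *)
Definition mul_ip f g := ip (fmul f) (fmul g).

Let mulD f g : fmul (fadd f g) = fadd (fmul f) (fmul g).
Proof. by apply/funext => z; rewrite /fmul /fadd mulrDr. Qed.
Let mulZ c f : fmul (fscale c f) = fscale c (fmul f).
Proof. by apply/funext => z; rewrite /fmul /fscale mulrCA. Qed.
Let mulB f g : fmul (fsub f g) = fsub (fmul f) (fmul g).
Proof. by apply/funext => z; rewrite /fmul /fsub mulrBr. Qed.

Lemma mul_prehilbert : prehilbert mul_preim mul_ip.
Proof.
have [h0 hD hZ] := ph_lin PH.
split.
- split; rewrite /mul_preim /=.
  + by rewrite (_ : fmul _ = fun=> 0) //; apply/funext => z; rewrite /fmul mulr0.
  + by move=> f g Hf Hg; rewrite -[fun z => _]/(fadd f g) mulD; exact: hD.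
  + by move=> c f Hf; rewrite -[fun z => _]/(fscale c f) mulZ; exact: hZ.
- by move=> f g h *; rewrite /mul_ip mulD (ph_add PH).
- by move=> c f h *; rewrite /mul_ip mulZ (ph_scale PH).
- by move=> f g *; rewrite /mul_ip (ph_conj PH).
- by move=> f *; apply: (ph_ge0 PH).
Qed.

Lemma mul_complete : hcomplete ip H -> hcomplete mul_ip mul_preim.
Proof.
move=> Hc u uH uc.
have nE f g : nsq mul_ip (fsub f g) = nsq ip (fsub (fmul f) (fmul g)).
  by rewrite /nsq /mul_ip mulB.
have [|f Hf fl] := Hc (fun n => fmul (u n)) uH.
  by move=> e /uc[N HN]; exists N => n k Nn Nk; rewrite -nE HN.
have fE : fmul (fun z => f z / m z) = f by apply/funext => z; rewrite /fmul mulrC divfK.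
exists (fun z => f z / m z); first by rewrite /mul_preim /= fE.
by move=> e /fl[N HN]; exists N => n Nn; rewrite nE fE HN.
Qed.

Lemma mul_eval_bounded : eval_bounded ip H -> eval_bounded mul_ip mul_preim.
Proof.
move=> He w; have [c c0 Hc] := He w.
have m0 : 0 < cabs (m w) ^+ 2 by rewrite exprn_gt0 // cabs_gt0.
exists (c / cabs (m w) ^+ 2); first by rewrite divr_ge0 // ltW.
move=> f Hf; rewrite [leRHS]mulrAC ler_pdivlMr // mulrC -exprMn -cabsM.
exact: Hc _ Hf.
Qed.

End Multiplier.

(** * The pair A, B attached to the kernels of N *)

Section Assembly.
Context {R : realType}.
Local Notation C := R[i].
Local Notation re := (@complex.Re R).
Local Notation im := (@complex.Im R).
Implicit Types (f g : C -> C) (w z : C).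

Definition de_branges_pair (K : C -> C -> C) (A B : C -> C) := forall w z,
  A z * (A w)^*%C - B z * (B w)^*%C = 2 * 'i%C * pi%:C * (w^*%C - z) * K w z.

Section Pair.
Variables (E : C -> C) (N : set (C -> C)) (K : C -> C -> C).
Hypotheses (ER : db_regular E) (Nc : closed_subspace E N).
Hypotheses (Nz : no_common_zeros N) (Ni : nearly_invariant N).
Hypothesis HK : forall w, N (K w) /\ forall f, N f -> f w = dbip E f (K w).

Let Kh w : entire (K w).
Proof. by case: Nc => NE _ _; case: (HK w) => /NE[]. Qed.

Lemma pair_exists : exists a b : R, [/\ 0 < a, 0 < b &
  de_branges_pair K (fun z => a%:C * ((z + 'i%C) * K 'i%C z))
                    (fun z => b%:C * ((z - 'i%C) * K (- 'i%C) z))].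
Proof.
have [k1 n1] := kernel_diag ER Nc Nz HK 'i%C.
have [k2 n2] := kernel_diag ER Nc Nz HK (- 'i%C).
have p0 := pi_gt0 R.
set n := nsq _ _ in k1 n1; set n' := nsq _ _ in k2 n2.
(* The squares supply the factor pi and the divisors K_i(i) and K_{-i}(-i) of [kernel_identity]. *)
exists (Num.sqrt (pi / n)), (Num.sqrt (pi / n')).
split; rewrite ?sqrtr_gt0 ?divr_gt0 // => w z.
rewrite !conjcM !conjcD !conjc_real conjc_i conjc_Ni.
have := kernel_identity ER Nc Nz Ni HK w z; rewrite k1 k2 => e.
have sE (t : R) : 0 < t -> (Num.sqrt (pi / t))%:C * (Num.sqrt (pi / t))%:C = pi%:C * t%:C^-1 :> C.
  move=> t0; rewrite -rmorphM -expr2 sqr_sqrtr ?divr_ge0 ?ltW //=.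
  by rewrite rmorphM fmorphV.
rewrite [RHS](_ : _ = pi%:C * (2 * 'i%C * (w^*%C - z) * K w z)); last by ring.
have := sE n n1; have := sE n' n2.
set s := (Num.sqrt _)%:C; set t := (Num.sqrt (pi / n))%:C => s2 t2.
rewrite e.
rewrite (_ : t * ((z + 'i%C) * K 'i%C z) * _ = t * t * ((z + 'i%C) * (w^*%C - 'i%C) * K 'i%C z * (K 'i%C w)^*%C)); last by ring.
rewrite (_ : s * ((z - 'i%C) * K (- 'i%C) z) * _ = s * s * ((z - 'i%C) * (w^*%C + 'i%C) * K (- 'i%C) z * (K (- 'i%C) w)^*%C)); last by ring.
by rewrite s2 t2; ring.
Qed.

Variables (A B : C -> C).
Hypotheses (Ah : entire A) (Bh : entire B) (AB : de_branges_pair K A B).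

Lemma pair_diag z : exists2 n : R, 0 < n & cabs (A z) ^+ 2 - cabs (B z) ^+ 2 = 4 * pi * im z * n.
Proof.
have [k n0] := kernel_diag ER Nc Nz HK z.
exists (nsq (dbip E) (K z)) => //.
have := AB z z; rewrite k !mulc_conj => /(congr1 re).
rewrite re_add re_opp /= => ->; case: z {k n0} => x y /=; ring.
Qed.

Lemma pair_upper z : 0 < im z -> cabs (B z) < cabs (A z).
Proof.
move=> z0; have [n n0 e] := pair_diag z.
rewrite -(@ltr_pXn2r _ 2) ?nnegrE ?cabs_ge0 // -subr_gt0 e.
by rewrite !mulr_gt0 // pi_gt0.
Qed.

Lemma pair_lower z : im z < 0 -> cabs (A z) < cabs (B z).
Proof.
move=> z0; have [n n0 e] := pair_diag z.
rewrite -(@ltr_pXn2r _ 2) ?nnegrE ?cabs_ge0 // -subr_lt0 e.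
by rewrite pmulr_llt0 // nmulr_llt0 // mulr_gt0 // pi_gt0.
Qed.

Lemma pair_star z : A z * fstar A z = B z * fstar B z.
Proof.
have := AB z^*%C z; rewrite conjcK subrr mulr0 mul0r => /eqP.
by rewrite subr_eq0 => /eqP.
Qed.

(** On the real line |A| = |B|, so a zero of A would be one of B. Then K_x would vanish off x, and
    by continuity at x, against the positivity of its diagonal. *)
Lemma pair_real (x : R) : A x%:C != 0.
Proof.
apply/negP => /eqP Ax; have [n n0] := pair_diag x%:C.
rewrite Ax cabs0 expr0n /= mulr0 mul0r sub0r => /eqP; rewrite oppr_eq0 sqrf_eq0 cabs_eq0 => /eqP Bx.
have /negP := kernel_diag_neq0 ER Nc Nz HK x%:C; apply; apply/eqP.
apply: (vanish_real (k := 0) (d := 1)) => //; first exact: holo_ccont (@Kh x%:C x%:C).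
move=> y /andP[y0 _]; have := AB x%:C (x +i* y)%C.
rewrite Ax Bx conjc0 !mulr0 subrr conjc_real => /esym/eqP; rewrite mulf_eq0 => /orP[|/eqP ->].
  rewrite mulf_eq0 (negPf (@ipi_neq0 R)) /= => /eqP/(congr1 im) /=; lra.
by rewrite cabs0 expr0n mul0r.
Qed.

End Pair.
End Assembly.

(** * The exponential form of A/B^* for the pair *)

Section ExponentialFactor.
Context {R : realType}.
Local Notation C := R[i].
Local Notation re := (@complex.Re R).
Local Notation im := (@complex.Im R).
Implicit Types (f g : C -> C) (w z : C).

Definition expmul (a : R) z : C := cexp ('i%C * a%:C * z).

Lemma holo_expmul a z : holomorphic_at (expmul a) z.
Proof. by apply: holo_cexp; apply: holoM; [exact: holo_cst|exact: holo_id]. Qed.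

Lemma expmul_neq0 a z : expmul a z != 0. Proof. exact: cexp_neq0. Qed.

Lemma fstar_expmul a z : fstar (expmul a) z = (expmul a z)^-1.
Proof.
rewrite /fstar /expmul -cexp_conj !conjcM conjcK conjc_real -cexpN; congr cexp.
by rewrite conjc_i !mulNr.
Qed.

Lemma expmul_double a z : cexp ('i%C * (2 * a)%:C * z) = expmul a z ^+ 2.
Proof. by rewrite /expmul expr2 -cexpD; congr cexp; rewrite rmorphM /= rmorph_nat; ring. Qed.

(** B^* also carries the factor z + i, which cancels in A = U B^*. What remains relates K_i/E to
    (K_{-i})^*/E, both quotients of elements of H(E), with constant b/a. *)
Lemma pair_growth (E : C -> C) (N : set (C -> C)) (K : C -> C -> C) (a b : R) (U : C -> C) :
  db_regular E -> N `<=` db_space E -> (forall w, N (K w)) -> 0 < a -> 0 < b ->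
  let A z := a%:C * ((z + 'i%C) * K 'i%C z) in
  let B z := b%:C * ((z - 'i%C) * K (- 'i%C) z) in
  (forall z, 0 < im z -> A z != 0) -> (forall z, 0 < im z -> fstar B z != 0) ->
  entire U -> (forall z, U z != 0) -> (forall z, U z * fstar U z = 1) ->
  (forall z, A z = U z * fstar B z) ->
  exists (c : C) (al : R), c * c^*%C = 1 /\ forall z, U z = c * expmul al z ^+ 2.
Proof.
move=> ER NE NK a0 b0 A B An Bn Uh Un UU UA.
have PE := db_prehilbert ER.
have k1 := NE _ (NK 'i%C); have k2 := db_star (NE _ (NK (- 'i%C))).
have q1 := nsq_ge0 PE k1; have q2 := nsq_ge0 PE k2.
pose n := nsq (dbip E) (K 'i%C) + nsq (dbip E) (fstar (K (- 'i%C))) + 1.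
have n0 : 0 < n by rewrite /n; lra.
have bound f z : db_space E f -> nsq (dbip E) f <= n -> 0 < im z ->
    im z * cabs (quot E f z) ^+ 2 <= n.
  move=> fE fn z0; have Ez : 0 < cabs (E z) by rewrite cabs_gt0 db_neq0 // ltW.
  rewrite /quot cabs_div expr_div_n mulrA ler_pdivrMr ?exprn_gt0 //.
  apply: le_trans (db_upper_bound ER fE z0) _; rewrite mulrC.
  by apply: ler_wpM2r; rewrite ?sqr_ge0.
have hol f z : db_space E f -> 0 < im z -> holomorphic_at (quot E f) z.
  by case=> fh _ _ _ z0; apply: (quot_uhol ER) => //; exact: ltW.
have Ez z : 0 < im z -> E z != 0 by move=> z0; apply: (db_neq0 ER); exact: ltW.
have ac : a%:C != 0 :> C by rewrite fmorph_eq0 gt_eqF.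
have bc : b%:C != 0 :> C by rewrite fmorph_eq0 gt_eqF.
have sB z : fstar B z = b%:C * ((z + 'i%C) * fstar (K (- 'i%C)) z).
  rewrite /fstar /B !conjcM conjcB conjcK conjc_real.
  by rewrite conjc_i opprK.
have zi z : 0 < im z -> z + 'i%C != 0.
  by move=> z0; apply/eqP => /(congr1 im); rewrite im_add /=; lra.
have [c [al [c1 UE]]] : exists (c : C) (al : R), c * c^*%C = 1 /\
    forall z, U z = c * cexp ('i%C * (2 * al)%:C * z).
  apply: (@exponential_factor _ U (quot E (K 'i%C)) (quot E (fstar (K (- 'i%C)))) (b%:C / a%:C) n).
  - exact: Uh.
  - exact: Un.
  - exact: UU.
  - exact: n0.
  - by rewrite mulf_neq0 ?invr_eq0.
  - by move=> z; exact: hol.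
  - move=> z z0; rewrite /quot mulf_neq0 ?invr_eq0 ?Ez //.
    by have := An z z0; rewrite /A !mulf_eq0 !negb_or => /andP[_ /andP[_]].
  - by move=> z; apply: bound => //; rewrite /n; lra.
  - by move=> z; exact: hol.
  - move=> z z0; rewrite /quot mulf_neq0 ?invr_eq0 ?Ez //.
    by have := Bn z z0; rewrite sB !mulf_eq0 !negb_or => /andP[_ /andP[_]].
  - by move=> z; apply: bound => //; rewrite /n; lra.
  - move=> z z0; have := UA z; rewrite sB /A /quot => e; have zi0 := zi z z0.
    have -> : K 'i%C z = a%:C * ((z + 'i%C) * K 'i%C z) / (a%:C * (z + 'i%C)).
      by field; rewrite ac zi0.
    by rewrite e; field; rewrite ac zi0 Ez.
by exists c, al; split=> // z; rewrite UE expmul_double.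
Qed.

End ExponentialFactor.

(** * Identification of N with the shifted de Branges space *)

Theorem theorem1p1 (R : realType) (E : R[i] -> R[i]) (N : set (R[i] -> R[i])) :
  de_branges_function E ->
  closed_subspace E N ->
  no_common_zeros N ->
  nearly_invariant N ->
  exists (E0 : R[i] -> R[i]) (alpha : R),
    de_branges_function E0 /\ N = exp_shift alpha (db_space E0).
Proof.
move=> Edb Nc Nz Ni; have [NE Nlin _] := Nc.
have ER := no_common_zeros_regular Edb NE Nz.
have [K HK] := sub_kernels ER Nc.
have NK w : N (K w) by case: (HK w).
have KE w f : N f -> f w = dbip E f (K w) by case: (HK w) => _; exact.
have Kh w : entire (K w) by have [] := NE _ (NK w).
have [a [b [a0 b0]]] := pair_exists ER Nc Nz Ni HK.
set A := fun z => a%:C * _; set B := fun z => b%:C * _; move=> AB.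
have holoS (c z : R[i]) : holomorphic_at (fun v => v + c) z.
  by apply: holoD; [exact: holo_id|exact: holo_cst].
have Ah : entire A.
  move=> z; apply: holoM; first exact: holo_cst.
  by apply: holoM; [exact: holoS|exact: Kh].
have Bh : entire B.
  move=> z; apply: holoM; first exact: holo_cst.
  by apply: holoM; [exact: holoS|exact: Kh].
have up := pair_upper ER Nc Nz HK AB.
have low := pair_lower ER Nc Nz HK AB.
have Ax := pair_real ER Nc Nz HK AB.
have [U [Uh Un UA UB UU]] := inner_factor Ah Bh up low (pair_star AB) Ax.
have An z : 0 < complex.Im z -> A z != 0.
  by move=> z0; rewrite -cabs_gt0; apply: le_lt_trans (up z z0); exact: cabs_ge0.
have Bn z : 0 < complex.Im z -> fstar B z != 0.
  move=> z0; rewrite /fstar conjc_eq0 -cabs_gt0; apply: le_lt_trans (low z^*%C _).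
    exact: cabs_ge0.
  by rewrite im_conj oppr_lt0.
have [c [al [c1 UE]]] := pair_growth ER NE NK a0 b0 An Bn Uh Un UU UA.
pose m := expmul al; have mn z : m z != 0 by exact: expmul_neq0.
have cn : c != 0 by apply/eqP => cz; move: c1; rewrite cz mul0r => /eqP; rewrite eq_sym oner_eq0.
pose E0 z := A z / m z.
have E0h : entire E0.
  by move=> z; apply: holoM; [exact: Ah|apply: holoV => //; exact: holo_expmul].
(* The reflection of m is 1/m, so E0^* = m A^*, and B = c m^2 A^*. *)
have E0s z : fstar E0 z = B z / (c * m z).
  have -> : fstar E0 z = fstar A z * m z.
    by rewrite /fstar /E0 conjcM conjc_inv -/(fstar m z) fstar_expmul invrK.
  by rewrite (UB z) UE /m; field; rewrite cn expmul_neq0.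
have cabsc : cabs c = 1.
  apply/eqP; rewrite -(@eqrXn2 _ 2) ?cabs_ge0 // expr1n; apply/eqP.
  by have := congr1 (@complex.Re R) c1; rewrite mulc_conj.
have E0db : de_branges_function E0.
  split=> // z z0; rewrite -[cabs (E0 _)]cabs_conj -/(fstar E0 z) E0s !cabs_div cabsM cabsc mul1r.
  by rewrite ltr_pM2r ?up // invr_gt0 cabs_gt0.
have E0R : db_regular E0.
  by split=> // x; rewrite /E0 mulf_neq0 ?invr_eq0 ?Ax ?mn.
(* As |c| = 1, the numerator is that of the pair A, B divided by m(z) and by the conjugate of m(w):
   the kernel of N after division by m. *)
have kerE w z : z != w^*%C -> dbkernel E0 w z = K w z / (m z * (m w)^*%C).
  move=> zw; have wz : w^*%C - z != 0 by rewrite subr_eq0 eq_sym.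
  have ip0 := @ipi_neq0 R; have mc : (m w)^*%C != 0 by rewrite conjc_eq0.
  have cc : c^*%C != 0 by rewrite conjc_eq0.
  have e1 : (A w / m w)^*%C = (A w)^*%C / (m w)^*%C by rewrite [LHS]conjcM conjc_inv.
  have e2 : (B w / (c * m w))^*%C = (B w)^*%C / (c^*%C * (m w)^*%C).
    by rewrite [LHS]conjcM conjc_inv [(c * _)^*%C]conjcM.
  rewrite /dbkernel !E0s /E0 e1 e2.
  have -> : A z / m z * ((A w)^*%C / (m w)^*%C) - B z / (c * m z) * ((B w)^*%C / (c^*%C * (m w)^*%C))
      = (A z * (A w)^*%C - B z * (B w)^*%C / (c * c^*%C)) / (m z * (m w)^*%C).
    by field; rewrite mn mc cn cc.
  rewrite c1 divr1 AB; move: ip0; set t := 2 * _ * _ => ip0.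
  by field; rewrite mn mc wz ip0.
pose K0 w z := K w z / (m z * (m w)^*%C).
have K0h w : entire (K0 w).
  move=> z; apply: holoM; first exact: Kh.
  apply: holoV; last by rewrite mulf_neq0 ?conjc_eq0.
  by apply: holoM; [exact: holo_expmul|exact: holo_cst].
have mK w : fmul m (K0 w) = fscale ((m w)^*%C)^-1 (K w).
  by apply/funext => z; rewrite /fmul /K0 /fscale; field; rewrite mn conjc_eq0 mn.
have PN := prehilbert_sub (db_prehilbert ER) NE Nlin.
have P1 := mul_prehilbert m PN.
have C1 := mul_complete mn (closed_complete ER Nc).
have B1 := mul_eval_bounded mn (sub_eval_bounded ER Nc).
have P2 := db_prehilbert E0R.
have C2 := db_complete E0R.
have B2 := db_eval_bounded E0R.
(* The reproducing formula of H(E0) is available at nonreal points; a function of either space that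
   vanishes at all of them is 0 by continuity. *)
pose S : set R[i] := [set w | complex.Im w != 0].
have KH w : S w -> mul_preim m N (K0 w) /\ db_space E0 (K0 w).
  move=> Sw; split.
    by rewrite /mul_preim /= mK; case: Nlin => _ _ h; exact: h.
  by apply: (db_kernel_mem E0R Sw (@K0h w)) => z zw; rewrite kerE.
have R1 w f : S w -> mul_preim m N f -> f w = mul_ip m (dbip E) f (K0 w).
  move=> _ Nf; rewrite /mul_ip mK (ipZr PN) // -(KE w) //.
  by rewrite conjc_inv conjcK /fmul mulKf.
have R2 w f : S w -> db_space E0 f -> f w = dbip E0 f (K0 w).
  move=> Sw fE; apply: (db_reproducing E0R Sw fE) => x; rewrite kerE //.
  by apply: real_neq; rewrite im_conj oppr_eq0.
have V1 f : mul_preim m N f -> (forall w, S w -> f w = 0) -> forall w, f w = 0.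
  move=> /NE[fh _ _ _] f0 w; apply: (mulfI (mn w)); rewrite mulr0.
  apply: (@vanish_nonreal _ (fmul m f) w); first exact: holo_ccont (@fh w).
  by move=> v /f0 fv; rewrite /fmul fv mulr0.
have V2 f : db_space E0 f -> (forall w, S w -> f w = 0) -> forall w, f w = 0.
  by move=> [fh _ _ _] f0 w; apply: vanish_nonreal => //; exact: holo_ccont (@fh w).
have S12 := same_kernel_sub P1 P2 C1 C2 B1 B2 KH R1 R2 V1.
have KH' w : S w -> db_space E0 (K0 w) /\ mul_preim m N (K0 w) by move=> /KH[].
have S21 := same_kernel_sub P2 P1 C2 C1 B2 B1 KH' R2 R1 V2.
exists E0, al; split=> //; apply/seteqP; split=> [f Nf|_ [f fE <-]]; last exact: S21.
exists (fun z => f z / m z).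
  apply: S12; rewrite /mul_preim /=.
  by rewrite (_ : fmul _ _ = f) //; apply/funext => z; rewrite /fmul mulrC divfK.
by apply/funext => z; rewrite -[cexp _]/(m z) mulrC divfK.
Qed.
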